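(* Let $B$ and $B'$ be two perfect bases of $U_q^-(\mathfrak g)$. Then the identity map of $U_q^-(\mathfrak g)$ induces a perfect isomorphism from $(U_q^-(\mathfrak g),B)$ to $(U_q^-(\mathfrak g),B')$; that is, there exist a unique crystal isomorphism $\tilde\phi:B\to B'$ and a unique map $c:B\setminus\{\mathbf 1\}\to\mathbb{Q}(q)^\times$ such that $\tilde\phi(\mathbf 1)=\mathbf 1$ and $$b-c(b)\tilde\phi(b)\prec_{\mathbf i}b$$ for each $b\in B\setminus\{\mathbf 1\}$ and any sequence $\mathbf i=(i_1,\dots,i_m)$ with $\mathsf e_{\mathbf i}^{top}(b)=\mathbf 1$.
   Context: **Datum and quantum group.** $I$ is a countable index set and $A=(a_{ij})_{i,j\in I}$ is an integer matrix with $a_{ii}=2$ or $a_{ii}\in 2\mathbb{Z}_{\le 0}$, $a_{ij}\le 0$ for $i\ne j$, $a_{ij}=0\iff a_{ji}=0$. $I^{re}=\{i:a_{ii}=2\}$, $I^{im}=I\setminus I^{re}$. Positive integers $s_i$ with $s_ia_{ij}=s_ja_{ji}$ are fixed. $(A,P,\Pi,\Pi^\vee)$ is a Borcherds-Cartan datum: $P$ a free abelian group, $\Pi=\{\alpha_i\}\subset P$ linearly independent, $\Pi^\vee=\{h_i\}\subset P^\vee=\mathrm{Hom}(P,\mathbb{Z})$, $\langle h_i,\alpha_j\rangle=a_{ij}$, and for each $i$ there is $\Lambda_i\in P$ with $\langle h_j,\Lambda_i\rangle=\delta_{ij}$. $Q^+=\sum\mathbb{Z}_{\ge0}\alpha_i$,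 $Q^-=-Q^+$. $q$ is an indeterminate, $q_i=q^{s_i}$, and for $i\in I^{re}$ $\left[{m\atop n}\right]_i$ is the usual $q_i$-binomial coefficient ($[n]_i=\frac{q_i^n-q_i^{-n}}{q_i-q_i^{-1}}$). $U_q(\mathfrak g)$ is the $\mathbb{Q}(q)$-algebra generated by $e_i,f_i$ ($i\in I$), $q^h$ ($h\in P^\vee$) with relations $q^0=1$, $q^hq^{h'}=q^{h+h'}$; $q^he_iq^{-h}=q^{\langle h,\alpha_i\rangle}e_i$, $q^hf_iq^{-h}=q^{-\langle h,\alpha_i\rangle}f_i$; $e_if_j-f_je_i=\delta_{ij}\frac{K_i-K_i^{-1}}{q_i-q_i^{-1}}$, $K_i=q^{s_ih_i}$; $\sum_{r=0}^{1-a_{ij}}(-1)^r\left[{1-a_{ij}\atop r}\right]_ie_i^{1-a_{ij}-r}e_je_i^r=0$ and likewise for $f$, if $i\in I^{re}$, $i\ne j$; $e_ie_j=e_je_i$, $f_if_j=f_jf_i$ if $a_{ij}=0$. $U_q^-(\mathfrak g)$ is the subalgebra generated by the $f_i$; it is graded by $Q^-$ with $f_i\in U_q^-(\mathfrak g)_{-\alpha_i}$, and $\mathbf 1$ denotes its unit. For $x\in U_q^-(\mathfrak g)$ there are unique $y,z\in U_q^-(\mathfrak g)$ with $e_ix-xe_i=\frac{K_iy-K_i^{-1}z}{q_i-q_i^{-1}}$; set $e_i'(x)=z$. Then $e_i'(\mathbf 1)=0$ and $e_i'(f_jx)=\delta_{ij}x+q_i^{-a_{ij}}f_je_i'(x)$.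 **Perfect bases.** For $v\in U_q^-(\mathfrak g)$, $\ell_i(v)=\min\{n\in\mathbb{Z}_{\ge0}:e_i'^{\,n+1}v=0\}$; $U_q^-(\mathfrak g)_i^{<k}$ denotes the space of $v$ with $e_i'^{\,k}v=0$ (i.e. $v=0$ or $\ell_i(v)<k$). A $\mathbb{Q}(q)$-basis $B$ of $U_q^-(\mathfrak g)$ is perfect if (1) $B=\bigsqcup_{\mu\in Q^-}B_\mu$ with $B_\mu=B\cap U_q^-(\mathfrak g)_\mu$; (2) for $b\in B$, $i\in I$ with $e_i'(b)\ne0$ there is a unique $\mathsf e_i(b)\in B$ with $e_i'(b)\in c\,\mathsf e_i(b)+U_q^-(\mathfrak g)_i^{<\ell_i(b)-1}$ for some $c\in\mathbb{Q}(q)^\times$; (3) if $\mathsf e_i(b)=\mathsf e_i(b')$ for $b,b'\in B$, then $b=b'$. Put $\mathsf e_i(b)=0$ if $e_i'(b)=0$. Perfect bases are taken to satisfy $\mathbb{Q}(q)\mathbf 1\cap B=\{\mathbf 1\}$. **Crystal of a perfect basis.** $\mathrm{wt}(b)=\mu$ for $b\in B_\mu$; $\mathsf f_i(b)=b'$ if $\mathsf e_i(b')=b$, and $0$ if there is no such $b'$; $\varepsilon_i(b)=\ell_i(b)$ if $i\in I^{re}$ and $0$ if $i\in I^{im}$; $\varphi_i(b)=\varepsilon_i(b)+\langle h_i,\mathrm{wt}(b)\rangle$. Then $(B,\mathrm{wt},\mathsf e_i,\mathsf f_i,\varepsilon_i,\varphi_i)$ is an abstract crystal. A crystal morphism $\phi:B_1\to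 B_2\sqcup\{0\}$ satisfies: if $\phi(b)\in B_2$ then $\mathrm{wt},\varepsilon_i,\varphi_i$ of $\phi(b)$ and $b$ agree; and if $b$ and $\mathsf f_ib$ lie in $B_1$ then $\mathsf f_i\phi(b)=\phi(\mathsf f_ib)$ (with $\mathsf f_i 0=0$). A crystal isomorphism is a bijective crystal morphism $B_1\to B_2$. **The relation $\preceq_{\mathbf i}$.** For $\mathbf i\in I^m$ ($m\ge1$) define $\preceq_{\mathbf i}$ on $U_q^-(\mathfrak g)\setminus\{0\}$: for $\mathbf i=(i)$, $v\preceq_{\mathbf i}v'\iff\ell_i(v)\le\ell_i(v')$; for $\mathbf i=(i;\mathbf i')$, $v\preceq_{\mathbf i}v'\iff$ $\ell_i(v)<\ell_i(v')$, or $\ell_i(v)=\ell_i(v')$ and $e_i'^{\,\ell_i(v)}(v)\preceq_{\mathbf i'}e_i'^{\,\ell_i(v')}(v')$. $v\prec_{\mathbf i}v'$ means $v\preceq_{\mathbf i}v'$ and not $v'\preceq_{\mathbf i}v$; by convention $0\prec_{\mathbf i}v'$ for every $v'\neq0$. Put $\mathsf e_i^{top}(b)=\mathsf e_i^{\ell_i(b)}(b)$ and $\mathsf e_{\mathbf i}^{top}=\mathsf e_{i_m}^{top}\circ\cdots\circ\mathsf e_{i_1}^{top}$. *)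

(* Defs.v *)
From HB Require Import structures.
From mathcomp Require Import all_boot all_order all_algebra.
From mathcomp Require Import generic_quotient.
From mathcomp Require Import boolp classical_sets.

Set Implicit Arguments.
Unset Strict Implicit.
Unset Printing Implicit Defensive.

Import Order.TTheory GRing.Theory Num.Theory.
Local Open Scope ring_scope.
Local Open Scope classical_set_scope.

Section LinearAlgebra.
Context {R : nzRingType} {V : lmodType R}.

Definition lin_indep {T : eqType} (v : T -> V) : Prop :=
  forall (r : seq T) (c : T -> R), uniq r ->
    \sum_(i <- r) c i *: v i = 0 -> {in r, forall i, c i = 0}.

Definition lspan (S : set V) : set V :=
  [set x | exists r : seq V, exists c : V -> R,
     {in r, forall v, S v} /\ x = \sum_(v <- r) c v *: v].

Definition is_basis (W B : set V) : Prop :=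
  lin_indep (fun b : B => val b) /\ lspan B = W.

End LinearAlgebra.

Notation Qq := {fraction {poly rat}}.
Definition q : Qq := tofrac 'X.

(* zmodule P is P viewed as a module over int; P^vee is {additive P -> int}. *)
Record bc_datum (I : countType) (P : zmodType) := BCDatum {
  bcA : I -> I -> int;
  bcs : I -> nat;
  bcalpha : I -> P;
  bch : I -> {additive P -> int};
  bcA_diag : forall i,
    bcA i i = 2 \/ (bcA i i <= 0 /\ (2 %| bcA i i)%Z);
  bcA_offdiag : forall i j, i != j -> bcA i j <= 0;
  bcA_zero : forall i j, bcA i j = 0 <-> bcA j i = 0;
  bcs_gt0 : forall i, (0 < bcs i)%N;
  bcA_symm : forall i j, (bcs i)%:Z * bcA i j = (bcs j)%:Z * bcA j i;
  bcP_free : exists S : set (zmodule P), is_basis setT S;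
  bcalpha_indep : lin_indep (bcalpha : I -> zmodule P);
  bc_pairing : forall i j, bch i (bcalpha j) = bcA i j;
  bcLambda : forall i, exists L : P, forall j, bch j L = (j == i)%:R
}.

Section QuantumGroup.
Context {I : countType} {P : zmodType} (D : bc_datum I P).

Notation a := (bcA D).
Notation s := (bcs D).
Notation alpha := (bcalpha D).
Notation h := (bch D).

Definition is_real (i : I) : bool := a i i == 2.

Definition qi (i : I) : Qq := q ^+ s i.
Definition qint (i : I) (n : nat) : Qq :=
  (qi i ^+ n - qi i ^- n) / (qi i - (qi i)^-1).
Definition qfact (i : I) (n : nat) : Qq := \prod_(k < n) qint i k.+1.
Definition qbinom (i : I) (m n : nat) : Qq :=
  qfact i m / (qfact i n * qfact i (m - n)).

Definition hs (i : I) : {additive P -> int} := (s i)%:Z \*o h i.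

(* In serre_e and serre_f, a i j <= 0, so `|1 - a i j| is 1 - a i j. *)
Record uq_relations (A : algType Qq) (e f : I -> A)
    (t : {additive P -> int} -> A) : Prop := UqRelations {
  rel_t0 : t \0 = 1;
  rel_tD : forall h1 h2, t h1 * t h2 = t (h1 \+ h2);
  rel_te : forall h1 i, t h1 * e i * t (\- h1) = q ^ (h1 (alpha i)) *: e i;
  rel_tf : forall h1 i, t h1 * f i * t (\- h1) = q ^ (- h1 (alpha i)) *: f i;
  rel_ef : forall i j, e i * f j - f j * e i =
    if i == j then (qi i - (qi i)^-1)^-1 *: (t (hs i) - t (\- hs i)) else 0;
  serre_e : forall i j, is_real i -> i != j ->
    let n := `|1 - a i j|%N in
    \sum_(r < n.+1) ((-1) ^+ r * qbinom i n r) *: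
      (e i ^+ (n - r) * e j * e i ^+ r) = 0;
  serre_f : forall i j, is_real i -> i != j ->
    let n := `|1 - a i j|%N in
    \sum_(r < n.+1) ((-1) ^+ r * qbinom i n r) *:
      (f i ^+ (n - r) * f j * f i ^+ r) = 0;
  rel_ee : forall i j, a i j = 0 -> e i * e j = e j * e i;
  rel_ff : forall i j, a i j = 0 -> f i * f j = f j * f i
}.

(* U_q(g), presented by generators and relations: expressions in the
   generators, identified when they agree in every algebra satisfying the
   relations.  Lemmas Uq_rel and Uq_lift below check that the result satisfies
   the relations and is universal with this property. *)
Inductive uq_expr : Type :=
| XE of I | XF of I | XT of {additive P -> int}
| XC of Qq
| XAdd of uq_expr & uq_expr
| XMul of uq_expr & uq_expr.

Fixpoint uq_eval (A : algType Qq) (e f : I -> A)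
    (t : {additive P -> int} -> A) (x : uq_expr) : A :=
  match x with
  | XE i => e i
  | XF i => f i
  | XT h1 => t h1
  | XC c => c%:A
  | XAdd x y => uq_eval e f t x + uq_eval e f t y
  | XMul x y => uq_eval e f t x * uq_eval e f t y
  end.

Definition uq_equiv (x y : uq_expr) : bool :=
  `[< forall (A : algType Qq) (e f : I -> A) (t : {additive P -> int} -> A),
        uq_relations e f t -> uq_eval e f t x = uq_eval e f t y >].

Lemma uq_equiv_is_equiv : equiv_class_of uq_equiv.
Proof.
split=> [x|x y|y x z].
- by apply/asboolP.
- by apply/idP/idP=> /asboolP xy; apply/asboolP=> A e f t r; rewrite (xy A e f t r).
- move=> /asboolP xy /asboolP yz; apply/asboolP=> A e f t r.
  by rewrite (xy _ _ _ _ r) (yz _ _ _ _ r).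
Qed.

Canonical uq_equiv_rel := EquivRelPack uq_equiv_is_equiv.

HB.instance Definition _ := gen_eqMixin uq_expr.
HB.instance Definition _ := gen_choiceMixin uq_expr.

Definition Uq : Type := {eq_quot uq_equiv_rel}%qT.
HB.instance Definition _ := Choice.on Uq.
HB.instance Definition _ := EqQuotient.on Uq.

Definition uq_class (x : uq_expr) : Uq := (\pi_Uq x)%qT.

Definition Uq_eval (A : algType Qq) (e f : I -> A)
  (t : {additive P -> int} -> A) (u : Uq) : A := uq_eval e f t (repr u).

Lemma Uq_evalE (A : algType Qq) (e f : I -> A) t (x : uq_expr) :
  uq_relations e f t -> Uq_eval e f t (uq_class x) = uq_eval e f t x.
Proof.
move=> r; rewrite /Uq_eval /uq_class.
case: piP => y /eqmodP /asboolP xy.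
by rewrite (xy A e f t r).
Qed.

Lemma Uq_ext (u v : Uq) :
  (forall (A : algType Qq) (e f : I -> A) t, uq_relations e f t ->
     Uq_eval e f t u = Uq_eval e f t v) -> u = v.
Proof.
move=> uv; rewrite -[u]reprK -[v]reprK; apply/eqmodP/asboolP => A e f t r.
exact: uv.
Qed.

Definition Uq_add (u v : Uq) : Uq := uq_class (XAdd (repr u) (repr v)).
Definition Uq_mul (u v : Uq) : Uq := uq_class (XMul (repr u) (repr v)).
Definition Uq_scale (c : Qq) (u : Uq) : Uq :=
  uq_class (XMul (XC c) (repr u)).
Definition Uq_const (c : Qq) : Uq := uq_class (XC c).

Section Eval.
Context (A : algType Qq) (e f : I -> A) (t : {additive P -> int} -> A).
Hypothesis r : uq_relations e f t.
Notation ev := (Uq_eval e f t).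

Lemma Uq_evalD u v : ev (Uq_add u v) = ev u + ev v.
Proof. exact: Uq_evalE. Qed.
Lemma Uq_evalM u v : ev (Uq_mul u v) = ev u * ev v.
Proof. exact: Uq_evalE. Qed.
Lemma Uq_evalZ c u : ev (Uq_scale c u) = c *: ev u.
Proof. by rewrite Uq_evalE //= mulr_algl. Qed.
Lemma Uq_evalC c : ev (Uq_const c) = c%:A.
Proof. exact: Uq_evalE. Qed.

End Eval.

Ltac uq_ext :=
  let r := fresh "r" in
  apply: Uq_ext; intros ? ? ? ? r;
  rewrite ?(Uq_evalD r, Uq_evalM r, Uq_evalZ r, Uq_evalC r) ?(scale0r, scale1r).

Fact Uq_addA : associative Uq_add.
Proof. by move=> u v w; uq_ext; rewrite addrA. Qed.
Fact Uq_addC : commutative Uq_add.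
Proof. by move=> u v; uq_ext; rewrite addrC. Qed.
Fact Uq_add0 : left_id (Uq_const 0) Uq_add.
Proof. by move=> u; uq_ext; rewrite add0r. Qed.
Fact Uq_addN : left_inverse (Uq_const 0) (Uq_scale (-1)) Uq_add.
Proof. by move=> u; uq_ext; rewrite scaleN1r addNr. Qed.

HB.instance Definition _ :=
  GRing.isZmodule.Build Uq Uq_addA Uq_addC Uq_add0 Uq_addN.

Fact Uq_mulA : associative Uq_mul.
Proof. by move=> u v w; uq_ext; rewrite mulrA. Qed.
Fact Uq_mul1l : left_id (Uq_const 1) Uq_mul.
Proof. by move=> u; uq_ext; rewrite mul1r. Qed.
Fact Uq_mul1r : right_id (Uq_const 1) Uq_mul.
Proof. by move=> u; uq_ext; rewrite mulr1. Qed.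
Fact Uq_mulDl : left_distributive Uq_mul +%R.
Proof. by move=> u v w; uq_ext; rewrite mulrDl. Qed.
Fact Uq_mulDr : right_distributive Uq_mul +%R.
Proof. by move=> u v w; uq_ext; rewrite mulrDr. Qed.

Lemma uq_counit_relations :
  @uq_relations Qq^o (fun _ => 0) (fun _ => 0) (fun _ => 1).
Proof.
split=> //=; try by move=> *; rewrite ?(mulr0, mul0r, mulr1, scaler0).
- by move=> i j; rewrite !mulr0 !subrr scaler0 if_same.
- by move=> i j _ _; apply: big1 => k _; rewrite mulr0 mul0r scaler0.
- by move=> i j _ _; apply: big1 => k _; rewrite mulr0 mul0r scaler0.
Qed.

Fact Uq_nontrivial : Uq_const 1 != Uq_const 0.
Proof.
apply/eqP => /(congr1 (Uq_eval (fun _ => 0) (fun _ => 0) (fun _ => 1 : Qq^o))).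
rewrite !(Uq_evalC uq_counit_relations) scale0r scale1r.
by apply/eqP; rewrite oner_eq0.
Qed.

HB.instance Definition _ := GRing.Zmodule_isNzRing.Build Uq
  Uq_mulA Uq_mul1l Uq_mul1r Uq_mulDl Uq_mulDr Uq_nontrivial.

Fact Uq_scaleA c d u : Uq_scale c (Uq_scale d u) = Uq_scale (c * d) u.
Proof. by uq_ext; rewrite scalerA. Qed.
Fact Uq_scale1 : left_id 1 Uq_scale.
Proof. by move=> u; uq_ext. Qed.
Fact Uq_scaleDr : right_distributive Uq_scale +%R.
Proof. by move=> c u v; uq_ext; rewrite scalerDr. Qed.
Fact Uq_scaleDl u : {morph Uq_scale^~ u : c d / c + d}.
Proof. by move=> c d; uq_ext; rewrite scalerDl. Qed.

HB.instance Definition _ := GRing.Zmodule_isLmodule.Build Qq Uq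
  Uq_scaleA Uq_scale1 Uq_scaleDr Uq_scaleDl.

Fact Uq_scaleAl (c : Qq) (u v : Uq) : c *: (u * v) = (c *: u) * v.
Proof. by uq_ext; rewrite scalerAl. Qed.
Fact Uq_scaleAr (c : Qq) (u v : Uq) : c *: (u * v) = u * (c *: v).
Proof. by uq_ext; rewrite scalerAr. Qed.

HB.instance Definition _ := GRing.Lmodule_isLalgebra.Build Qq Uq Uq_scaleAl.
HB.instance Definition _ := GRing.Lalgebra_isAlgebra.Build Qq Uq Uq_scaleAr.

Definition gen_e (i : I) : Uq := uq_class (XE i).
Definition gen_f (i : I) : Uq := uq_class (XF i).
Definition gen_q (h1 : {additive P -> int}) : Uq := uq_class (XT h1).

Lemma uq_eval_gen (x : uq_expr) : uq_eval gen_e gen_f gen_q x = uq_class x.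
Proof.
elim: x => //= [c|x -> y ->|x -> y ->]; apply: Uq_ext => A e f t r.
- by rewrite (Uq_evalZ r) (Uq_evalC r) (Uq_evalE _ r) scale1r.
- by rewrite (Uq_evalD r) !(Uq_evalE _ r).
- by rewrite (Uq_evalM r) !(Uq_evalE _ r).
Qed.

Lemma Uq_lift (A : algType Qq) (e f : I -> A) t : uq_relations e f t ->
  exists2 phi : {lrmorphism Uq -> A},
    [/\ forall i, phi (gen_e i) = e i, forall i, phi (gen_f i) = f i
      & forall h1, phi (gen_q h1) = t h1] &
    forall psi : {lrmorphism Uq -> A},
      [/\ forall i, psi (gen_e i) = e i, forall i, psi (gen_f i) = f i
      & forall h1, psi (gen_q h1) = t h1] ->
      psi =1 phi.
Proof.
move=> r; pose ev : Uq -> A := Uq_eval e f t.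
have evB : zmod_morphism ev.
  move=> u v; rewrite /ev (Uq_evalD r); congr (_ + _).
  by rewrite (Uq_evalZ r) scaleN1r.
have evZ : scalable ev by move=> c u; exact: (Uq_evalZ r).
have evM : monoid_morphism ev.
  split; last by move=> u v; exact: (Uq_evalM r).
  by rewrite /ev (Uq_evalC r) scale1r.
pose zm := GRing.isZmodMorphism.Build Uq A ev evB.
pose sc := GRing.isScalable.Build Qq Uq A *:%R ev evZ.
pose mm := GRing.isMonoidMorphism.Build Uq A ev evM.
pose phi : {lrmorphism Uq -> A} := HB.pack ev zm sc mm.
exists phi; first by split=> x /=; exact: (Uq_evalE _ r).
move=> psi [pe pf pt] u; rewrite -[u]reprK -/(uq_class (repr u)).
rewrite [RHS](Uq_evalE _ r) -uq_eval_gen.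
elim: (repr u) => /= [i|i|h1|c|x <- y <-|x <- y <-].
- exact: pe.
- exact: pf.
- exact: pt.
- by rewrite linearZ rmorph1.
- exact: rmorphD.
- exact: rmorphM.
Qed.

Lemma Uq_rel : uq_relations gen_e gen_f gen_q.
Proof.
have evZ A e f t (r : @uq_relations A e f t) c (u : Uq) :
  Uq_eval e f t (c *: u) = c *: Uq_eval e f t u by exact: Uq_evalZ.
have evM A e f t (r : @uq_relations A e f t) (u v : Uq) :
  Uq_eval e f t (u * v) = Uq_eval e f t u * Uq_eval e f t v by exact: Uq_evalM.
have ev0 A e f t (r : @uq_relations A e f t) : Uq_eval e f t (0 : Uq) = 0.
  by rewrite [LHS](Uq_evalC r) scale0r.
have ev1 A e f t (r : @uq_relations A e f t) : Uq_eval e f t (1 : Uq) = 1.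
  by rewrite [LHS](Uq_evalC r) scale1r.
have evD A e f t (r : @uq_relations A e f t) (u v : Uq) :
  Uq_eval e f t (u + v) = Uq_eval e f t u + Uq_eval e f t v by exact: Uq_evalD.
have evB A e f t (r : @uq_relations A e f t) (u v : Uq) :
  Uq_eval e f t (u - v) = Uq_eval e f t u - Uq_eval e f t v.
  by rewrite evD // -scaleN1r evZ // scaleN1r.
have evX A e f t (r : @uq_relations A e f t) (u : Uq) n :
  Uq_eval e f t (u ^+ n) = Uq_eval e f t u ^+ n.
  by elim: n => [|n IHn]; rewrite ?expr0 ?ev1 // !exprS evM // IHn.
have ev_sum A e f t (r : @uq_relations A e f t) n (u : 'I_n -> Uq) :
  Uq_eval e f t (\sum_(k < n) u k) = \sum_(k < n) Uq_eval e f t (u k).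
  by apply: (big_morph (Uq_eval e f t)) => [x y|]; [exact: evD|exact: ev0].
have ev_e A e f t (r : @uq_relations A e f t) i :
  Uq_eval e f t (gen_e i) = e i by exact: Uq_evalE.
have ev_f A e f t (r : @uq_relations A e f t) i :
  Uq_eval e f t (gen_f i) = f i by exact: Uq_evalE.
have ev_t A e f t (r : @uq_relations A e f t) h1 :
  Uq_eval e f t (gen_q h1) = t h1 by exact: Uq_evalE.
split; [|move=> h1 h2|move=> h1 i|move=> h1 i|move=> i j|move=> i j re ij n
  |move=> i j re ij n|move=> i j a0|move=> i j a0];
  apply: Uq_ext => A e f t r.
- by rewrite ev1 // ev_t //; exact: (rel_t0 r).
- by rewrite evM // !ev_t //; exact: (rel_tD r).
- by rewrite evZ // !evM // !ev_t // !ev_e //; exact: (rel_te r).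
- by rewrite evZ // !evM // !ev_t // !ev_f //; exact: (rel_tf r).
- rewrite evB // !evM // !ev_e // !ev_f // [LHS](rel_ef r).
  by case: ifP => _; rewrite ?ev0 // evZ // evB // !ev_t.
- rewrite ev0 // ev_sum // -[RHS](serre_e r re ij); apply: eq_bigr => k _.
  by rewrite evZ // !evM // !evX // !ev_e.
- rewrite ev0 // ev_sum // -[RHS](serre_f r re ij); apply: eq_bigr => k _.
  by rewrite evZ // !evM // !evX // !ev_f.
- by rewrite !evM // !ev_e //; exact: (rel_ee r).
- by rewrite !evM // !ev_f //; exact: (rel_ff r).
Qed.

Local Notation E := gen_e.
Local Notation F := gen_f.
Local Notation T := gen_q.

Definition Uminus : set Uq :=
  smallest (fun S : set Uq => subalg_closed (mem S)) (range F).

Definition fmonomial (w : seq I) : Uq := \prod_(i <- w) F i.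

Definition Qminus : set P := [set - (\sum_(i <- w) alpha i) | w in [set: seq I]].

(* The Q^- -grading of U_q^-(g), given by f_i in degree - alpha_i: the
   component of degree mu is spanned by the monomials of degree mu. *)
Definition Uminus_deg (mu : P) : set Uq :=
  lspan [set fmonomial w | w in [set w | - (\sum_(i <- w) alpha i) = mu]].

(* gen_q (hs i) is K_i. *)
Definition eprime_eq (i : I) (x y z : Uq) : Prop :=
  E i * x - x * E i =
  (qi i - (qi i)^-1)^-1 *: (T (hs i) * y - T (\- hs i) * z).

Definition eprime (i : I) (x : Uq) : Uq :=
  (xget (0, 0) [set yz : Uq * Uq |
    [/\ Uminus yz.1, Uminus yz.2 & eprime_eq i x yz.1 yz.2]]).2.

Definition ell (i : I) (v : Uq) : nat :=
  xget 0%N [set n | iter n.+1 (eprime i) v = 0 /\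
                    forall m, iter m.+1 (eprime i) v = 0 -> (n <= m)%N].

Definition Uminus_lt (i : I) (k : nat) : set Uq :=
  [set v | Uminus v /\ iter k (eprime i) v = 0].

Definition perfect_arrow (i : I) (b b' : Uq) : Prop :=
  exists2 c : Qq, c != 0 & Uminus_lt i (ell i b).-1 (eprime i b - c *: b').

(* pb_arrow says that e_i(b) is well defined when e_i'(b) <> 0; pb_inj is the
   injectivity of e_i on such b.  ell i b > 0 in that case, so .-1 does not
   truncate in perfect_arrow. *)
Record perfect_basis (B : set Uq) : Prop := PerfectBasis {
  pb_basis : is_basis Uminus B;
  pb_graded : forall b, B b -> exists! mu, Qminus mu /\ Uminus_deg mu b;
  pb_arrow : forall b i, B b -> eprime i b <> 0 ->
    exists! b', B b' /\ perfect_arrow i b b';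
  pb_inj : forall i b1 b2 b', B b1 -> B b2 -> B b' ->
    eprime i b1 <> 0 -> eprime i b2 <> 0 ->
    perfect_arrow i b1 b' -> perfect_arrow i b2 b' -> b1 = b2;
  pb_one : B `&` [set c%:A | c in [set: Qq]] = [set 1]
}.

Section Crystal.
Context (B : set Uq).

(* None plays the role of the extra element 0 of the crystal. *)
Definition etil (i : I) (b : B) : option B :=
  if eprime i (val b) == 0 then None
  else xget None [set Some b' | b' in [set b' : B | perfect_arrow i (val b) (val b')]].

Definition ftil (i : I) (b : B) : option B :=
  xget None [set Some b' | b' in [set b' : B | etil i b' = Some b]].

Definition wt (b : B) : P :=
  xget 0 [set mu | Qminus mu /\ Uminus_deg mu (val b)].

Definition eps (i : I) (b : B) : int :=
  if is_real i then (ell i (val b))%:Z else 0.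

Definition phi (i : I) (b : B) : int := eps i b + h i (wt b).

Definition etop (i : I) (b : B) : option B :=
  iter (ell i (val b)) (obind (etil i)) (Some b).

Definition etop_seq (w : seq I) (b : B) : option B :=
  foldl (fun ob i => obind (etop i) ob) (Some b) w.

End Crystal.

Definition crystal_morphism (B1 B2 : set Uq) (psi : B1 -> option B2) : Prop :=
  (forall b b', psi b = Some b' ->
     wt b' = wt b /\ forall i, eps i b' = eps i b /\ phi i b' = phi i b) /\
  (forall i b b', ftil i b = Some b' -> obind (@ftil B2 i) (psi b) = psi b').

Definition crystal_isomorphism (B1 B2 : set Uq) (psi : B1 -> B2) : Prop :=
  crystal_morphism (Some \o psi) /\ bijective psi.

(* prece i w is the relation for the nonempty sequence (i; w). *)
Fixpoint prece (i : I) (w : seq I) (v v' : Uq) : Prop :=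
  match w with
  | [::] => (ell i v <= ell i v')%N
  | j :: w' =>
      (ell i v < ell i v')%N \/
      (ell i v = ell i v' /\
       prece j w' (iter (ell i v) (eprime i) v) (iter (ell i v') (eprime i) v'))
  end.

Definition prec (i : I) (w : seq I) (v v' : Uq) : Prop :=
  v' <> 0 /\ (v = 0 \/ (v <> 0 /\ prece i w v v' /\ ~ prece i w v' v)).

Definition nontrivial_part (B : set Uq) : Type := {b : B | val b != 1}.

(* The identity map of U_q^-(g) induces (psi, c) from B to B'. *)
Definition id_perfect_isomorphism (B B' : set Uq) (psi : B -> B')
    (c : nontrivial_part B -> {x : Qq | x != 0}) : Prop :=
  [/\ crystal_isomorphism psi,
      forall b : B, val b = 1 -> val (psi b) = 1
    & forall (b : nontrivial_part B) (i : I) (w : seq I),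
        omap val (etop_seq (i :: w) (val b)) = Some 1 ->
        prec i w (val (val b) - val (c b) *: val (psi (val b))) (val (val b))].

End QuantumGroup.

(* Main.v *)
(* U_q(g) acts on functions from words in I to a vector space, f_i and e_i
   being the transposes of right multiplications on a Verma module; the
   functions compatible with the Serre relations form a submodule.  Hence
   U_q^-(g) is presented by the Serre relations, and e_i' is well defined and
   linear.

   A homogeneous x of nonzero weight -alpha killed by all e_i' is 0: by
   induction on the weight the mirror derivations kill x too, so x is
   primitive for the twisted coproduct and the antipode maps x to -x.  The
   square of the antipode is a scalar on each weight space, which gives
   (alpha, alpha) = \sum_i k_i (alpha_i, alpha_i) for alpha = \sum_i k_i alpha_i.
   As (alpha, alpha_i) <= 0 for real i, by the sl_2-theory of U_q^- / U_q^- f_i,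
   each term is nonpositive, so alpha is supported on commuting imaginary
   indices, where the claim is a direct computation.

   So every element b of a perfect basis is sent to a nonzero scalar by the
   tops of the e_i' along some word w, and all elements of a perfect basis that
   occur in v lie weakly below v along w.  Hence b expands in the other basis
   with exactly one term having the same string along w.  Comparing two words,
   a first discrepancy would be strictly decreasing, so the matching does not
   depend on w. *)
Require Import Defs.
From HB Require Import structures.
From mathcomp Require Import all_boot all_order all_algebra.
From mathcomp Require Import generic_quotient.
From mathcomp Require Import boolp classical_sets functions.
From mathcomp Require Import zify ring.

Set Implicit Arguments.
Unset Strict Implicit.
Unset Printing Implicit Defensive.

Import Order.TTheory GRing.Theory Num.Theory.
Local Open Scope ring_scope.

(** * The quantum Serre element commutes with suitable derivations *)

(** [eprime] is chosen among the solutions of [eprime_eq], and nothing is known beforehand about the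
    size of [Uq], so even uniqueness of the solution must come from a representation. Word functions
    are given values in [Uq] itself: x in U_q^-, acting on [fm \o rev] and evaluated at the empty
    word, returns x. Any other function compatible with the Serre relations yields a linear map on
    U_q^-, whence reversal, weight projections and the antipode.

    No bilinear form on U_q^- is used. On weight -alpha the antipode is, up to sign and reversal,
    the scalar q^(-N), where 2N is the sum of (alpha, alpha_i) - (alpha_i, alpha_i) over the letters
    i of alpha; a singular vector forces N = 0. For imaginary i the subtraction removes one copy of
    i from alpha, so negative or zero norms do no harm.

    The obstacle in the matching is that c(b) must serve all sequences w reducing b to 1, while such
    a w may fail to reduce the other elements of the same weight. Two words are therefore compared
    only when both reduce every element of that weight in both bases. *)

Section QuantumIntegers.
Variables (K : fieldType) (Q : K).

(** The formulas of [qint], [qfact] and [qbinom] with a free parameter, so that Q can be replaced by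
    its inverse; at Q = [qi D i] they are convertible to the originals. *)
Definition qnum (m : nat) : K := (Q ^+ m - Q ^- m) / (Q - Q^-1).
Definition qnum_fact (m : nat) : K := \prod_(k < m) qnum k.+1.
Definition qnum_binom (m n : nat) : K :=
  qnum_fact m / (qnum_fact n * qnum_fact (m - n)).

Definition serre_elt (A : algType K) (f g : A) (n : nat) : A :=
  \sum_(r < n.+1) ((-1) ^+ r * qnum_binom n r) *: (f ^+ (n - r) * g * f ^+ r).

Notation qn := qnum.
Notation qf := qnum_fact.
Notation qb := qnum_binom.
Hypothesis Q0 : Q != 0.
Hypothesis qn0 : forall m, qn m.+1 != 0.

Let QB0 : Q - Q^-1 != 0.
Proof. by apply: contraNneq (qn0 0) => e; rewrite /qnum e invr0 mulr0. Qed.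

Let qfS m : qf m.+1 = qf m * qn m.+1.
Proof. by rewrite /qnum_fact big_ord_recr. Qed.

Let qf_neq0 m : qf m != 0.
Proof. by apply/prodf_neq0 => k _; apply: qn0. Qed.

Lemma qbinom_shift n r : (r < n)%N -> qb n r * qn (n - r) = qb n r.+1 * qn r.+1.
Proof.
move=> rn; rewrite /qnum_binom qfS.
have -> : (n - r = (n - r.+1).+1)%N by lia.
rewrite qfS.
have := qf_neq0 r; have := qf_neq0 (n - r.+1).
have := qn0 r; have := qn0 (n - r.+1).
move: (qn r.+1) (qn (_ - _).+1) (qf r) (qf (_ - _)) (qf n) => a b c d e.
by move=> *; field; do ?[apply/andP; split].
Qed.

(** A closed form for the partial sums turns the vanishing of the full alternating sum into an
    induction whose step is one rational identity, the q-Pascal rule. At k = n the one remaining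
    term cancels the right-hand side. *)
Lemma qbinom_alternating_partial n k : (k <= n)%N ->
  \sum_(r < k.+1) (-1) ^+ r * qb n.+1 r * Q ^+ (r * n) =
  (-1) ^+ k * qb n k * Q ^+ (k * n.+1).
Proof.
elim: k => [|k IH] kn.
  rewrite big_ord1 !mul0n !expr0 !mulr1 !mul1r /qnum_binom !subn0.
  by rewrite /qnum_fact big_ord0 !mul1r !divff // qf_neq0.
rewrite big_ord_recr IH 1?ltnW //= /qnum_binom.
have -> : (n - k = (n - k.+1).+1)%N by lia.
have -> : (n.+1 - k.+1 = (n - k.+1).+1)%N by lia.
set m := (n - k.+1)%N; have nE : (n = k.+1 + m)%N by rewrite /m; lia.
rewrite !qfS.
have := qf_neq0 k; have := qf_neq0 m; have := qf_neq0 n.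
have := qn0 k; have := qn0 m.
have QQ := QB0; rewrite /qnum.
(* All powers are expressed through Q, Q^m, Q^k and Q^(k(n+1)), which [field] can then treat as
   independent variables. *)
rewrite (_ : Q ^+ (k.+1 * n) = Q ^+ (k * n.+1) * Q ^+ m * Q); last first.
  by rewrite nE -!exprD -exprSr; congr (_ ^+ _); lia.
rewrite (_ : Q ^+ (k.+1 * n.+1) = Q ^+ (k * n.+1) * (Q ^+ m * Q ^+ k.+1 * Q)); last first.
  by rewrite nE -!exprD -exprSr -exprD; congr (_ ^+ _); lia.
rewrite (_ : Q ^+ n.+1 = Q ^+ m * Q ^+ k.+1 * Q); last first.
  by rewrite nE -exprD -exprSr; congr (_ ^+ _); lia.
rewrite !exprS; move: QQ.
have := expf_neq0 m Q0; have := expf_neq0 k Q0.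
move: (Q ^+ m) (Q ^+ k) (Q ^+ (k * n.+1)) (qf k) (qf m) (qf n) ((-1) ^+ k).
move=> a b c x y z sg b0 a0 QQ.
move=> h1 h2 z0 y0 x0.
have sq (z' : K) : z' != 0 -> z' - z'^-1 != 0 -> z' * z' - 1 != 0.
  move=> z'0; apply: contraNneq => e.
  have -> : z' - z'^-1 = (z' * z' - 1) / z' by field.
  by rewrite e mul0r.
have nz (z' : K) : (z' - z'^-1) / (Q - Q^-1) != 0 -> z' - z'^-1 != 0.
  by apply: contraNneq => ->; rewrite mul0r.
have h1p := sq _ (mulf_neq0 Q0 a0) (nz _ h1).
have h2p := sq _ (mulf_neq0 Q0 b0) (nz _ h2).
have h3p := sq _ Q0 QQ.
by field; do ?[apply/andP; split].
Qed.

Lemma qbinom_alternating n :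
  \sum_(r < n.+2) (-1) ^+ r * qb n.+1 r * Q ^+ (r * n) = 0.
Proof.
rewrite big_ord_recr qbinom_alternating_partial //= /qnum_binom !subnn.
rewrite ![qf 0]big_ord0 !mulr1 !divff // exprS mulnC.
by rewrite mulN1r !mulr1 mulNr subrr.
Qed.

End QuantumIntegers.

Lemma qnum_inv (K : fieldType) (Q : K) : qnum Q^-1 =1 qnum Q.
Proof.
by move=> m; rewrite /qnum invrK exprVn invrK -opprB -(opprB Q) invrN mulrNN.
Qed.

Section SerreElement.
Variables (K : fieldType) (Q : K).
Hypothesis Q0 : Q != 0.
Hypothesis qn0 : forall m, qnum Q m.+1 != 0.
Notation qn := (qnum Q).
Notation qb := (qnum_binom Q).
Notation serre_elt := (serre_elt Q).

Let QB0 : Q - Q^-1 != 0.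
Proof. by apply: contraNneq (qn0 0) => e; rewrite /qnum e invr0 mulr0. Qed.

Lemma qbinom_alternating_inv n :
  \sum_(r < n.+2) (-1) ^+ r * qb n.+1 r * Q ^- (r * n) = 0.
Proof.
have QV0 : Q^-1 != 0 by rewrite invr_eq0.
rewrite -[RHS](@qbinom_alternating K Q^-1 QV0 _ n); last first.
  by move=> m; rewrite qnum_inv.
apply: eq_bigr => r _; rewrite exprVn; congr (_ * _ * _).
rewrite /qnum_binom /qnum_fact.
by congr (_ / (_ * _)); apply: eq_bigr => k _; rewrite qnum_inv.
Qed.

Variables (A : algType K) (f g : A) (n : nat).
Variables (e u v : A).

(** The case of e_j, which differentiates g only. Moving the resulting u and v to the right of f^r
    costs Q^(rn) and Q^(-rn), and the binomials assemble into two vanishing alternating sums. *)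
Lemma serre_elt_comm_middle (c : K) :
  e * f = f * e -> e * g - g * e = c *: (u - v) ->
  u * f = Q ^+ n *: (f * u) -> v * f = Q ^- n *: (f * v) ->
  e * serre_elt f g n.+1 = serre_elt f g n.+1 * e.
Proof.
move=> ef eg uf vf.
have uX r : u * f ^+ r = Q ^+ (r * n) *: (f ^+ r * u).
  elim: r => [|r IH]; first by rewrite mulr1 mul1r mul0n scale1r.
  rewrite exprSr mulrA IH -scalerAl -(mulrA _ u f) uf -scalerAr scalerA -exprD mulrA.
  by congr (_ ^+ _ *: _); lia.
have vX r : v * f ^+ r = Q ^- (r * n) *: (f ^+ r * v).
  elim: r => [|r IH]; first by rewrite mulr1 mul1r mul0n invr1 scale1r.
  rewrite exprSr mulrA IH -scalerAl -(mulrA _ v f) vf -scalerAr scalerA -invfM -exprD.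
  by rewrite mulrA; congr ((_ ^+ _)^-1 *: _); lia.
have eX r : e * f ^+ r = f ^+ r * e by apply: commrX.
apply/eqP; rewrite -subr_eq0; apply/eqP.
rewrite /serre_elt mulr_sumr mulr_suml -sumrB.
transitivity (c *: (f ^+ n.+1 *
  ((\sum_(r < n.+2) (-1) ^+ r * qb n.+1 r * Q ^+ (r * n)) *: u
   - (\sum_(r < n.+2) (-1) ^+ r * qb n.+1 r * Q ^- (r * n)) *: v))); last first.
  by rewrite (qbinom_alternating Q0 qn0) qbinom_alternating_inv !scale0r subrr mulr0 scaler0.
rewrite !scaler_suml -sumrB mulr_sumr scaler_sumr; apply: eq_bigr => r _.
rewrite -!scalerAr -scalerAl -scalerBr.
have -> : e * (f ^+ (n.+1 - r) * g * f ^+ r) - f ^+ (n.+1 - r) * g * f ^+ r * e =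
    f ^+ (n.+1 - r) * (e * g - g * e) * f ^+ r.
  rewrite mulrBr mulrBl !mulrA eX -(mulrA _ (f ^+ r) e) -(eX r).
  by rewrite !mulrA.
have fE : f ^+ n.+1 = f ^+ (n.+1 - r) * f ^+ r.
  by rewrite -exprD subnK // -ltnS.
rewrite eg -scalerAr -scalerAl -(mulrA _ (u - v)) mulrBl uX vX fE -mulrA.
rewrite scalerA (mulrC (_ * qb _ _)) -[LHS]scalerA; congr (_ *: _).
rewrite scalerAr; congr (_ * _).
by rewrite scalerBr !scalerA mulrBr -!scalerAr.
Qed.

(** The case of e_i. Differentiating the right power of f in term r+1 and the left power in term r
    gives the same element, with opposite coefficients by [qbinom_shift]; the sum telescopes. *)
Lemma serre_elt_comm_outer :
  e * g = g * e -> e * f - f * e = (Q - Q^-1)^-1 *: (u - v) ->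
  u * f = Q ^- 2 *: (f * u) -> v * f = Q ^+ 2 *: (f * v) ->
  u * g = Q ^+ n *: (g * u) -> v * g = Q ^- n *: (g * v) ->
  e * serre_elt f g n.+1 = serre_elt f g n.+1 * e.
Proof.
move=> eg ef uf vf ug vg.
have uX r : u * f ^+ r = Q ^- (r * 2) *: (f ^+ r * u).
  elim: r => [|r IH]; first by rewrite mulr1 mul1r mul0n invr1 scale1r.
  rewrite exprSr mulrA IH -scalerAl -(mulrA _ u f) uf -scalerAr scalerA -invfM -exprD.
  by rewrite mulrA; congr ((_ ^+ _)^-1 *: _); lia.
have vX r : v * f ^+ r = Q ^+ (r * 2) *: (f ^+ r * v).
  elim: r => [|r IH]; first by rewrite mulr1 mul1r mul0n scale1r.
  rewrite exprSr mulrA IH -scalerAl -(mulrA _ v f) vf -scalerAr scalerA -exprD mulrA.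
  by congr (_ ^+ _ *: _); lia.
pose c := (Q - Q^-1)^-1.
(* [w m] is the sl_2 commutator of e with f^m. At m = 0 the truncated [m.-1] is harmless because
   [qn 0] is 0. *)
pose w m := qn m *: (f ^+ m.-1 * (c *: (Q ^- m.-1 *: u - Q ^+ m.-1 *: v))).
have eX m : e * f ^+ m = f ^+ m * e + w m.
  elim: m => [|m IH].
    by rewrite /w /qnum !expr0 invr1 subrr mul0r scale0r addr0 mulr1 mul1r.
  rewrite exprS mulrA (_ : e * f = f * e + c *: (u - v)); last first.
    by rewrite -ef addrC subrK.
  rewrite mulrDl -mulrA IH mulrDr mulrA -exprS -addrA; congr (_ + _).
  rewrite -scalerAl mulrBl uX vX /w /=.
  case: m {IH} => [|m].
    rewrite /qnum !expr0 invr1 !subrr !mul0r scale0r mulr0 add0r.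
    by rewrite !scale1r !mul1r divff ?QB0 // scale1r.
  rewrite -scalerAr mulrA -exprS /=.
  transitivity ((qn m.+1 * c * Q ^- m + c * Q ^- (m.+1 * 2)) *: (f ^+ m.+1 * u)
     - (qn m.+1 * c * Q ^+ m + c * Q ^+ (m.+1 * 2)) *: (f ^+ m.+1 * v)).
    rewrite !scalerDl opprD addrACA -!scalerA -!scalerBr.
    by rewrite -!scalerAr mulrBr -!scalerAr !scalerBr.
  rewrite -scalerAr mulrBr -!scalerAr !scalerBr !scalerA.
  have x0 := expf_neq0 m Q0; have QQ := QB0.
  have Q1 : Q * Q - 1 != 0.
    apply: contraNneq QQ => e0.
    have -> : Q - Q^-1 = (Q * Q - 1) / Q by field.
    by rewrite e0 mul0r.
  rewrite /c /qnum !exprM !exprS !expr0 !mulr1; move: (Q ^+ m) x0 => x x0.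
  by congr (_ *: _ - _ *: _); field; rewrite ?Q0 ?x0 ?Q1.
have fgX r :
  e * (f ^+ (n.+1 - r) * g * f ^+ r) = f ^+ (n.+1 - r) * g * f ^+ r * e +
   (w (n.+1 - r)%N * g * f ^+ r + f ^+ (n.+1 - r) * g * w r).
  rewrite !mulrA eX !mulrDl [RHS]addrCA [LHS]addrC; congr (_ + _).
  by rewrite -(mulrA _ e) eg !mulrA -(mulrA _ e) eX mulrDr !mulrA.
rewrite /serre_elt mulr_sumr mulr_suml.
under eq_bigr => r _ do rewrite -scalerAr fgX scalerDr scalerAl.
rewrite big_split /= -[RHS]addr0; congr (_ + _).
under eq_bigr => r _ do rewrite scalerDr.
rewrite big_split /= [X in X + _]big_ord_recr [X in _ + X]big_ord_recl /=.
rewrite subnn subn0.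
have -> : w 0 = 0 by rewrite /w /qnum expr0 invr1 subrr mul0r scale0r.
rewrite !mul0r !mulr0 !scaler0 addr0 add0r -big_split /=.
apply: big1 => -[r rn] _; rewrite /bump /= add1n subSS.
have shift := qbinom_shift Q0 qn0 rn; rewrite subSn // in shift *.
set a := (n - r)%N in shift *; have nE : n = (r + a)%N by rewrite /a; lia.
pose z := f ^+ a * g * f ^+ r * (c *: (Q ^- r *: u - Q ^+ r *: v)).
have -> : w a.+1 * g * f ^+ r = qn a.+1 *: z.
  rewrite /w /= -!scalerAl /z -!scalerAr -!scalerAl; congr (_ *: (_ *: _)).
  rewrite -!mulrA; congr (_ * _); rewrite !mulrBl !mulrBr -!scalerAl -!scalerAr.
  rewrite !mulrA ug vg -!scalerAl -!mulrA uX vX -!scalerAr !scalerA.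
  rewrite !(exprM _ r 2) nE !exprD.
  have := expf_neq0 a Q0; have := expf_neq0 r Q0.
  move: (Q ^+ a) (Q ^+ r) => x y y0 x0.
  by congr (_ *: _ - _ *: _); field; rewrite ?x0 ?y0.
have -> : f ^+ a * g * w r.+1 = qn r.+1 *: z.
  by rewrite /w /= -!scalerAr /z mulrA -!scalerAr.
by rewrite !scalerA -mulrA shift exprS mulN1r !mulNr mulrA scaleNr subrr.
Qed.

End SerreElement.

Lemma serre_elt_twist (K : fieldType) (Q : K) (A : algType K) (f g t : A) n x y :
  t * f = x *: (f * t) -> t * g = y *: (g * t) ->
  t * serre_elt Q f g n = (x ^+ n * y) *: (serre_elt Q f g n * t).
Proof.
move=> tf tg; have tX k : t * f ^+ k = x ^+ k *: (f ^+ k * t).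
  elim: k => [|k IH]; first by rewrite scale1r mulr1 mul1r.
  rewrite exprSr mulrA IH -scalerAl -(mulrA _ t) tf -scalerAr scalerA mulrA.
  by rewrite -exprSr.
rewrite /serre_elt mulr_sumr mulr_suml scaler_sumr; apply: eq_bigr => -[r rn] _ /=.
rewrite -scalerAr -scalerAl; move: (_ * qnum_binom _ _ _) => c.
rewrite scalerA (mulrC _ c) -[RHS]scalerA; congr (_ *: _).
rewrite !mulrA tX -!scalerAl -(mulrA _ t) tg -!scalerAr -!scalerAl.
rewrite !mulrA -(mulrA _ t) tX -!scalerAr !mulrA !scalerA.
by congr (_ *: _); rewrite mulrAC -exprD subnK.
Qed.

Lemma commutator_comm (K : fieldType) (A : algType K) (e f g t : A) :
  e * f = f * e + t -> e * g = g * e -> t * g = g * t ->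
  e * (f * g - g * f) = (f * g - g * f) * e.
Proof.
move=> ef eg tg; rewrite mulrBr mulrBl !mulrA ef eg -(mulrA g e) ef.
by rewrite mulrDl mulrDr -(mulrA f e) eg !mulrA opprD addrACA tg subrr addr0.
Qed.

Lemma commutator_comm3 (K : fieldType) (A : algType K) (e f g : A) :
  e * f = f * e -> e * g = g * e ->
  e * (f * g - g * f) = (f * g - g * f) * e.
Proof.
move=> ef eg; apply: (@commutator_comm _ _ _ _ _ 0) => //.
  by rewrite addr0.
by rewrite mulr0 mul0r.
Qed.

(** * The algebra of endomorphisms of a module *)

Section Endomorphisms.
Variables (R : comNzRingType) (V : lmodType R).

(** Linearity is kept as a bare proposition, so that endomorphisms equal at every vector are
    equal. *)
Record endo := Endo { endo_fun :> V -> V; endo_linear : linear endo_fun }.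
HB.instance Definition _ := gen_eqMixin endo.
HB.instance Definition _ := gen_choiceMixin endo.
HB.instance Definition _ (T : endo) :=
  GRing.isLinear.Build R V V *:%R T (endo_linear T).

Lemma endoP (S T : endo) : S =1 T -> S = T.
Proof.
case: S T => [S lS] [T lT] /= /funext ST; rewrite {}ST in lS *.
by congr Endo; exact: Prop_irrelevance.
Qed.

Definition endo_zero : endo := Endo (@GRing.linearP _ _ _ _ (\0 : {linear V -> V})).
Definition endo_opp (S : endo) : endo :=
  Endo (@GRing.linearP _ _ _ _ (\- S : {linear V -> V})).
Definition endo_add (S T : endo) : endo :=
  Endo (@GRing.linearP _ _ _ _ (S \+ T : {linear V -> V})).
Definition endo_one : endo := Endo (@GRing.linearP _ _ _ _ (idfun : {linear V -> V})).
Definition endo_mul (S T : endo) : endo :=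
  Endo (@GRing.linearP _ _ _ _ (S \o T : {linear V -> V})).
Definition endo_scale (c : R) (S : endo) : endo :=
  Endo (@GRing.linearP _ _ _ _ (c \*: S : {linear V -> V})).

Fact endo_addA : associative endo_add.
Proof. by move=> S T U; apply: endoP => v /=; rewrite addrA. Qed.
Fact endo_addC : commutative endo_add.
Proof. by move=> S T; apply: endoP => v /=; rewrite addrC. Qed.
Fact endo_add0 : left_id endo_zero endo_add.
Proof. by move=> S; apply: endoP => v /=; rewrite add0r. Qed.
Fact endo_addN : left_inverse endo_zero endo_opp endo_add.
Proof. by move=> S; apply: endoP => v /=; rewrite addNr. Qed.
HB.instance Definition _ :=
  GRing.isZmodule.Build endo endo_addA endo_addC endo_add0 endo_addN.

Fact endo_mulA : associative endo_mul.
Proof. by move=> S T U; apply: endoP. Qed.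
Fact endo_mul1l : left_id endo_one endo_mul.
Proof. by move=> S; apply: endoP. Qed.
Fact endo_mul1r : right_id endo_one endo_mul.
Proof. by move=> S; apply: endoP. Qed.
Fact endo_mulDl : left_distributive endo_mul +%R.
Proof. by move=> S T U; apply: endoP. Qed.
Fact endo_mulDr : right_distributive endo_mul +%R.
Proof. by move=> S T U; apply: endoP => v /=; rewrite linearD. Qed.
HB.instance Definition _ := GRing.Zmodule_isPzRing.Build endo
  endo_mulA endo_mul1l endo_mul1r endo_mulDl endo_mulDr.

Fact endo_scaleA c d S : endo_scale c (endo_scale d S) = endo_scale (c * d) S.
Proof. by apply: endoP => v /=; rewrite scalerA. Qed.
Fact endo_scale1 : left_id 1 endo_scale.
Proof. by move=> S; apply: endoP => v /=; rewrite scale1r. Qed.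
Fact endo_scaleDr : right_distributive endo_scale +%R.
Proof. by move=> c S T; apply: endoP => v /=; rewrite scalerDr. Qed.
Fact endo_scaleDl S : {morph endo_scale^~ S : c d / c + d}.
Proof. by move=> c d; apply: endoP => v /=; rewrite scalerDl. Qed.
HB.instance Definition _ := GRing.Zmodule_isLmodule.Build R endo
  endo_scaleA endo_scale1 endo_scaleDr endo_scaleDl.

Lemma endoD (S T : endo) v : (S + T) v = S v + T v. Proof. by []. Qed.
Lemma endoN (S : endo) v : (- S) v = - S v. Proof. by []. Qed.
Lemma endoM (S T : endo) v : (S * T) v = S (T v). Proof. by []. Qed.
Lemma endoZ c (S : endo) v : (c *: S) v = c *: S v. Proof. by []. Qed.
Lemma endo_sum n (F : 'I_n -> endo) v : (\sum_(k < n) F k) v = \sum_(k < n) F k v.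
Proof. by elim/big_ind2: _ => //= S x T y <- <-. Qed.
Lemma endo_lin (T : endo) c u v : T (c *: u + v) = c *: T u + T v.
Proof. exact: endo_linear. Qed.
Lemma endo_linZ (T : endo) c v : T (c *: v) = c *: T v.
Proof. exact: (linearZZ T). Qed.
Lemma endo_lin0 (T : endo) : T 0 = 0.
Proof. exact: (linear0 T). Qed.
Lemma endo_linB (T : endo) u v : T (u - v) = T u - T v.
Proof. exact: (linearB T). Qed.
End Endomorphisms.

(* v0 != 0 ensures 1 != 0, which an algType requires. *)
Section EndoAlgebra.
Variables (R : comNzRingType) (V : lmodType R) (v0 : V) (v0_neq0 : v0 != 0).
Definition nzendo of v0 != 0 : Type := endo V.
Notation E := (nzendo v0_neq0).
HB.instance Definition _ := GRing.Zmodule.on E.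
HB.instance Definition _ := GRing.PzRing.on E.
Fact nzendo_neq0 : (1 : endo V) != 0.
Proof.
by apply: contraNneq v0_neq0 => /(congr1 (fun T : endo V => T v0)) /= ->.
Qed.
HB.instance Definition _ := GRing.PzSemiRing_isNonZero.Build E nzendo_neq0.
HB.instance Definition _ := GRing.Lmodule.on E.
Fact nzendo_scaleAl (c : R) (S T : E) : c *: (S * T) = (c *: S) * T.
Proof. by apply: endoP. Qed.
Fact nzendo_scaleAr (c : R) (S T : E) : c *: (S * T) = S * (c *: T).
Proof. by apply: endoP => v /=; rewrite linearZ. Qed.
HB.instance Definition _ := GRing.Lmodule_isLalgebra.Build R E nzendo_scaleAl.
HB.instance Definition _ := GRing.Lalgebra_isAlgebra.Build R E nzendo_scaleAr.
Definition EndAlg : algType R := E.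
End EndoAlgebra.

(** * The action of the generators on functions on words *)

Lemma q_expn_eq1 n : (q ^+ n == 1) = (n == 0)%N.
Proof.
have [-> | n0] := eqVneq n 0%N; first by rewrite expr0 eqxx.
apply/eqP; rewrite /q -[X in X = 1]rmorphXn -(rmorph1 (@tofrac _)) => /eqP.
rewrite tofrac_eq => /eqP /(congr1 (fun p : {poly rat} => size p)).
by rewrite size_polyXn size_poly1 => -[] /eqP; rewrite (negbTE n0).
Qed.

Lemma q_neq0 : q != 0.
Proof. by rewrite /q tofrac_eq0 polyX_eq0. Qed.

Lemma q_expz_eq1 (n : int) : (q ^ n == 1) = (n == 0).
Proof.
case: n => n; first by rewrite -exprnP q_expn_eq1.
by rewrite NegzE -exprnN invr_eq1 q_expn_eq1.
Qed.

Lemma q_expz_neq0 (n : int) : q ^ n != 0.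
Proof. by rewrite expfz_neq0 // q_neq0. Qed.

Lemma q_expzD (m n : int) : q ^ (m + n) = q ^ m * q ^ n.
Proof. by rewrite expfzDr ?q_neq0. Qed.

Section Generic.
Context {I : countType} {P : zmodType} (D : bc_datum I P).
Notation a := (bcA D).
Notation s := (bcs D).
Notation alpha := (bcalpha D).
Notation hs := (hs D).

Lemma qi_neq0 i : qi D i != 0.
Proof. by rewrite expf_neq0 // q_neq0. Qed.

Lemma qi_expz i (n : int) : qi D i ^ n = q ^ ((s i)%:Z * n).
Proof. by rewrite /qi -exprz_exp. Qed.

Lemma qiX i n : qi D i ^+ n = q ^ ((s i)%:Z * n%:Z).
Proof. by rewrite -qi_expz. Qed.

Lemma qiXV i n : qi D i ^- n = q ^ (- ((s i)%:Z * n%:Z)).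
Proof. by rewrite qiX invr_expz. Qed.

Lemma qi_subV_neq0 i m : qi D i ^+ m.+1 - qi D i ^- m.+1 != 0.
Proof.
rewrite subr_eq0; apply/eqP => e.
have: qi D i ^+ m.+1 * qi D i ^+ m.+1 == 1.
  by rewrite {2}e mulfV // expf_neq0 // qi_neq0.
by rewrite -exprD -exprM q_expn_eq1; have := bcs_gt0 D i; lia.
Qed.

Lemma qint_neq0 i m : qnum (qi D i) m.+1 != 0.
Proof.
rewrite mulf_neq0 ?qi_subV_neq0 // invr_eq0.
by have := qi_subV_neq0 i 0; rewrite expr1.
Qed.

Lemma a_offdiag_nat i j : i != j ->
  exists n, `|1 - a i j|%N = n.+1 /\ a i j = - n%:Z.
Proof.
by move=> ij; have := bcA_offdiag D ij; exists `|a i j|%N; split; lia.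
Qed.

Definition wtw (w : seq I) : P := \sum_(k <- w) alpha k.

Lemma wtw_cons i w : wtw (i :: w) = alpha i + wtw w.
Proof. exact: big_cons. Qed.

Lemma wtw_cat u w : wtw (u ++ w) = wtw u + wtw w.
Proof. exact: big_cat. Qed.

Lemma hs_alpha i j : hs i (alpha j) = (s i)%:Z * a i j.
Proof. by rewrite /= bc_pairing. Qed.

(* Functions on words, with f_i and e_i acting as the transposes of right
   multiplication by f_i and e_i on a right Verma module of highest weight lam;
   words are read backwards. *)
Section WordFunctions.
Variables (lam : P) (V : lmodType Qq).
Notation Fn := (seq I -> V).

Let fnD (g g' : Fn) w : (g + g') w = g w + g' w. Proof. by []. Qed.
Let fnN (g : Fn) w : (- g) w = - g w. Proof. by []. Qed.
Let fnZ c (g : Fn) w : (c *: g) w = c *: g w. Proof. by []. Qed.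
Let fnE := (fnD, fnN, fnZ).

Definition wf_f (i : I) (g : Fn) : Fn := fun w => g (i :: w).
Definition wf_t (h1 : {additive P -> int}) (g : Fn) : Fn :=
  fun w => q ^ (h1 (lam + wtw w)) *: g w.
Definition wf_k (i : I) (g : Fn) : Fn :=
  (qi D i - (qi D i)^-1)^-1 *: (wf_t (hs i) g - wf_t (\- hs i) g).
(** The recursion is the commutator [e_i, f_j] solved for f_j e_i; the value 0 at the empty word
    says that e_i annihilates the highest weight vector. *)
Fixpoint wf_e_rec (i : I) (w : seq I) (g : Fn) : V :=
  if w is j :: w' then
    wf_e_rec i w' (wf_f j g) - (if i == j then wf_k i g w' else 0)
  else 0.
Definition wf_e (i : I) (g : Fn) : Fn := fun w => wf_e_rec i w g.

Fact wf_f_linear i : linear (wf_f i). Proof. by []. Qed.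
Fact wf_t_linear h1 : linear (wf_t h1).
Proof.
move=> c g g'; apply/funext => w; rewrite /wf_t /=.
by rewrite !fnE scalerDr !scalerA mulrC.
Qed.
Fact wf_k_linear i : linear (wf_k i).
Proof.
move=> c g g'; rewrite /wf_k !wf_t_linear opprD addrACA scalerDr.
by rewrite -scalerBr !scalerA mulrC.
Qed.
Fact wf_e_linear i : linear (wf_e i).
Proof.
move=> c g g'; apply/funext => w; rewrite /wf_e.
change (wf_e_rec i w (c *: g + g') = c *: wf_e_rec i w g + wf_e_rec i w g').
elim: w g g' => [|j w IH] g g' /=; first by rewrite scaler0 addr0.
rewrite wf_f_linear IH wf_k_linear.
case: (i == j); last by rewrite !subr0.
by rewrite scalerBr -addrACA -opprD.
Qed.

Variables (v0 : V) (v0_neq0 : v0 != 0).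
Fact wf_neq0 : (fun w => if w is [::] then v0 else 0) != 0 :> Fn.
Proof. by apply: contraNneq v0_neq0 => /(congr1 (@^~ [::])) /= ->. Qed.
Notation FE := (EndAlg wf_neq0).

Definition op_f i : FE := Endo (wf_f_linear i).
Definition op_t h1 : FE := Endo (wf_t_linear h1).
Definition op_e i : FE := Endo (wf_e_linear i).

Lemma op_t0 : op_t \0 = 1.
Proof. by apply: endoP => g; apply/funext => w; rewrite /= /wf_t /= expr0z scale1r. Qed.

Lemma op_tD (h1 h2 : {additive P -> int}) : op_t h1 * op_t h2 = op_t (h1 \+ h2).
Proof.
apply: endoP => g; apply/funext => w.
by rewrite /= /wf_t scalerA -q_expzD.
Qed.

Lemma op_tN (h1 : {additive P -> int}) : op_t h1 * op_t (\- h1) = 1.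
Proof.
rewrite -op_t0 op_tD; apply: endoP => g; apply/funext => w.
by rewrite /= /wf_t /= subrr.
Qed.

Lemma wf_tf (h1 : {additive P -> int}) i g :
  wf_t h1 (wf_f i g) = q ^ (- h1 (alpha i)) *: wf_f i (wf_t h1 g).
Proof.
apply/funext => w; rewrite fnZ /wf_t /wf_f wtw_cons scalerA -q_expzD !raddfD /=.
by congr (_ ^ _ *: _); ring.
Qed.

Lemma wf_tC (h1 h2 : {additive P -> int}) g :
  wf_t h1 (wf_t h2 g) = wf_t h2 (wf_t h1 g).
Proof. by apply/funext => w; rewrite /wf_t !scalerA mulrC. Qed.

Lemma wf_tB (h1 : {additive P -> int}) g g' :
  wf_t h1 (g - g') = wf_t h1 g - wf_t h1 g'.
Proof. exact: (linearB (op_t h1)). Qed.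

Lemma wf_tZ (h1 : {additive P -> int}) c g : wf_t h1 (c *: g) = c *: wf_t h1 g.
Proof. exact: (linearZZ (op_t h1)). Qed.

Lemma wf_eZ i c g : wf_e i (c *: g) = c *: wf_e i g.
Proof. exact: (linearZZ (op_e i)). Qed.

Lemma wf_kt i (h1 : {additive P -> int}) g : wf_k i (wf_t h1 g) = wf_t h1 (wf_k i g).
Proof. by rewrite /wf_k wf_tZ wf_tB !(wf_tC h1). Qed.

Lemma wf_eS i j g w :
  wf_e i g (j :: w) = wf_e i (wf_f j g) w - (if i == j then wf_k i g w else 0).
Proof. by []. Qed.

Lemma wf_te (h1 : {additive P -> int}) i g :
  wf_t h1 (wf_e i g) = q ^ h1 (alpha i) *: wf_e i (wf_t h1 g).
Proof.
apply/funext => w; rewrite fnZ.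
elim: w g => [|j w IH] g; first by rewrite /wf_t /wf_e /= !scaler0.
have ft : wf_f j (wf_t h1 g) = q ^ h1 (alpha j) *: wf_t h1 (wf_f j g).
  by rewrite wf_tf scalerA -q_expzD subrr expr0z scale1r.
rewrite wf_eS ft wf_eZ fnZ scalerBr scalerA mulrC -scalerA -IH wf_kt.
rewrite {1 3}/wf_t wtw_cons wf_eS scalerBr scalerA -q_expzD addrCA raddfD /=.
congr (_ - _); case: eqP => [->|]; last by rewrite !scaler0.
by rewrite q_expzD -scalerA.
Qed.

Lemma op_tf (h1 : {additive P -> int}) i :
  op_t h1 * op_f i = q ^ (- h1 (alpha i)) *: (op_f i * op_t h1).
Proof. by apply: endoP => g; rewrite endoZ !endoM /= wf_tf. Qed.

Lemma op_te (h1 : {additive P -> int}) i :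
  op_t h1 * op_e i = q ^ h1 (alpha i) *: (op_e i * op_t h1).
Proof. by apply: endoP => g; rewrite endoZ !endoM /= wf_te. Qed.

Lemma op_ef i j : op_e i * op_f j - op_f j * op_e i =
    if i == j then (qi D i - (qi D i)^-1)^-1 *: (op_t (hs i) - op_t (\- hs i)) else 0.
Proof.
apply: endoP => g; apply/funext => w.
change (wf_e i (wf_f j g) w - wf_e i g (j :: w) =
  (if i == j then (qi D i - (qi D i)^-1)^-1 *: (op_t (hs i) - op_t (\- hs i)) else 0 : FE) g w).
rewrite {2}/wf_e /= opprB addrC subrK.
by case: eqP.
Qed.

Let hsE i j : hs i (alpha j) = (s i)%:Z * a i j. Proof. exact: hs_alpha. Qed.

Lemma op_tNf i j :
  op_t (\- hs i) * op_f j = q ^ hs i (alpha j) *: (op_f j * op_t (\- hs i)).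
Proof. by rewrite op_tf /= opprK. Qed.

Lemma op_tNe i j :
  op_t (\- hs i) * op_e j = q ^ (- hs i (alpha j)) *: (op_e j * op_t (\- hs i)).
Proof. by rewrite op_te. Qed.

Lemma op_e_serre_f k i j : is_real D i -> i != j ->
  let S := serre_elt (qi D i) (op_f i) (op_f j) `|1 - a i j|%N in
  op_e k * S = S * op_e k.
Proof.
move=> /eqP ri ij /=; have [n [-> aij]] := a_offdiag_nat ij.
have aijs : (s j)%:Z * a j i = (s i)%:Z * - n%:Z by rewrite -bcA_symm aij.
have efC l m : l != m -> op_e l * op_f m = op_f m * op_e l.
  by move=> lm; apply/eqP; rewrite -subr_eq0 op_ef (negbTE lm).
have [->|ki] := eqVneq k i.
  apply: (serre_elt_comm_outer (qi_neq0 i) (qint_neq0 i)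
            (u := op_t (hs i)) (v := op_t (\- hs i))).
  - exact: efC.
  - by rewrite op_ef eqxx.
  - rewrite op_tf hsE ri qiXV; congr (_ ^ _ *: _); lia.
  - rewrite op_tNf hsE ri qiX; congr (_ ^ _ *: _); lia.
  - rewrite op_tf hsE aij qiX; congr (_ ^ _ *: _); lia.
  - rewrite op_tNf hsE aij qiXV; congr (_ ^ _ *: _); lia.
have [->|kj] := eqVneq k j.
  apply: (serre_elt_comm_middle (qi_neq0 i) (qint_neq0 i) (u := op_t (hs j))
            (v := op_t (\- hs j)) (c := (qi D j - (qi D j)^-1)^-1)).
  - by apply: efC; rewrite eq_sym.
  - by rewrite op_ef eqxx.
  - rewrite op_tf hsE aijs qiX; congr (_ ^ _ *: _); lia.
  - rewrite op_tNf hsE aijs qiXV; congr (_ ^ _ *: _); lia.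
(* An index other than i and j commutes with both factors: a degenerate middle case, with u = v =
   0. *)
by apply: (serre_elt_comm_middle (qi_neq0 i) (qint_neq0 i) (u := 0) (v := 0)
         (c := 0)); rewrite ?efC ?mul0r ?mulr0 ?subrr ?scaler0.
Qed.

Lemma op_serre_e k i j : is_real D i -> i != j ->
  let S := serre_elt (qi D i) (op_e i) (op_e j) `|1 - a i j|%N in
  op_f k * S = S * op_f k.
Proof.
move=> /eqP ri ij /=; have [n [-> aij]] := a_offdiag_nat ij.
have aijs : (s j)%:Z * a j i = (s i)%:Z * - n%:Z by rewrite -bcA_symm aij.
have efC l m : l != m -> op_f l * op_e m = op_e m * op_f l.
  by rewrite eq_sym => lm; apply/esym/eqP; rewrite -subr_eq0 op_ef (negbTE lm).
have [->|ki] := eqVneq k i.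
  (* Exchanging e and f changes the sign of the commutator, so K_i and its inverse exchange roles as
     well. *)
  apply: (serre_elt_comm_outer (qi_neq0 i) (qint_neq0 i)
            (u := op_t (\- hs i)) (v := op_t (hs i))).
  - exact: efC.
  - by rewrite -opprB op_ef eqxx -scalerN opprB.
  - rewrite op_tNe hsE ri qiXV; congr (_ ^ _ *: _); lia.
  - rewrite op_te hsE ri qiX; congr (_ ^ _ *: _); lia.
  - rewrite op_tNe hsE aij qiX; congr (_ ^ _ *: _); lia.
  - rewrite op_te hsE aij qiXV; congr (_ ^ _ *: _); lia.
have [->|kj] := eqVneq k j.
  apply: (serre_elt_comm_middle (qi_neq0 i) (qint_neq0 i) (u := op_t (\- hs j))
            (v := op_t (hs j)) (c := (qi D j - (qi D j)^-1)^-1)).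
  - by apply: efC; rewrite eq_sym.
  - by rewrite -opprB op_ef eqxx -scalerN opprB.
  - rewrite op_tNe hsE aijs qiX; congr (_ ^ _ *: _); lia.
  - rewrite op_te hsE aijs qiXV; congr (_ ^ _ *: _); lia.
by apply: (serre_elt_comm_middle (qi_neq0 i) (qint_neq0 i) (u := 0) (v := 0)
         (c := 0)); rewrite ?efC ?mul0r ?mulr0 ?subrr ?scaler0.
Qed.

End WordFunctions.
End Generic.

(** * Word functions compatible with the Serre relations *)

Section Representation.
Context {I : countType} {P : zmodType} (D : bc_datum I P).
Notation a := (bcA D).
Notation alpha := (bcalpha D).
Notation hs := (hs D).
Variables (lam : P) (V : lmodType Qq) (v0 : V) (v0_neq0 : v0 != 0).
Notation Fn := (seq I -> V).
Notation FE := (EndAlg (@wf_neq0 I _ _ v0_neq0)).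
Notation op_f := (@op_f I _ _ v0_neq0).
Notation op_e := (op_e D lam v0_neq0).
Notation op_t := (op_t D lam v0_neq0).

Inductive relator : FE -> Prop :=
| RelSerre i j of is_real D i & i != j :
    relator (serre_elt (qi D i) (op_f i) (op_f j) `|1 - a i j|%N)
| RelComm i j of a i j = 0 : relator (op_f i * op_f j - op_f j * op_f i).

Lemma op_ef_comm k i j : a i j = 0 ->
  op_e k * (op_f i * op_f j - op_f j * op_f i) =
  (op_f i * op_f j - op_f j * op_f i) * op_e k.
Proof.
move=> aij0; have [->|ij] := eqVneq i j; first by rewrite subrr mulr0 mul0r.
have aji0 : a j i = 0 by apply/(bcA_zero D).
have efC l m : l != m -> op_e l * op_f m = op_f m * op_e l.
  by move=> lm; apply/eqP; rewrite -subr_eq0 op_ef (negbTE lm).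
have tf l m : a l m = 0 -> op_t (hs l) * op_f m = op_f m * op_t (hs l).
  by move=> a0; rewrite op_tf hs_alpha a0 mulr0 oppr0 expr0z scale1r.
have tNf l m : a l m = 0 -> op_t (\- hs l) * op_f m = op_f m * op_t (\- hs l).
  by move=> a0; rewrite op_tNf hs_alpha a0 mulr0 expr0z scale1r.
have ee l : op_e l * op_f l = op_f l * op_e l +
  (qi D l - (qi D l)^-1)^-1 *: (op_t (hs l) - op_t (\- hs l)).
  by have := op_ef D lam v0_neq0 l l; rewrite eqxx => <-; rewrite addrC subrK.
have main l m : l != m -> a l m = 0 ->
  op_e l * (op_f l * op_f m - op_f m * op_f l) =
  (op_f l * op_f m - op_f m * op_f l) * op_e l.
  move=> lm a0; apply: commutator_comm (ee l) (efC _ _ lm) _.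
  by rewrite -scalerAl -scalerAr mulrBl mulrBr tf // tNf.
have [->|ki] := eqVneq k i; first exact: main.
have [->|kj] := eqVneq k j.
  by rewrite -opprB mulrN mulNr main // eq_sym.
by apply: commutator_comm3; apply: efC.
Qed.

Lemma relator_e R k : relator R -> op_e k * R = R * op_e k.
Proof. by case=> [i j ri ij|i j aij]; [exact: op_e_serre_f|exact: op_ef_comm]. Qed.

Lemma relator_t R (h1 : {additive P -> int}) : relator R ->
  exists c, R * op_t h1 = c *: (op_t h1 * R).
Proof.
have f0 i : q ^ (- h1 (alpha i)) != 0 by exact: q_expz_neq0.
suff: relator R -> exists2 x, x != 0 & op_t h1 * R = x *: (R * op_t h1).
  by move=> tR /tR [x x0 ->]; exists x^-1; rewrite scalerA mulVf // scale1r.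
case=> [i j ri ij|i j aij].
  exists ((q ^ (- h1 (alpha i))) ^+ `|1 - a i j|%N * q ^ (- h1 (alpha j))).
    apply: mulf_neq0; [apply: expf_neq0; exact: f0|exact: f0].
  by apply: serre_elt_twist; exact: op_tf.
exists (q ^ (- h1 (alpha i)) * q ^ (- h1 (alpha j))); first by apply: mulf_neq0; exact: f0.
have tt l m : op_t h1 * (op_f l * op_f m) =
    (q ^ (- h1 (alpha l)) * q ^ (- h1 (alpha m))) *: (op_f l * op_f m * op_t h1).
  rewrite mulrA op_tf -scalerAl -(mulrA (op_f l) (op_t h1)) op_tf -scalerAr scalerA.
  by rewrite mulrA.
by rewrite mulrBr mulrBl scalerBr !tt [q ^ (- h1 (alpha j)) * _]mulrC.
Qed.

Definition shift (u : seq I) (g : Fn) : Fn := fun w => g (u ++ w).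

Lemma shift_linear u c g g' : shift u (c *: g + g') = c *: shift u g + shift u g'.
Proof. by []. Qed.

Lemma shift_t u (h1 : {additive P -> int}) g :
  shift u (op_t h1 g) = q ^ h1 (wtw D u) *: op_t h1 (shift u g).
Proof.
apply/funext => w; rewrite /shift /=.
change (wf_t D lam h1 g (u ++ w) = q ^ h1 (wtw D u) *: wf_t D lam h1 (shift u g) w).
rewrite /wf_t scalerA -q_expzD wtw_cat addrCA.
by rewrite [in LHS]raddfD.
Qed.

(** Quantifying over all shifts makes the condition stable under [op_f i], which is the shift by the
    letter i. *)
Definition killed (g : Fn) : Prop := forall R u, relator R -> R (shift u g) = 0.

Lemma killed_linear c g g' : killed g -> killed g' -> killed (c *: g + g').
Proof.
move=> kg kg' R u rR; rewrite shift_linear endo_lin.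
by rewrite (kg R u rR) (kg' R u rR) scaler0 addr0.
Qed.

Lemma killed_f i g : killed g -> killed (op_f i g).
Proof. by move=> kg R u rR; apply: (kg R (i :: u)). Qed.

Lemma killed_t h1 g : killed g -> killed (op_t h1 g).
Proof.
move=> kg R u rR; rewrite shift_t endo_linZ -(endoM R).
by have [c ->] := relator_t h1 rR; rewrite endoZ endoM kg // endo_lin0 !scaler0.
Qed.

Lemma killed0 : killed 0.
Proof. by move=> R u rR; rewrite (_ : shift u 0 = 0) // endo_lin0. Qed.

(** With no shift, R commutes with e_i. A shift is peeled off one letter at a time by f_j e_i = e_i
    f_j - [e_i, f_j], whose last term is a combination of operators [op_t]. *)
Lemma killed_e i g : killed g -> killed (op_e i g).
Proof.
move=> kg R u rR; elim: u g kg => [|j u IH] g kg.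
  change (R (op_e i g) = 0).
  rewrite -(endoM R) -relator_e // (endoM (op_e i)).
  by rewrite (kg R [::] rR : R g = 0) endo_lin0.
change (R (shift u (op_f j (op_e i g))) = 0).
have -> : op_f j (op_e i g) = op_e i (op_f j g) - (if i == j then wf_k D lam i g else 0).
  apply/funext => w.
  rewrite /= /wf_f wf_eS; congr (_ - _).
  by case: (i == j).
have -> : shift u (op_e i (op_f j g) - (if i == j then wf_k D lam i g else 0)) =
  shift u (op_e i (op_f j g)) - shift u (if i == j then wf_k D lam i g else 0) by [].
rewrite endo_linB IH ?sub0r; last exact: killed_f.
apply/eqP; rewrite oppr_eq0; apply/eqP.
have kk : killed (wf_k D lam i g).
  have -> : wf_k D lam i g =
    (qi D i - (qi D i)^-1)^-1 *: (-1 *: op_t (\- hs i) g + op_t (hs i) g) + 0.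
    by rewrite addr0 scaleN1r; congr (_ *: _); rewrite addrC.
  apply: killed_linear; last exact: killed0.
  by apply: killed_linear; exact: killed_t.
by case: eqP => _; [exact: kk|exact: killed0].
Qed.

Lemma op_e_top i (X : FE) g : (op_e i * X) g [::] = 0.
Proof. by []. Qed.

(** The value of X g at k :: w is that of X (f_k g) at w, so the values at the empty word determine
    X. Thus the e_i satisfy their relations on all word functions, whereas the f_i do so only on
    killed ones. *)
Lemma op_eq0 (X : FE) : (forall k, op_f k * X = X * op_f k) ->
  (forall g, X g [::] = 0) -> X = 0.
Proof.
move=> fX X0; apply: endoP => g; apply/funext => w.
elim: w g => [|k w IH] g; first exact: X0.
rewrite (_ : X g (k :: w) = (op_f k * X) g w) // fX endoM.
exact: IH.
Qed.

Lemma op_serre_e0 i j : is_real D i -> i != j ->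
  serre_elt (qi D i) (op_e i) (op_e j) `|1 - a i j|%N = 0.
Proof.
move=> ri ij; apply: op_eq0 => [k|g]; first exact: op_serre_e.
rewrite /serre_elt endo_sum fct_sumE; apply: big1 => r _.
rewrite endoZ; apply/eqP.
rewrite [X in X == _](_ : _ = ((-1) ^+ r * qnum_binom (qi D i) `|1 - a i j|%N r) *:
  ((op_e i ^+ (`|1 - a i j| - r) * op_e j * op_e i ^+ r) g [::])) //.
case: (`|1 - a i j| - r)%N => [|m].
  by rewrite mul1r op_e_top scaler0.
by rewrite exprS -!mulrA op_e_top scaler0.
Qed.

Lemma op_eeC i j : a i j = 0 -> op_e i * op_e j = op_e j * op_e i.
Proof.
move=> aij0; apply/eqP; rewrite -subr_eq0; apply/eqP; apply: op_eq0; last first.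
  move=> g; change ((op_e i * op_e j) g [::] - (op_e j * op_e i) g [::] = 0).
  by rewrite !op_e_top subrr.
move=> k; have [->|ij] := eqVneq i j; first by rewrite subrr mulr0 mul0r.
have aji0 : a j i = 0 by apply/(bcA_zero D).
have efC l m : l != m -> op_f l * op_e m = op_e m * op_f l.
  rewrite eq_sym => lm; apply/esym/eqP.
  by rewrite -subr_eq0 op_ef (negbTE lm).
have te l m : a l m = 0 -> op_t (hs l) * op_e m = op_e m * op_t (hs l).
  by move=> a0; rewrite op_te hs_alpha a0 mulr0 expr0z scale1r.
have tNe l m : a l m = 0 -> op_t (\- hs l) * op_e m = op_e m * op_t (\- hs l).
  by move=> a0; rewrite op_tNe hs_alpha a0 mulr0 oppr0 expr0z scale1r.
have ee l : op_f l * op_e l = op_e l * op_f l +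
  - ((qi D l - (qi D l)^-1)^-1 *: (op_t (hs l) - op_t (\- hs l))).
  have := op_ef D lam v0_neq0 l l; rewrite eqxx => <-.
  by rewrite opprB addrC subrK.
have main l m : l != m -> a l m = 0 ->
  op_f l * (op_e l * op_e m - op_e m * op_e l) =
  (op_e l * op_e m - op_e m * op_e l) * op_f l.
  move=> lm a0; apply: commutator_comm (ee l) (efC _ _ lm) _.
  by rewrite mulNr mulrN -scalerAl -scalerAr mulrBl mulrBr te // tNe.
have [->|ki] := eqVneq k i; first exact: main.
have [->|kj] := eqVneq k j.
  by rewrite -opprB mulrN mulNr main // eq_sym.
by apply: commutator_comm3; apply: efC.
Qed.
End Representation.

Section SerreVanish.
Context {I : countType} {P : zmodType} (D : bc_datum I P).
Notation a := (bcA D).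
Variables (V : lmodType Qq).

(** The powers of i stand in the order opposite to [serre_elt], because a product of operators
    [op_f] reads its word backwards. *)
Definition serre_vanish (g : seq I -> V) : Prop :=
  (forall i j u v, is_real D i -> i != j -> let n := `|1 - a i j|%N in
     \sum_(r < n.+1) ((-1) ^+ r * qnum_binom (qi D i) n r) *:
       g (u ++ nseq r i ++ j :: nseq (n - r) i ++ v) = 0) /\
  (forall i j u v, a i j = 0 -> g (u ++ i :: j :: v) = g (u ++ j :: i :: v)).

Variables (v0 : V) (v0_neq0 : v0 != 0).
Notation op_f := (@op_f I _ _ v0_neq0).

Lemma op_fX i n g w : (op_f i ^+ n) g w = g (nseq n i ++ w).
Proof.
elim: n g w => [|n IH] g w //.
by rewrite exprSr endoM IH.
Qed.

Lemma op_serreE i j n g w : serre_elt (qi D i) (op_f i) (op_f j) n g w =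
  \sum_(r < n.+1) ((-1) ^+ r * qnum_binom (qi D i) n r) *:
       g (nseq r i ++ j :: nseq (n - r) i ++ w).
Proof.
rewrite /serre_elt endo_sum fct_sumE; apply: eq_bigr => r _.
rewrite endoZ; congr (_ *: _).
by rewrite !endoM op_fX [LHS]/= /wf_f op_fX.
Qed.

Lemma serre_vanish_killed g : serre_vanish g -> killed D v0_neq0 g.
Proof.
move=> [gS gC] R u [i j ri ij|i j aij]; apply/funext => w.
  by rewrite op_serreE; exact: gS.
change (shift u g [:: j, i & w] - shift u g [:: i, j & w] = 0).
by rewrite /shift (gC i j u w aij) subrr.
Qed.
End SerreVanish.

(** * The action of U_q(g) on the killed functions *)

Section KilledModule.
Context {I : countType} {P : zmodType} (D : bc_datum I P).
Notation a := (bcA D).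
Notation alpha := (bcalpha D).
Variables (lam : P) (V : lmodType Qq) (v0 : V) (v0_neq0 : v0 != 0).
Notation Fn := (seq I -> V).
Notation FE := (EndAlg (@wf_neq0 I _ _ v0_neq0)).
Notation op_f := (@op_f I _ _ v0_neq0).
Notation op_e := (op_e D lam v0_neq0).
Notation op_t := (op_t D lam v0_neq0).
Notation killed := (killed D v0_neq0).

Definition killed_pred : {pred Fn} := fun g => `[< killed g >].
Fact killed_submod : submod_closed killed_pred.
Proof.
split; first by apply/asboolP; exact: killed0.
by move=> c g g' /asboolP kg /asboolP kg'; apply/asboolP; exact: killed_linear.
Qed.
HB.instance Definition _ :=
  GRing.isSubmodClosed.Build Qq Fn killed_pred killed_submod.

Record kfun := KFun { kval :> Fn; kvalP : kval \in killed_pred }.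
HB.instance Definition _ := [isSub for kval].
HB.instance Definition _ := [Choice of kfun by <:].
HB.instance Definition _ := [SubChoice_isSubLmodule of kfun by <:].

Lemma kval0 : kval 0 = 0. Proof. exact: (raddf0 (\val : kfun -> Fn)). Qed.
Lemma kvalD g g' : kval (g + g') = kval g + kval g'.
Proof. exact: (raddfD (\val : kfun -> Fn)). Qed.
Lemma kvalN g : kval (- g) = - kval g.
Proof. exact: (raddfN (\val : kfun -> Fn)). Qed.
Lemma kvalZ c g : kval (c *: g) = c *: kval g.
Proof. exact: (linearZZ (\val : kfun -> Fn)). Qed.

Lemma kfunP (g : kfun) : killed g. Proof. exact/asboolP/kvalP. Qed.
Definition mk_kfun (g : Fn) (kg : killed g) : kfun := KFun (introT (asboolP _) kg).

(** A nonzero killed function, which makes the endomorphisms of the killed functions a nonzero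
    algebra. *)
Definition vacuum : Fn := fun w => if w is [::] then v0 else 0.
Lemma vacuum_killed : killed vacuum.
Proof.
apply: serre_vanish_killed; split=> [i j u v _ _|i j u v _]; last by case: u.
by apply: big1 => r _; case: u; case: (r : nat) => *; rewrite scaler0.
Qed.
Lemma vacuum_neq0 : mk_kfun vacuum_killed != 0.
Proof.
apply: contraNneq v0_neq0 => /(congr1 (fun g : kfun => kval g [::])) e.
apply/eqP; rewrite -[v0]/(kval (mk_kfun vacuum_killed) [::]) [LHS]e.
exact: (congr1 (@^~ [::]) kval0).
Qed.
Notation EN := (EndAlg vacuum_neq0).

Definition k_op (T : FE) (kT : forall g, killed g -> killed (T g)) (g : kfun) : kfun :=
  mk_kfun (kT g (kfunP g)).
Fact k_op_linear T kT : linear (@k_op T kT).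
Proof.
move=> c g g'; apply: val_inj.
change (T (kval (c *: g + g')) = kval (c *: k_op kT g + k_op kT g')).
by rewrite !kvalD !kvalZ endo_lin.
Qed.
Definition k_endo T kT : EN := Endo (@k_op_linear T kT).
Definition k_f i : EN := k_endo (@killed_f _ _ D V v0 v0_neq0 i).
Definition k_e i : EN := k_endo (@killed_e _ _ D lam V v0 v0_neq0 i).
Definition k_t h1 : EN := k_endo (@killed_t _ _ D lam V v0 v0_neq0 h1).

(** Y determines X ([lifts_eq]), so an identity between operators on all functions passes to the
    submodule by computing only with Y. *)
Definition lifts (X : EN) (Y : FE) := forall g : kfun, kval (X g) = Y (kval g).

Lemma lifts_f i : lifts (k_f i) (op_f i). Proof. by []. Qed.
Lemma lifts_e i : lifts (k_e i) (op_e i). Proof. by []. Qed.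
Lemma lifts_t h1 : lifts (k_t h1) (op_t h1). Proof. by []. Qed.
Lemma lifts0 : lifts 0 0. Proof. by move=> g; exact: kval0. Qed.
Lemma liftsM X Y X' Y' : lifts X Y -> lifts X' Y' -> lifts (X * X') (Y * Y').
Proof. by move=> XY XY' g; rewrite !endoM XY XY'. Qed.
Lemma liftsD X Y X' Y' : lifts X Y -> lifts X' Y' -> lifts (X + X') (Y + Y').
Proof. by move=> XY XY' g; rewrite !endoD kvalD XY XY'. Qed.
Lemma liftsN X Y : lifts X Y -> lifts (- X) (- Y).
Proof. by move=> XY g; rewrite !endoN kvalN XY. Qed.
Lemma liftsZ c X Y : lifts X Y -> lifts (c *: X) (c *: Y).
Proof. by move=> XY g; rewrite !endoZ kvalZ XY. Qed.
Lemma liftsX X Y n : lifts X Y -> lifts (X ^+ n) (Y ^+ n).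
Proof. by move=> XY; elim: n => // n IH; rewrite !exprS; exact: liftsM. Qed.
Lemma lifts_sum n (X : 'I_n -> EN) (Y : 'I_n -> FE) :
  (forall r, lifts (X r) (Y r)) -> lifts (\sum_(r < n) X r) (\sum_(r < n) Y r).
Proof.
by move=> XY; elim/big_ind2: _ => *; [exact: lifts0|exact: liftsD|].
Qed.

Lemma lifts_eq X X' Y : lifts X Y -> lifts X' Y -> X = X'.
Proof.
move=> XY XY'; apply: endoP => g; apply: val_inj.
exact: etrans (XY g) (esym (XY' g)).
Qed.

Lemma lifts_relator X R : relator D R -> lifts X R -> X = 0.
Proof.
move=> rR XR; apply: endoP => g; apply: val_inj; apply: etrans (XR g) _.
by rewrite (kfunP g [::] rR : R (kval g) = 0); exact: esym kval0.
Qed.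

Lemma lifts_serre i n (X X' : EN) (Y Y' : FE) : lifts X Y -> lifts X' Y' ->
  lifts (serre_elt (qi D i) X X' n) (serre_elt (qi D i) Y Y' n).
Proof.
move=> XY XY'; apply: lifts_sum => r; apply: liftsZ.
by apply: liftsM (liftsM _ XY') _; apply: liftsX.
Qed.

Lemma k_relations : uq_relations D k_e k_f k_t.
Proof.
split.
- by apply: (lifts_eq (lifts_t _)); rewrite op_t0.
- move=> h1 h2; apply: (lifts_eq (liftsM (lifts_t _) (lifts_t _))).
  by rewrite op_tD.
- move=> h1 i; apply: lifts_eq (liftsZ _ (lifts_e i)).
  have <- : op_t h1 * op_e i * op_t (\- h1) = q ^ h1 (alpha i) *: op_e i.
    by rewrite op_te -scalerAl -mulrA op_tN mulr1.
  by do 2?[apply: liftsM].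
- move=> h1 i; apply: lifts_eq (liftsZ _ (lifts_f i)).
  have <- : op_t h1 * op_f i * op_t (\- h1) = q ^ (- h1 (alpha i)) *: op_f i.
    by rewrite op_tf -scalerAl -mulrA op_tN mulr1.
  by do 2?[apply: liftsM].
- move=> i j.
  apply: (@lifts_eq _ _ (op_e i * op_f j - op_f j * op_e i)).
    by apply: liftsD; [|apply: liftsN]; apply: liftsM.
  rewrite op_ef; case: eqP => _; last exact: lifts0.
  by apply: liftsZ; apply: liftsD => //; apply: liftsN.
- move=> i j ri ij; apply: lifts_eq lifts0.
  have := @lifts_serre i `|1 - a i j|%N _ _ _ _ (lifts_e i) (lifts_e j).
  by rewrite (op_serre_e0 lam v0_neq0 ri ij).
- move=> i j ri ij; apply: (lifts_relator (RelSerre v0_neq0 ri ij)).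
  exact: (@lifts_serre i `|1 - a i j|%N _ _ _ _ (lifts_f i) (lifts_f j)).
- move=> i j aij; apply: (@lifts_eq _ _ (op_e i * op_e j)); first exact: liftsM.
  by rewrite op_eeC //; exact: liftsM.
- move=> i j aij; apply/eqP; rewrite -subr_eq0; apply/eqP.
  apply: (lifts_relator (RelComm v0_neq0 aij)).
  by apply: liftsD; [|apply: liftsN]; apply: liftsM.
Qed.
End KilledModule.

Local Open Scope classical_set_scope.

(** * The negative part and its presentation *)

Lemma qnum_binom_sym (K : fieldType) (Q : K) n r : (r <= n)%N ->
  qnum_binom Q n (n - r) = qnum_binom Q n r.
Proof. by move=> rn; rewrite /qnum_binom subKn // (mulrC (qnum_fact Q r)). Qed.

Section Uminus.
Context {I : countType} {P : zmodType} (D : bc_datum I P).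
Notation a := (bcA D).
Notation s := (bcs D).
Notation hs := (hs D).
Notation Uq := (Uq D).
Notation F := (gen_f D).
Notation E := (gen_e D).
Notation T := (gen_q D).
Notation fm := (fmonomial D).
Notation Um := (@Uminus I P D).

Lemma fm_cons i w : fm (i :: w) = F i * fm w.
Proof. exact: big_cons. Qed.
Lemma fm_nil : fm [::] = 1. Proof. exact: big_nil. Qed.
Lemma fm_cat u w : fm (u ++ w) = fm u * fm w.
Proof. exact: big_cat. Qed.
Lemma fm_nseq n i : fm (nseq n i) = F i ^+ n.
Proof. by elim: n => [|n IH]; rewrite ?fm_nil //= fm_cons IH exprS. Qed.
Lemma fm1 i : fm [:: i] = F i. Proof. exact: big_seq1. Qed.

Lemma Uminus_closed : subalg_closed (mem Um).
Proof.
split=> [|c x y xU yU|x y xU yU]; apply/mem_set => S [[S1 SL SM] FS].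
- by have := S1; rewrite inE.
- have Sx : x \in S by apply/mem_set; move/set_mem: xU; apply.
  have Sy : y \in S by apply/mem_set; move/set_mem: yU; apply.
  by apply/set_mem; exact: SL.
- have Sx : x \in S by apply/mem_set; move/set_mem: xU; apply.
  have Sy : y \in S by apply/mem_set; move/set_mem: yU; apply.
  by apply/set_mem; exact: SM.
Qed.

Lemma Uminus1 : Um 1.
Proof. by apply/set_mem; case: Uminus_closed. Qed.
Lemma Uminus_lin c x y : Um x -> Um y -> Um (c *: x + y).
Proof.
move=> /mem_set xU /mem_set yU; apply/set_mem.
by case: Uminus_closed => _ + _; apply.
Qed.
Lemma Uminus0 : Um 0.
Proof. by have := Uminus_lin (-1) Uminus1 Uminus1; rewrite scaleN1r addNr. Qed.
Lemma UminusZ c x : Um x -> Um (c *: x).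
Proof. by move=> xU; rewrite -[_ *: _]addr0; apply: Uminus_lin Uminus0. Qed.
Lemma UminusD x y : Um x -> Um y -> Um (x + y).
Proof. by rewrite -{2}[x]scale1r; exact: Uminus_lin. Qed.
Lemma UminusB x y : Um x -> Um y -> Um (x - y).
Proof. by move=> xU yU; rewrite addrC -scaleN1r; exact: Uminus_lin. Qed.
Lemma UminusM x y : Um x -> Um y -> Um (x * y).
Proof.
move=> /mem_set xU /mem_set yU; apply/set_mem.
by case: Uminus_closed => _ _; apply.
Qed.
Lemma Uminus_gen i : Um (F i).
Proof. by move=> S [_]; apply; exists i. Qed.
Lemma Uminus_fm w : Um (fm w).
Proof.
elim: w => [|i w IH]; first by rewrite fm_nil; exact: Uminus1.
by rewrite fm_cons; apply: UminusM IH; exact: Uminus_gen.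
Qed.
Lemma UminusX x n : Um x -> Um (x ^+ n).
Proof.
move=> xU; elim: n => [|n IH]; first exact: Uminus1.
by rewrite exprS; exact: UminusM.
Qed.

Definition fsum (l : seq (Qq * seq I)) : Uq := \sum_(p <- l) p.1 *: fm p.2.

Lemma fsum_cat l l' : fsum (l ++ l') = fsum l + fsum l'.
Proof. exact: big_cat. Qed.

Lemma UminusP x : Um x -> exists l, x = fsum l.
Proof.
move=> xU; suff: [set y | exists l, y = fsum l] x by [].
apply: xU; split; last first.
  by move=> _ [i _ <-]; exists [:: (1, [:: i])]; rewrite /fsum big_seq1 scale1r fm1.
have scl c l : c *: fsum l = fsum [seq (c * p.1, p.2) | p <- l].
  by rewrite /fsum big_map scaler_sumr; apply: eq_bigr => p _; rewrite scalerA.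
split=> [|c x1 y1|x1 y1].
- by rewrite inE; exists [:: (1, [::])]; rewrite /fsum big_seq1 scale1r fm_nil.
- rewrite !inE => -[l ->] [l' ->]; rewrite scl -fsum_cat; by eexists.
- rewrite !inE => -[l ->] [l' ->].
  exists (flatten [seq [seq (p.1 * p'.1, p.2 ++ p'.2) | p' <- l'] | p <- l]).
  rewrite /fsum big_flatten big_map mulr_suml; apply: eq_bigr => p _.
  rewrite big_map mulr_sumr; apply: eq_bigr => p' _ /=.
  by rewrite fm_cat -scalerAl -scalerAr scalerA.
Qed.

Lemma Uminus_ind (Pr : Uq -> Prop) : (forall w, Pr (fm w)) ->
  (forall c x y, Um x -> Um y -> Pr x -> Pr y -> Pr (c *: x + y)) -> Pr 0 ->
  forall x, Um x -> Pr x.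
Proof.
move=> Pw PL P0 x /UminusP[l ->].
elim: l => [|p l IH]; first by rewrite /fsum big_nil.
rewrite /fsum big_cons; apply: PL => //; first exact: Uminus_fm.
by rewrite /fsum; elim/big_ind: _ => [|*|*]; [exact: Uminus0|exact: UminusD|
  apply: UminusZ; exact: Uminus_fm].
Qed.

(** Replacing r by n - r preserves the binomial and multiplies the sum by (-1)^n, so both orders
    express the same relation. *)
Lemma serre_vanish_sym (V : lmodType Qq) (g : seq I -> V) :
  (forall i j u v, is_real D i -> i != j -> let n := `|1 - a i j|%N in
     \sum_(r < n.+1) ((-1) ^+ r * qnum_binom (qi D i) n r) *:
       g (u ++ nseq (n - r) i ++ j :: nseq r i ++ v) = 0) ->
  (forall i j u v, a i j = 0 -> g (u ++ i :: j :: v) = g (u ++ j :: i :: v)) ->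
  serre_vanish D g.
Proof.
move=> gS gC; split=> // i j u v ri ij n.
apply/eqP; rewrite -(inj_eq (scalerI (_ : (-1) ^+ n != 0 :> Qq))) ?signr_eq0 //.
rewrite scaler0 -[X in _ == X](gS i j u v ri ij) -/n scaler_sumr; apply/eqP.
rewrite [RHS](reindex_inj rev_ord_inj) /=; apply: eq_bigr => -[r rn] _ /=.
have rn' : (r <= n)%N by [].
rewrite subSS subKn // scalerA mulrA (qnum_binom_sym _ rn').
move: (qnum_binom _ _ _) (g _) => c y; congr (_ * _ *: _).
by rewrite -{1}(subnK rn') exprD -mulrA -expr2 sqrr_sign mulr1.
Qed.

Lemma serre_vanish_rev (V : lmodType Qq) (g : seq I -> V) :
  serre_vanish D g -> serre_vanish D (g \o rev).
Proof.
move=> [gS gC]; apply: serre_vanish_sym => [i j u v ri ij n|i j u v aij] /=.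
  rewrite -[RHS](gS i j (rev v) (rev u) ri ij) -/n; apply: eq_bigr => r _.
  have revn k : rev (nseq k i) = nseq k i.
    by elim: k => //= k IH; rewrite rev_cons IH -[RHS]/(nseq k.+1 i) -addn1 nseqD cats1.
  congr (_ *: g _); rewrite !rev_cat rev_cons rev_cat !revn.
  by rewrite -!cats1 -!catA.
have aji : a j i = 0 by apply/(bcA_zero D).
by rewrite !rev_cat !rev_cons -!cats1 -!catA gC.
Qed.

(** The words of one relation are permutations of each other, so the factor [chi] comes out of the
    sum. *)
Lemma serre_vanish_twist (V : lmodType Qq) (g : seq I -> V) (chi : seq I -> Qq) :
  (forall u v, perm_eq u v -> chi u = chi v) -> serre_vanish D g ->
  serre_vanish D (fun w => chi w *: g w).
Proof.
move=> chiP [gS gC]; split=> [i j u v ri ij n|i j u v aij].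
  transitivity (chi (u ++ nseq n i ++ j :: v) *: (\sum_(r < n.+1)
    ((-1) ^+ r * qnum_binom (qi D i) n r) *:
       g (u ++ nseq r i ++ j :: nseq (n - r) i ++ v))).
    rewrite scaler_sumr; apply: eq_bigr => -[r rn] _ /=.
    rewrite !scalerA mulrC; congr (_ * _ *: _); apply: chiP.
    apply/permP => p; rewrite !count_cat /= !count_cat !count_nseq.
    by case: (p i); rewrite ?mul1n ?mul0n; lia.
  by rewrite gS // scaler0.
rewrite gC //; congr (_ *: _); apply: chiP; rewrite perm_cat2l.
by rewrite -(cat1s i) -(cat1s j v) perm_catCA.
Qed.

Lemma serre_vanish_fm : serre_vanish D fm.
Proof.
apply: serre_vanish_sym => [i j u v ri ij n|i j u v aij].
  transitivity (fm u * (\sum_(r < n.+1) ((-1) ^+ r * qbinom D i n r) *: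
       (F i ^+ (n - r) * F j * F i ^+ r)) * fm v).
    rewrite mulr_sumr mulr_suml; apply: eq_bigr => r _.
    rewrite -scalerAr -scalerAl !fm_cat fm_cons fm_cat !fm_nseq.
    by rewrite !mulrA.
  by rewrite (serre_f (Uq_rel D) ri ij) mulr0 mul0r.
by rewrite !fm_cat !fm_cons !mulrA -!(mulrA (fm u)) (rel_ff (Uq_rel D) aij).
Qed.

Section Rep.
Variable (lam : P).
Notation one := (oner_neq0 Uq).

Lemma word_rep : exists2 phi : Uq -> endo (kfun D one),
  [/\ forall x g, kval (phi (E x) g) = op_e D lam one x (kval g),
      forall x g, kval (phi (F x) g) = op_f one x (kval g) &
      forall h1 g, kval (phi (T h1) g) = op_t D lam one h1 (kval g)] &
  [/\ forall x y g, phi (x * y) g = phi x (phi y g),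
      forall c x y g, phi (c *: x + y) g = c *: phi x g + phi y g &
      forall g, phi 1 g = g].
Proof.
have [phi [pe pf pt] _] := Uq_lift (k_relations D lam one).
exists phi; first by split=> [x g|x g|x g]; rewrite ?pe ?pf ?pt.
split=> [x y g|c x y g|g]; first by rewrite rmorphM.
  by rewrite linearP.
by rewrite rmorph1.
Qed.

Lemma word_rep_fm (phi : Uq -> endo (kfun D one)) :
  (forall x g, kval (phi (F x) g) = op_f one x (kval g)) ->
  (forall x y g, phi (x * y) g = phi x (phi y g)) -> (forall g, phi 1 g = g) ->
  forall w g v, kval (phi (fm w) g) v = kval g (rev w ++ v).
Proof.
move=> pf pM p1; elim=> [|i w IH] g v; first by rewrite fm_nil p1.
by rewrite fm_cons pM pf [LHS]IH rev_cons cat_rcons.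
Qed.
End Rep.

(** The presentation of U_q^-: its monomials satisfy only the consequences of the Serre relations.
    Since f_i reads one letter of the argument, the monomial of w acting on [g \o rev] has value g w
    at the empty word. *)
Lemma word_ext (g : seq I -> Uq) : serre_vanish D g ->
  exists G : {linear Uq -> Uq}, forall w, G (fm w) = g w.
Proof.
move=> gS; have kg := serre_vanish_killed (v0_neq0 := oner_neq0 Uq) (serre_vanish_rev gS).
have [phi [_ pf _] [pM pL p1]] := word_rep 0.
pose G x : Uq := kval (phi x (mk_kfun kg)) [::].
have lG : linear G by move=> c x y; rewrite /G pL kvalD kvalZ.
pose Gl : {linear Uq -> Uq} := HB.pack G (GRing.isLinear.Build Qq Uq Uq *:%R G lG).
exists Gl => w /=.
by rewrite /G (word_rep_fm pf pM p1) cats0 /= revK.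
Qed.

(* Acting with the highest weights 0 and Lambda_i gives two linear equations
   for y and z, with invertible matrix. *)
Lemma eprime_linear i : exists d : {linear Uq -> Uq},
  forall x y z, Um y -> Um z -> eprime_eq i x y z -> z = d x.
Proof.
have kg := serre_vanish_killed (v0_neq0 := oner_neq0 Uq) (serre_vanish_rev serre_vanish_fm).
have [L hL] := bcLambda D i.
suff main lam : exists G : {linear Uq -> Uq}, forall x y z, Um y -> Um z ->
    eprime_eq i x y z ->
    - G x = (qi D i - (qi D i)^-1)^-1 *: (q ^ hs i lam *: y - q ^ (- hs i lam) *: z).
  have [G0 hG0] := main 0; have [G1 hG1] := main L.
  (* At highest weight 0 the coefficients of y and z are 1 and -1, at Lambda_i they are q_i and
     -q_i^(-1); this combination eliminates y and leaves z with coefficient 1. *)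
  pose G x := qi D i *: G0 x - G1 x.
  have lG : linear G.
    move=> c x y; rewrite /G (linearP G0) (linearP G1) /= scalerDr opprD addrACA scalerA mulrC.
    by rewrite -scalerA -scalerBr.
  pose Gl : {linear Uq -> Uq} := HB.pack G (GRing.isLinear.Build Qq Uq Uq *:%R G lG).
  exists Gl => x y z yU zU xyz /=.
  have e0 := hG0 x y z yU zU xyz; have e1 := hG1 x y z yU zU xyz.
  have hsL : hs i L = (s i)%:Z by rewrite /= hL eqxx mulr1.
  rewrite raddf0 oppr0 expr0z !scale1r in e0; rewrite hsL in e1.
  have qE : q ^ (s i)%:Z = qi D i by [].
  have qVE : q ^ (- (s i)%:Z) = (qi D i)^-1 by rewrite -qE invr_expz.
  rewrite qE qVE in e1.
  rewrite /G -[G0 x]opprK e0 -[in RHS](opprK (G1 x)) opprK e1 scalerN scalerA mulrC.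
  rewrite -scalerA -scalerN -scalerDr scalerBr.
  have -> : - (qi D i *: y - qi D i *: z) + (qi D i *: y - (qi D i)^-1 *: z) =
    (qi D i - (qi D i)^-1) *: z.
    by rewrite opprB addrA subrK scalerBl.
  by rewrite scalerA mulVf ?scale1r //; have := qi_subV_neq0 D i 0; rewrite expr1.
have [phi [pe pf pt] [pM pL p1]] := word_rep lam.
pose ev x : Uq := kval (phi x (mk_kfun kg)) [::].
pose G x : Uq := ev (x * E i).
have lev : linear ev by move=> c x y; rewrite /ev pL kvalD kvalZ.
have lG : linear G by move=> c x y; rewrite /G mulrDl -scalerAl lev.
pose Gl : {linear Uq -> Uq} := HB.pack G (GRing.isLinear.Build Qq Uq Uq *:%R G lG).
exists Gl => x y z yU zU xyz /=.
have evU x' : Um x' -> ev x' = x'.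
  move: x'; apply: Uminus_ind => [w|c x1 y1 _ _|].
  - by rewrite /ev (word_rep_fm pf pM p1) cats0 /= revK.
  - by rewrite lev => -> ->.
  - have := lev (-1) 0 0; rewrite scaler0 addr0 scaleN1r addNr.
    by [].
have evT h1 x' : Um x' -> ev (T h1 * x') = q ^ h1 lam *: x'.
  move=> x'U; rewrite -[in RHS](evU _ x'U) /ev pM pt /= /wf_t /wtw big_nil addr0.
  by [].
have evB x1 x2 : ev (x1 - x2) = ev x1 - ev x2.
  by rewrite addrC -scaleN1r lev scaleN1r addrC.
have evZ c x1 : ev (c *: x1) = c *: ev x1.
  have e0 : ev 0 = 0 by apply: evU; exact: Uminus0.
  by rewrite -[c *: x1]addr0 lev e0 addr0.
have := congr1 ev xyz; rewrite /eprime_eq evB evZ evB !evT //.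
(* [wf_e] is 0 at the empty word, so only the term x e_i of the commutator survives. *)
rewrite [ev (E i * x)](_ : _ = 0) ?sub0r //.
by rewrite /ev pM pe.
Qed.
End Uminus.

(** * The derivations e_i' *)

(** [gen_q] is indexed by additive maps, so K_i^(-1) K_i = 1 requires that pointwise equal maps be
    equal. *)
Lemma additive_ext (U V : zmodType) (f g : {additive U -> V}) : f =1 g -> f = g.
Proof.
case: f => f [[fA]]; case: g => g [[gA]] /= /funext fg.
have ffg : f = g by []; subst g.
by rewrite (Prop_irrelevance fA gA).
Qed.

Section Derivations.
Context {I : countType} {P : zmodType} (D : bc_datum I P).
Notation a := (bcA D).
Notation s := (bcs D).
Notation alpha := (bcalpha D).
Notation hs := (hs D).
Notation Uq := (Uq D).
Notation F := (gen_f D).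
Notation E := (gen_e D).
Notation T := (gen_q D).
Notation fm := (fmonomial D).
Notation Um := (@Uminus I P D).

(** A linear map defined on all of [Uq], so that the theory of linear maps applies without
    membership conditions; on U_q^- it is [eprime] ([eprimeE]). *)
Definition ed (i : I) : {linear Uq -> Uq} := sval (cid (eprime_linear D i)).

Lemma edP i (x y z : Uq) : Um y -> Um z -> eprime_eq i x y z -> z = ed i x.
Proof. by rewrite /ed; case: cid => d /= hd; exact: hd. Qed.

(** The symmetric bilinear form (alpha_i, alpha_j). *)
Definition pr (i j : I) : int := (s i)%:Z * a i j.
Lemma prC i j : pr i j = pr j i. Proof. exact: bcA_symm. Qed.

Lemma gen_qNK (h1 : {additive P -> int}) : T (\- h1) * T h1 = 1.
Proof.
rewrite (rel_tD (Uq_rel D)) -(rel_t0 (Uq_rel D)); congr T.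
by apply: additive_ext => x; rewrite /= addNr.
Qed.

Lemma gen_qf (h1 : {additive P -> int}) j :
  F j * T h1 = q ^ h1 (alpha j) *: (T h1 * F j).
Proof.
have := rel_tf (Uq_rel D) h1 j => /(congr1 (fun x => x * T h1)).
rewrite -[_ * T (\- h1) * _]mulrA gen_qNK mulr1 -scalerAl => ->.
by rewrite scalerA -q_expzD subrr expr0z scale1r.
Qed.

(** Moving F_j across K_i and across its inverse costs opposite powers of q, hence the opposite
    exponents for y and z. Both the existence of e_i' and its recursion come from here. *)
Lemma eprime_eq_F i j (x y z : Uq) : eprime_eq i x y z ->
  eprime_eq i (F j * x) ((i == j)%:R *: x + q ^ pr i j *: (F j * y))
                        ((i == j)%:R *: x + q ^ (- pr i j) *: (F j * z)).
Proof.
rewrite /eprime_eq => xyz.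
have -> : E i * (F j * x) - F j * x * E i =
    (E i * F j - F j * E i) * x + F j * (E i * x - x * E i).
  by rewrite mulrBl mulrBr !mulrA addrA subrK.
rewrite xyz (rel_ef (Uq_rel D)) -scalerAr mulrBr !mulrA !gen_qf.
have -> : (\- hs i : {additive P -> int}) (alpha j) = - pr i j.
  by rewrite /= bc_pairing.
rewrite hs_alpha -/(pr i j) -!scalerAl -!mulrA !mulrDr opprD addrACA.
rewrite -!scalerAr [RHS]scalerDr; congr (_ + _).
case: eqP => _; last by rewrite !scale0r subrr scaler0 mul0r.
by rewrite !scale1r -scalerAl mulrBl.
Qed.

Lemma eprime_eq0 i : eprime_eq i (0 : Uq) 0 0.
Proof. by rewrite /eprime_eq !mulr0 mul0r !subrr scaler0. Qed.

Lemma eprime_eq1 i : eprime_eq i (1 : Uq) 0 0.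
Proof. by rewrite /eprime_eq !mulr0 mulr1 mul1r !subrr scaler0. Qed.

Lemma eprime_eq_lin i c (x y z x' y' z' : Uq) : eprime_eq i x y z ->
  eprime_eq i x' y' z' -> eprime_eq i (c *: x + x') (c *: y + y') (c *: z + z').
Proof.
rewrite /eprime_eq => xyz xyz'.
have lin (u x1 x2 : Uq) : u * (c *: x1 + x2) = c *: (u * x1) + u * x2.
  by rewrite mulrDr -scalerAr.
rewrite !lin mulrDl -scalerAl opprD addrACA -scalerBr xyz xyz'.
rewrite [in RHS]opprD [in RHS]addrACA -[in RHS]scalerBr [RHS]scalerDr; congr (_ + _).
by rewrite !scalerA mulrC.
Qed.

Lemma eprime_ex i (x : Uq) : Um x -> exists y z, [/\ Um y, Um z & eprime_eq i x y z].
Proof.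
move: x; apply: Uminus_ind => [w|c x x' _ _ [y [z [yU zU e]]] [y' [z' [yU' zU' e']]]|].
- elim: w => [|j w [y [z [yU zU e]]]].
    by exists 0, 0; split; rewrite ?fm_nil; by [exact: Uminus0|exact: eprime_eq1].
  do 2 eexists; split; last by rewrite fm_cons; exact: eprime_eq_F e.
    apply: Uminus_lin; first exact: Uminus_fm.
    by apply: UminusZ; apply: UminusM => //; exact: Uminus_gen.
  apply: Uminus_lin; first exact: Uminus_fm.
  by apply: UminusZ; apply: UminusM => //; exact: Uminus_gen.
- do 2 eexists; split; last exact: eprime_eq_lin e e'.
    exact: Uminus_lin.
  exact: Uminus_lin.
- by exists 0, 0; split; by [exact: Uminus0|exact: eprime_eq0].
Qed.

Lemma eprimeE i (x : Uq) : Um x -> eprime i x = ed i x.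
Proof.
move=> xU; rewrite /eprime.
have [y [z [yU zU e]]] := eprime_ex i xU.
by case: xgetP => [[y' z'] _ [yU' zU' e']|/(_ (y, z))]; [exact: edP e'|case].
Qed.

Lemma Uminus_ed i x : Um x -> Um (ed i x).
Proof. by move=> /(eprime_ex i)[y [z [yU zU /(edP yU zU) <-]]]. Qed.

Lemma ed1 i : ed i 1 = 0.
Proof. by rewrite -(edP _ _ (eprime_eq1 i)) //; exact: Uminus0. Qed.

Lemma ed_F i j x : Um x ->
  ed i (F j * x) = (i == j)%:R *: x + q ^ (- pr i j) *: (F j * ed i x).
Proof.
move=> xU; have [y [z [yU zU e]]] := eprime_ex i xU.
rewrite -(edP yU zU e); apply/esym/edP; last exact: eprime_eq_F e.
  by apply: Uminus_lin => //; apply: UminusZ; apply: UminusM => //; exact: Uminus_gen.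
by apply: Uminus_lin => //; apply: UminusZ; apply: UminusM => //; exact: Uminus_gen.
Qed.

Definition wpr (i : I) (w : seq I) : int := \sum_(j <- w) pr i j.
Lemma wpr_cons i j w : wpr i (j :: w) = pr i j + wpr i w.
Proof. exact: big_cons. Qed.
Lemma wpr_nil i : wpr i [::] = 0. Proof. exact: big_nil. Qed.
Lemma wpr_cat i u w : wpr i (u ++ w) = wpr i u + wpr i w.
Proof. exact: big_cat. Qed.
Lemma wpr_perm i u w : perm_eq u w -> wpr i u = wpr i w.
Proof. exact: perm_big. Qed.

Lemma ed_fm_cat i u x : Um x ->
  ed i (fm u * x) = ed i (fm u) * x + q ^ (- wpr i u) *: (fm u * ed i x).
Proof.
move=> xU; elim: u => [|j u IH].
  by rewrite fm_nil ed1 mul0r !mul1r wpr_nil oppr0 expr0z scale1r add0r.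
have uU : Um (fm u) := Uminus_fm _; have uxU := UminusM uU xU.
rewrite fm_cons -mulrA !ed_F // IH mulrDl -!scalerAl mulrDr scalerDr addrA.
by rewrite !mulrA -scalerAr scalerA -q_expzD wpr_cons opprD mulrA.
Qed.

(** The anti-automorphism of U_q^- fixing each f_i, available because the Serre relations are stable
    under reversal. *)
Definition rv : {linear Uq -> Uq} :=
  sval (cid (word_ext (serre_vanish_rev (serre_vanish_fm D)))).
Lemma rv_fm w : rv (fm w) = fm (rev w).
Proof. by rewrite /rv; case: cid. Qed.

Definition perm_inv (chi : seq I -> Qq) := forall u v, perm_eq u v -> chi u = chi v.
Definition tw (chi : seq I -> Qq) (h : perm_inv chi) : {linear Uq -> Uq} :=
  sval (cid (word_ext (serre_vanish_twist h (serre_vanish_fm D)))).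
Lemma tw_fm chi (h : perm_inv chi) w : tw h (fm w) = chi w *: fm w.
Proof.
have /= hG := svalP (cid (word_ext (serre_vanish_twist h (serre_vanish_fm D)))).
exact: hG.
Qed.

Lemma rv1 : rv 1 = 1. Proof. by rewrite -(fm_nil D) rv_fm. Qed.

Lemma linear_Uminus (G H : {linear Uq -> Uq}) :
  (forall w, G (fm w) = H (fm w)) -> forall x, Um x -> G x = H x.
Proof.
move=> GH; apply: Uminus_ind => // [c x y _ _ ex ey|]; last by rewrite !linear0.
by rewrite !linearP ex ey.
Qed.

Lemma Uminus_linear (G : {linear Uq -> Uq}) :
  (forall w, Um (G (fm w))) -> forall x, Um x -> Um (G x).
Proof.
move=> GU; apply: Uminus_ind => // [c x y _ _ ex ey|].
  by rewrite linearP; exact: Uminus_lin.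
by rewrite linear0; exact: Uminus0.
Qed.

Lemma Uminus_rv x : Um x -> Um (rv x).
Proof. by apply: Uminus_linear => w; rewrite rv_fm; exact: Uminus_fm. Qed.

Lemma Uminus_tw chi (h : perm_inv chi) x : Um x -> Um (tw h x).
Proof.
by apply: Uminus_linear => w; rewrite tw_fm; apply: UminusZ; exact: Uminus_fm.
Qed.

Lemma rvK x : Um x -> rv (rv x) = x.
Proof.
move: x; apply: Uminus_ind => [w|c x y _ _ ex ey|]; last by rewrite !linear0.
  by rewrite !rv_fm revK.
by rewrite !linearP /= ex ey.
Qed.

Lemma rvM x y : Um x -> Um y -> rv (x * y) = rv y * rv x.
Proof.
move=> + yU; move: x; apply: Uminus_ind => [w|c x x' _ _ ex ex'|].
- move: y yU; apply: Uminus_ind => [u|c y y' _ _ ey ey'|].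
  + by rewrite -fm_cat !rv_fm rev_cat fm_cat.
  + by rewrite mulrDr -scalerAr !linearP /= ey ey' mulrDl -scalerAl.
  + by rewrite mulr0 !linear0 mul0r.
- by rewrite mulrDl -scalerAl !linearP /= ex ex' mulrDr -scalerAr.
- by rewrite mul0r !linear0 mulr0.
Qed.

Lemma counit : exists ep : {linear Uq -> Qq^o},
  ep 1 = 1 /\ forall i x, ep (F i * x) = 0.
Proof.
have [ep [_ epf _] _] := Uq_lift (uq_counit_relations D).
exists ep; split=> [|i x]; first exact: rmorph1.
by rewrite rmorphM /= epf mul0r.
Qed.
End Derivations.

(** * Weight components *)

Lemma perm_rem (T : eqType) (i : T) u w : perm_eq u w -> perm_eq (rem i u) (rem i w).
Proof.
move=> uw; have [iu|iu] := boolP (i \in u); last first.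
  by rewrite !rem_id // -(perm_mem uw).
rewrite -(perm_cons i) -(permPl (perm_to_rem iu)) (permPl uw).
by apply: perm_to_rem; rewrite -(perm_mem uw).
Qed.

Section Homogeneous.
Context {I : countType} {P : zmodType} (D : bc_datum I P).
Notation Uq := (Uq D).
Notation F := (gen_f D).
Notation fm := (fmonomial D).
Notation Um := (@Uminus I P D).
Notation ed := (ed D).
Notation rv := (rv D).

(** A weight is encoded as a word up to permutation, so that the letters remain available for
    induction; [wtw_perm] relates this to weights in P. *)
Definition homog (w : seq I) (x : Uq) : Prop :=
  exists2 l : seq (Qq * seq I), {in l, forall p, perm_eq p.2 w} & x = fsum D l.

Lemma homog_lin w c x y : homog w x -> homog w y -> homog w (c *: x + y).
Proof.
move=> [l hl ->] [l' hl' ->]; exists ([seq (c * p.1, p.2) | p <- l] ++ l').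
  by move=> p; rewrite mem_cat => /orP[/mapP[p' /hl ? ->]|/hl'].
rewrite fsum_cat /fsum big_map scaler_sumr; congr (_ + _).
by apply: eq_bigr => p _; rewrite scalerA.
Qed.

Lemma homog0 w : homog w 0.
Proof. by exists [::] => //; rewrite /fsum big_nil. Qed.

Lemma homogZ w c x : homog w x -> homog w (c *: x).
Proof. by move=> hx; rewrite -[_ *: _]addr0; apply: homog_lin => //; exact: homog0. Qed.

Lemma homogD w x y : homog w x -> homog w y -> homog w (x + y).
Proof. by rewrite -{2}[x]scale1r; exact: homog_lin. Qed.

Lemma homog_fm u w : perm_eq u w -> homog w (fm u).
Proof.
move=> uw; exists [:: (1, u)]; first by move=> p; rewrite inE => /eqP ->.
by rewrite /fsum big_seq1 scale1r.
Qed.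

Lemma fsum_ind (Pr : Uq -> Prop) l : {in l, forall p, Pr (fm p.2)} ->
  (forall c x y, Pr x -> Pr y -> Pr (c *: x + y)) -> Pr 0 -> Pr (fsum D l).
Proof.
move=> + PL P0; elim: l => [|p l IH] hl; first by rewrite /fsum big_nil.
rewrite /fsum big_cons; apply: PL; first by apply: hl; rewrite mem_head.
by apply: IH => p' lp'; apply: hl; rewrite in_cons lp' orbT.
Qed.

Lemma homog_ind w (Pr : Uq -> Prop) : (forall u, perm_eq u w -> Pr (fm u)) ->
  (forall c x y, Pr x -> Pr y -> Pr (c *: x + y)) -> Pr 0 ->
  forall x, homog w x -> Pr x.
Proof. by move=> Pu PL P0 _ [l hl ->]; apply: fsum_ind => // p /hl; exact: Pu. Qed.

Lemma homog_Um w x : homog w x -> Um x.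
Proof.
move: x; apply: homog_ind => [u _|c x y|]; [exact: Uminus_fm|exact: Uminus_lin|].
exact: Uminus0.
Qed.

Lemma homog_perm w w' x : perm_eq w w' -> homog w x -> homog w' x.
Proof.
move=> ww'; move: x; apply: homog_ind => [u uw|c x y|]; last exact: homog0.
  by apply: homog_fm; exact: perm_trans uw ww'.
exact: homog_lin.
Qed.

Lemma homogM u v x y : homog u x -> homog v y -> homog (u ++ v) (x * y).
Proof.
move=> + hy; move: x; apply: homog_ind => [u' uu'|c x x' hx hx'|].
- move: y hy; apply: homog_ind => [v' vv'|c y y' hy hy'|].
  + by rewrite -fm_cat; apply: homog_fm; exact: perm_cat.
  + by rewrite mulrDr -scalerAr; exact: homog_lin.
  + by rewrite mulr0; exact: homog0.
- by rewrite mulrDl -scalerAl; exact: homog_lin.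
- by rewrite mul0r; exact: homog0.
Qed.

Lemma homog_F i : homog [:: i] (F i).
Proof. by rewrite -fm1; exact: homog_fm. Qed.

Lemma homog_nil x : homog [::] x -> exists c, x = c *: 1.
Proof.
move: x; apply: homog_ind => [u /perm_nilP ->|c x y [c1 ->] [c2 ->]|].
- by exists 1; rewrite fm_nil scale1r.
- by exists (c * c1 + c2); rewrite scalerDl scalerA.
- by exists 0; rewrite scale0r.
Qed.

Lemma ed_fm_notin i u : i \notin u -> ed i (fm u) = 0.
Proof.
elim: u => [|j u IH]; first by rewrite fm_nil ed1.
rewrite in_cons negb_or => /andP[ij iu].
rewrite fm_cons ed_F; last exact: Uminus_fm.
by rewrite (negbTE ij) scale0r add0r IH // mulr0 scaler0.
Qed.

Lemma homog_ed_fm i u : homog (rem i u) (ed i (fm u)).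
Proof.
elim: u => [|j u IH]; first by rewrite fm_nil ed1; exact: homog0.
rewrite fm_cons ed_F /=; last exact: Uminus_fm.
rewrite eq_sym; case: eqP => [ij|_]; first subst j.
    rewrite scale1r; apply: homogD; first exact: homog_fm.
    apply: homogZ; have [iu|iu] := boolP (i \in u); last first.
      by rewrite ed_fm_notin // mulr0; exact: homog0.
    apply: (homog_perm _ (homogM (homog_F i) IH)).
    by rewrite perm_sym; exact: perm_to_rem.
by rewrite scale0r add0r; apply: homogZ; exact: (homogM (homog_F j) IH).
Qed.

Lemma homog_ed i w x : homog w x -> homog (rem i w) (ed i x).
Proof.
move: x; apply: homog_ind => [u uw|c x y hx hy|].
- by apply: (homog_perm _ (homog_ed_fm i u)); exact: perm_rem.
- by rewrite linearP; exact: homog_lin.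
- by rewrite linear0; exact: homog0.
Qed.

Lemma homog_ed_notin i w x : homog w x -> i \notin w -> ed i x = 0.
Proof.
move=> + iw; move: x; apply: homog_ind => [u uw|c x y hx hy|].
- by apply: ed_fm_notin; rewrite (perm_mem uw).
- by rewrite linearP /= hx hy scaler0 addr0.
- exact: linear0.
Qed.

Lemma homog_rv w x : homog w x -> homog w (rv x).
Proof.
move: x; apply: homog_ind => [u uw|c x y hx hy|].
- by rewrite rv_fm; apply: homog_fm; rewrite perm_rev.
- by rewrite linearP; exact: homog_lin.
- by rewrite linear0; exact: homog0.
Qed.

Lemma homog_tw chi (h : perm_inv chi) w x : homog w x -> tw D h x = chi w *: x.
Proof.
move: x; apply: homog_ind => [u uw|c x y hx hy|].
- by rewrite tw_fm (h _ _ uw).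
- by rewrite linearP /= hx hy scalerDr !scalerA mulrC.
- by rewrite linear0 scaler0.
Qed.

Fact perm_eq_inv (v : seq I) : perm_inv (fun u => (perm_eq u v)%:R : Qq).
Proof. by move=> u u' /permPl uu'; rewrite uu'. Qed.
Definition pj v : {linear Uq -> Uq} := tw D (perm_eq_inv v).

Lemma pj_fm v u : pj v (fm u) = (perm_eq u v)%:R *: fm u.
Proof. exact: tw_fm. Qed.

Lemma pj_id v x : homog v x -> pj v x = x.
Proof. by move=> /homog_tw ->; rewrite perm_refl scale1r. Qed.

Lemma pj_out u v x : homog u x -> ~~ perm_eq u v -> pj v x = 0.
Proof. by move=> /homog_tw -> /negbTE ->; rewrite scale0r. Qed.

Lemma homog_pj v x : Um x -> homog v (pj v x).
Proof.
move: x; apply: Uminus_ind => [u|c x y _ _ hx hy|].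
- rewrite pj_fm; case: (boolP (perm_eq u v)) => uv; last first.
    by rewrite scale0r; exact: homog0.
  by rewrite scale1r; exact: homog_fm.
- by rewrite linearP; exact: homog_lin.
- by rewrite linear0; exact: homog0.
Qed.

(** The terms with the letters of the first word add up to a projection of x, which is 0; dropping
    them shortens the list. *)
Lemma pj_eq0 x : Um x -> (forall v, pj v x = 0) -> x = 0.
Proof.
case/UminusP=> l ->; have [n] := ubnP (size l).
elim: n l => // n IH [|p l] //= ln x0; first by rewrite /fsum big_nil.
pose l1 := [seq p' <- l | ~~ perm_eq p'.2 p.2].
suff e : fsum D (p :: l) = fsum D l1.
  rewrite e; apply: IH => [|v]; last by rewrite -e.
  by rewrite size_filter (leq_ltn_trans (count_size _ _)).
have pjE L : pj p.2 (fsum D L) =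
    \sum_(p' <- L | perm_eq p'.2 p.2) p'.1 *: fm p'.2.
  rewrite /fsum linear_sum [RHS]big_mkcond; apply: eq_bigr => p' _.
  by rewrite linearZZ pj_fm; case: perm_eq; rewrite ?scale1r // scale0r scaler0.
have e0 := x0 p.2; rewrite pjE in e0.
rewrite {1}/fsum (bigID (fun p' : Qq * seq I => perm_eq p'.2 p.2)) /= e0.
by rewrite add0r big_cons perm_refl /= /fsum big_filter.
Qed.

Lemma homog_disjoint u v x : homog u x -> homog v x -> ~~ perm_eq u v -> x = 0.
Proof. by move=> hu hv uv; rewrite -(pj_id hv) (pj_out hu). Qed.
End Homogeneous.

(** * The twisted coproduct and the antipode *)

(* The kernel of x (x) y |-> S x * y is detected by the functionals phi t (x) 1:
   eliminate the first tensor whose left factor some phi t does not kill. *)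
Lemma tensor_elimination (K : fieldType) (A : algType K) (S : {linear A -> A})
    (T : Type) (phi : T -> {linear A -> K^o}) (W : A -> Prop) :
  (forall c x y, W x -> W y -> W (c *: x + y)) ->
  (forall x, W x -> (forall t, phi t x = 0) -> x = 0) ->
  forall L : seq (A * A), {in L, forall p, W p.1} ->
  (forall t, \sum_(p <- L) phi t p.1 *: p.2 = 0) -> \sum_(p <- L) S p.1 * p.2 = 0.
Proof.
move=> Wlin Wsep L; have [n] := ubnP (size L).
elim: n L => // n IH [|[x y] L] /= Ln WL phiL; first by rewrite big_nil.
have Wx : W x by apply: (WL (x, y)); rewrite mem_head.
have WL' : {in L, forall p, W p.1} by move=> p pL; apply: WL; rewrite in_cons pL orbT.
have [x0|/existsNP[t /eqP xt]] := pselect (forall t, phi t x = 0).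
  have {}x0 := Wsep x Wx x0; rewrite big_cons /= x0 linear0 mul0r add0r.
  by apply: IH => // t; rewrite -[RHS](phiL t) big_cons /= x0 linear0 scale0r add0r.
pose c (p : A * A) := phi t p.1 / phi t x.
have yE : y = - \sum_(p <- L) c p *: p.2.
  have := phiL t; rewrite big_cons /= => /eqP; rewrite addr_eq0 => /eqP e.
  rewrite -[y](scalerK xt) // e scalerN scaler_sumr; congr (- _).
  by apply: eq_bigr => p _; rewrite scalerA mulrC.
pose L' := [seq (p.1 - c p *: x, p.2) | p <- L].
have := IH L'; rewrite size_map => /(_ Ln); rewrite !big_map /=.
have WL2 : {in L', forall p, W p.1}.
  move=> _ /mapP[p pL ->] /=; rewrite addrC -scaleNr; apply: Wlin => //; exact: WL'.
move=> /(_ WL2) IHL; rewrite big_cons /= yE mulrN mulr_sumr addrC -sumrB.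
rewrite -[RHS]IHL.
  apply: eq_bigr => p _; rewrite linearB linearZZ mulrBl -scalerAr.
  by rewrite -scalerAl.
move=> t'; rewrite big_map /= -[RHS](phiL t') big_cons /= yE.
rewrite scalerN scaler_sumr addrC -sumrB; apply: eq_bigr => p _.
by rewrite linearB linearZZ scalerBl scalerA mulrC.
Qed.

Section Coproduct.
Context {I : countType} {P : zmodType} (D : bc_datum I P).
Notation Uq := (Uq D).
Notation F := (gen_f D).
Notation fm := (fmonomial D).
Notation Um := (@Uminus I P D).
Notation ed := (ed D).
Notation pr := (pr D).
Notation wpr := (wpr D).
Notation rv := (rv D).
Notation homog := (@homog I P D).

Definition ep : {linear Uq -> Qq^o} := sval (cid (counit D)).
Lemma ep1 : ep 1 = 1. Proof. by rewrite /ep; case: cid => e []. Qed.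
Lemma epF i x : ep (F i * x) = 0. Proof. by rewrite /ep; case: cid => e []. Qed.

Definition edt (t : seq I) (x : Uq) : Uq := foldl (fun y i => ed i y) x t.

Fact edt_linear t : linear (edt t).
Proof.
elim: t => [|i t IH] c x y //.
by rewrite -[LHS]/(edt t (ed i (c *: x + y))) linearP IH.
Qed.
HB.instance Definition _ t := GRing.isLinear.Build Qq Uq Uq *:%R (edt t) (edt_linear t).

(** The ways in which one derivation of t removes a factor f_j in front: those applied before it
    each contribute a power of q. *)
Fixpoint del (j : I) (t : seq I) : seq (Qq * seq I) :=
  if t is i :: t' then
    (if i == j then [:: (1, t')] else [::]) ++
    [seq (q ^ (- pr i j) * p.1, i :: p.2) | p <- del j t']
  else [::].

Lemma edt_F j t x : Um x -> edt t (F j * x) =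
  \sum_(p <- del j t) p.1 *: edt p.2 x + q ^ (- wpr j t) *: (F j * edt t x).
Proof.
elim: t x => [|i t IH] x xU.
  by rewrite big_nil add0r wpr_nil oppr0 expr0z scale1r.
rewrite -[LHS]/(edt t (ed i (F j * x))) ed_F // edt_linear.
rewrite linearZZ /= IH; last exact: Uminus_ed.
rewrite scalerDr addrA big_cat big_map /= wpr_cons opprD q_expzD (prC D j i).
congr (_ + _); last by rewrite scalerA.
congr (_ + _); first by case: eqP => _; rewrite ?big_seq1 ?big_nil // scale0r.
by rewrite scaler_sumr; apply: eq_bigr => p _; rewrite scalerA.
Qed.

(* The terms c u (x) v of the twisted coproduct of the monomial of w. *)
Fixpoint cop (w : seq I) : seq (Qq * (seq I * seq I)) :=
  if w is j :: w' then
    [seq (p.1, (j :: p.2.1, p.2.2)) | p <- cop w'] ++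
    [seq (p.1 * q ^ (- wpr j p.2.1), (p.2.1, j :: p.2.2)) | p <- cop w']
  else [:: (1, ([::], [::]))].

Lemma cop_size w p : p \in cop w -> (size p.2.1 <= size w)%N.
Proof.
elim: w p => [|j w IH] p /=; first by rewrite inE => /eqP ->.
rewrite mem_cat => /orP[] /mapP[p' /IH pw ->] //=.
exact: leqW.
Qed.

Lemma cop_sum_cons (B : seq I -> seq I -> Uq) j w :
  \sum_(p <- cop (j :: w)) p.1 *: B p.2.1 p.2.2 =
  \sum_(p <- cop w) p.1 *: (B (j :: p.2.1) p.2.2 +
                            q ^ (- wpr j p.2.1) *: B p.2.1 (j :: p.2.2)).
Proof.
rewrite /= big_cat !big_map; under [RHS]eq_bigr => p _ do rewrite scalerDr scalerA.
by rewrite big_split.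
Qed.

(** Each derivation removes one letter, so a constant can remain only if t exhausts u, and [ep]
    kills every nonempty monomial. *)
Lemma ep_edt_fm t u : ~~ perm_eq t u -> ep (edt t (fm u)) = 0.
Proof.
have gen x : homog u x -> ~~ perm_eq t u -> ep (edt t x) = 0; last first.
  by apply: gen; exact: homog_fm.
elim: t u x => [|i t IH] u x hx tu.
  case: u hx tu => [|j u] hx // _.
  move: x hx; apply: homog_ind => [v vu|c x y ex ey|]; last by rewrite /= linear0.
  - by case: v vu => [/perm_size|k v _] //; rewrite /= fm_cons epF.
  - by rewrite /= linearP /= ex ey scaler0 addr0.
have [iu|iu] := boolP (i \in u); last first.
  by rewrite /= (homog_ed_notin hx iu) linear0 linear0.
apply: IH (homog_ed i hx) _; apply: contra tu => tu.
by rewrite (permPr (perm_to_rem iu)) perm_cons.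
Qed.

Lemma ep_edt_cons t j u :
  ep (edt t (fm (j :: u))) = \sum_(p <- del j t) p.1 * ep (edt p.2 (fm u)).
Proof.
rewrite fm_cons edt_F; last exact: Uminus_fm.
rewrite (linearD ep) (linearZZ ep) epF scaler0 addr0 (linear_sum ep).
by apply: eq_bigr => p _; rewrite (linearZZ ep).
Qed.

(** Iterated derivations act through the left tensor factor alone. Only terms whose left word is a
    permutation of t survive, which reconciles the q-exponents [wpr j t] and [wpr j p.2.1]. *)
Lemma edt_cop t w : edt t (fm w) =
  \sum_(p <- cop w) p.1 *: (ep (edt t (fm p.2.1)) *: fm p.2.2).
Proof.
elim: w t => [|j w IH] t.
  rewrite /= big_seq1 /= scale1r fm_nil; case: t => [|i t].
    by rewrite /= ep1 scale1r.
  by rewrite /= ed1 linear0 linear0 scale0r.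
rewrite (cop_sum_cons (fun u v => ep (edt t (fm u)) *: fm v)).
rewrite fm_cons edt_F; last exact: Uminus_fm.
under [RHS]eq_bigr => p _ do rewrite scalerDr.
rewrite big_split /=; congr (_ + _).
  rewrite (eq_bigr _ (fun p' _ => congr1 (fun y => p'.1 *: y) (IH p'.2))).
  under eq_bigr => p' _ do rewrite scaler_sumr.
  rewrite exchange_big /=; apply: eq_bigr => p _.
  rewrite ep_edt_cons scaler_suml scaler_sumr; apply: eq_bigr => p' _.
  by rewrite !scalerA mulrCA mulrA.
rewrite IH mulr_sumr scaler_sumr; apply: eq_bigr => p _.
have [tp|tp] := boolP (perm_eq t p.2.1); last first.
  by rewrite ep_edt_fm // !scale0r !scaler0 mulr0 scaler0.
rewrite (wpr_perm D j tp) fm_cons -!scalerAr !scalerA.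
by congr (_ *: _); ring.
Qed.

(** The sum of the form over all pairs of positions of w; [winv2] shows that it depends only on the
    letters. *)
Fixpoint winv (w : seq I) : int :=
  if w is j :: w' then wpr j w' + winv w' else 0.

Lemma winv2 w : winv w + winv w = \sum_(i <- w) (wpr i w - pr i i).
Proof.
elim: w => [|j w IH]; first by rewrite big_nil.
rewrite big_cons /= addrACA IH wpr_cons.
rewrite [in RHS](eq_bigr (fun i => pr i j + (wpr i w - pr i i))) => [|i _]; last first.
  by rewrite wpr_cons addrA.
have e : \sum_(i <- w) pr i j = wpr j w.
  by rewrite /wpr; apply: eq_bigr => i _; rewrite prC.
rewrite [X in _ = _ + X]big_split /= e; move: (wpr j w) (\sum_(_ <- _) _) (pr j j) => x y z.
by ring.
Qed.

Definition antipode_coef (w : seq I) : Qq := (-1) ^+ size w * q ^ (- winv w).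

Fact antipode_coef_inv : perm_inv antipode_coef.
Proof.
move=> u v uv; rewrite /antipode_coef (perm_size uv); congr (_ * q ^ _).
have : winv u + winv u = winv v + winv v.
  rewrite !winv2 (perm_big _ uv) /=; apply: eq_bigr => i _.
  by rewrite (wpr_perm D i uv).
lia.
Qed.

Definition antipode : {linear Uq -> Uq} := rv \o tw D antipode_coef_inv.

Lemma antipode_fm w : antipode (fm w) = antipode_coef w *: fm (rev w).
Proof. by rewrite /= tw_fm linearZZ rv_fm. Qed.

Lemma antipode_cons j w :
  antipode (fm (j :: w)) = - q ^ (- wpr j w) *: (antipode (fm w) * F j).
Proof.
rewrite !antipode_fm rev_cons -cats1 fm_cat fm1 -scalerAl scalerA.
by congr (_ *: _); rewrite /antipode_coef /= opprD q_expzD exprS; ring.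
Qed.

(** The antipode axiom in nonzero weight. Each term of [cop w] produces two terms of [cop (j :: w)],
    and [antipode_cons] is the rule that makes these cancel. *)
Lemma antipode_cop j w :
  \sum_(p <- cop (j :: w)) p.1 *: (antipode (fm p.2.1) * fm p.2.2) = 0.
Proof.
rewrite (cop_sum_cons (fun u v => antipode (fm u) * fm v)).
apply: big1 => p _; rewrite antipode_cons fm_cons mulrA.
by rewrite -scalerAl scaleNr addNr scaler0.
Qed.

(** With [cop_right], this isolates the extreme terms 1 (x) w and w (x) 1 of the coproduct. *)
Lemma cop_left (B : seq I -> seq I -> Uq) w :
  \sum_(p <- cop w | size p.2.1 == 0%N) p.1 *: B p.2.1 p.2.2 = B [::] w.
Proof.
elim: w B => [|j w IH] B; first by rewrite /= big_cons big_nil /= addr0 scale1r.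
rewrite /= big_cat !big_map /= big_pred0 // add0r.
rewrite -(IH (fun u v => B u (j :: v))); apply: eq_bigr => p /nilP ->.
by rewrite wpr_nil oppr0 expr0z mulr1.
Qed.

Lemma cop_right (B : seq I -> seq I -> Uq) w :
  \sum_(p <- cop w | size p.2.1 == size w) p.1 *: B p.2.1 p.2.2 = B w [::].
Proof.
elim: w B => [|j w IH] B; first by rewrite /= big_cons big_nil /= addr0 scale1r.
rewrite /= big_cat !big_map /= [X in _ + X]big_seq_cond [X in _ + X]big_pred0.
  by rewrite addr0 -(IH (fun u v => B (j :: u) v)); apply: eq_bigl => p; rewrite eqSS.
by move=> p; apply/negbTE/andP => -[/cop_size + /eqP e]; rewrite e ltnn.
Qed.
End Coproduct.

(** * Singular vectors are scalars *)

Lemma scale_regular (R : pzRingType) (c : R) (d : R^o) : c *: d = c * d.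
Proof. by []. Qed.

Section Singular.
Context {I : countType} {P : zmodType} (D : bc_datum I P).
Notation Uq := (Uq D).
Notation fm := (fmonomial D).
Notation Um := (@Uminus I P D).
Notation ed := (ed D).
Notation rv := (rv D).
Notation homog := (@homog I P D).
Notation ep := (ep D).
Notation antipode := (antipode D).

Definition singular (x : Uq) : Prop := forall i, ed i x = 0.

Section Antipode.
Variable n : nat.
(** The induction hypothesis of [singular_eq0]. *)
Hypothesis nondeg : forall v x, (size v < n)%N -> v != [::] -> homog v x ->
  singular x -> x = 0.

(** The functionals of each derivative of x are among those of x, so by induction all derivatives
    vanish and [nondeg] applies. *)
Lemma functionals_separate v x : (size v < n)%N -> homog v x ->
  (forall t, ep (edt t x) = 0) -> x = 0.
Proof.
have [k] := ubnP (size v); elim: k v x => // k IH v x vk vn hx phix.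
have [v0|v0] := eqVneq v [::].
  move: hx; rewrite v0 => /homog_nil[c xc].
  by have := phix [::]; rewrite xc /= linearZZ ep1 /= scale_regular mulr1 => ->; rewrite scale0r.
apply: (nondeg vn v0 hx) => i; have [iv|iv] := boolP (i \in v); last first.
  exact: homog_ed_notin hx iv.
have vpos : (0 < size v)%N by case: (v) v0.
have sz : (size (rem i v) < size v)%N by rewrite size_rem // prednK.
apply: (IH (rem i v)); [exact: leq_trans sz _|exact: ltn_trans sz _|exact: homog_ed|].
by move=> t; exact: (phix (i :: t)).
Qed.

Lemma ep_edt_pj t v x : Um x ->
  ep (edt t (pj D v x)) = (perm_eq t v)%:R * ep (edt t x).
Proof.
move: x; apply: Uminus_ind => [u|c x y _ _ ex ey|]; last by rewrite !linear0 mulr0.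
- rewrite pj_fm linearZZ (linearZZ ep) scale_regular.
  have [tu|tu] := boolP (perm_eq t u); last by rewrite ep_edt_fm // !mulr0.
  by rewrite (permPl tu).
- rewrite linearP (linearP (edt t)) (linearP ep) (linearP (edt t)) (linearP ep) /=.
  by rewrite ex ey mulrDr; congr (_ + _); rewrite !scale_regular mulrCA.
Qed.

(** The span of the weights that occur on the left in the non-extreme coproduct terms of an element
    of length n; there the functionals separate. *)
Definition middle (x : Uq) : Prop :=
  Um x /\ forall v, (size v == 0)%N || (n <= size v)%N -> pj D v x = 0.

Lemma middle_lin c x y : middle x -> middle y -> middle (c *: x + y).
Proof.
move=> [xU mx] [yU my]; split=> [|v nv]; first exact: Uminus_lin.
by rewrite linearP /= mx // my // scaler0 addr0.
Qed.

Lemma middle_fm c u : (0 < size u < n)%N -> middle (c *: fm u).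
Proof.
move=> un; split=> [|v nv]; first by apply: UminusZ; exact: Uminus_fm.
rewrite linearZZ pj_fm; case: (boolP (perm_eq u v)) => [/perm_size uv|_].
  by move: un nv; rewrite uv; move: (size v) => m /andP[m0 mn] /orP[/eqP|]; lia.
by rewrite scale0r scaler0.
Qed.

Lemma functionals_separate_middle x : middle x ->
  (forall t, ep (edt t x) = 0) -> x = 0.
Proof.
move=> [xU mx] phix; apply: pj_eq0 => // v.
case: (boolP ((size v == 0)%N || (n <= size v)%N)) => [|nv]; first exact: mx.
apply: (functionals_separate (v := v)); first by lia.
  exact: homog_pj.
by move=> t; rewrite ep_edt_pj // phix mulr0.
Qed.

Definition matcoef (t : seq I) : {linear Uq -> Qq^o} := ep \o edt t.

(** For t of length strictly between 0 and n only middle terms of the coproduct contribute to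
    [edt t x], which is 0. [tensor_elimination] then removes these terms from the antipode axiom,
    leaving x + S x = 0. *)
Lemma antipode_singular w x : size w = n -> w != [::] -> homog w x -> singular x ->
  antipode x = - x.
Proof.
move=> wn w0 [l lw xE] sx.
have lwn : {in l, forall p, size p.2 = n}.
  by move=> p /lw /perm_size ->.
pose mid (r : Qq * (seq I * seq I)) := (0 < size r.2.1 < n)%N.
pose L := [seq ((p.1 * r.1) *: fm r.2.1, fm r.2.2) |
             p <- l, r <- [seq r <- cop D p.2 | mid r]].
have bigL (G : Uq * Uq -> Uq) : \sum_(p <- L) G p =
    \sum_(p <- l) \sum_(r <- cop D p.2 | mid r)
       G ((p.1 * r.1) *: fm r.2.1, fm r.2.2).
  by rewrite big_allpairs_dep; apply: eq_bigr => p _; rewrite big_filter.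
have Lmid : {in L, forall p, middle p.1}.
  move=> _ /allpairsPdep[p [r [_ + ->]]]; rewrite mem_filter => /andP[rm _].
  exact: middle_fm.
have phiL t : \sum_(p <- L) ep (edt t p.1) *: p.2 = 0.
  rewrite (bigL (fun p => ep (edt t p.1) *: p.2)) /=.
  have [tn|tn] := boolP (0 < size t < n)%N; last first.
    apply: big1 => p _; apply: big1 => r rm.
    rewrite linearZZ (linearZZ ep) ep_edt_fm ?scaler0 ?scale0r //.
    by apply: contra tn => /perm_size ->.
  have tx : edt t x = 0.
    case: t tn => // i t _; rewrite -[LHS]/(edt t (ed i x)) sx.
    exact: linear0.
  rewrite -[RHS]tx xE /fsum linear_sum; apply: eq_bigr => p _.
  rewrite linearZZ /= edt_cop scaler_sumr big_mkcond; apply: eq_bigr => r _.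
  rewrite linearZZ (linearZZ ep) /=; case: ifP => rm; first by rewrite scale_regular !scalerA.
  rewrite ep_edt_fm ?scale0r ?scaler0 //.
  by apply/negP => /perm_size e; move: rm; rewrite /mid -e tn.
have := tensor_elimination (phi := matcoef)
  antipode middle_lin functionals_separate_middle Lmid phiL.
rewrite (bigL (fun p => antipode p.1 * p.2)) /= => e0.
have split0 p : p \in l -> p.1 *: fm p.2 + p.1 *: antipode (fm p.2) =
    - \sum_(r <- cop D p.2 | mid r) antipode ((p.1 * r.1) *: fm r.2.1) * fm r.2.2.
  move=> pl; apply/eqP; rewrite -addr_eq0; apply/eqP.
  have pn := lwn p pl; pose B u v := antipode (fm u) * fm v.
  have {1}-> : fm p.2 = B [::] p.2.
    by rewrite /B antipode_fm /antipode_coef /= fm_nil expr0 oppr0 expr0z mulr1 scale1r mul1r.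
  have {1}-> : antipode (fm p.2) = B p.2 [::] by rewrite /B fm_nil mulr1.
  have -> : \sum_(r <- cop D p.2 | mid r)
        antipode ((p.1 * r.1) *: fm r.2.1) * fm r.2.2 =
      p.1 *: \sum_(r <- cop D p.2 | mid r) r.1 *: B r.2.1 r.2.2.
    rewrite scaler_sumr; apply: eq_bigr => r _.
    by rewrite linearZZ -scalerAl scalerA.
  rewrite -(cop_left B p.2) -(cop_right B p.2) -!scalerDr.
  have pcons : exists j u, p.2 = j :: u.
    by case: (p.2) (lw p pl) => [/perm_size /esym /size0nil w0'|j u _];
      [rewrite w0' in w0|exists j, u].
  have [j [u pE]] := pcons; have := antipode_cop D j u; rewrite -pE => e1.
  rewrite -[RHS](scaler0 _ p.1) -[X in _ = _ *: X]e1; congr (_ *: _).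
  rewrite [RHS](bigID (fun r => size r.2.1 == 0%N)) /= -addrA; congr (_ + _).
  rewrite [RHS](bigID (fun r => size r.2.1 == size p.2)) /=; congr (_ + _).
    apply: eq_bigl => r; rewrite pn; case: eqP => [->|]; rewrite ?andbT ?andbF //.
    by rewrite -wn; case: (w) w0.
  rewrite big_seq_cond [RHS]big_seq_cond; apply: eq_bigl => r.
  have [rc|//] := boolP (r \in cop D p.2); rewrite /= /mid -pn.
  by rewrite lt0n ltn_neqAle (cop_size rc) andbT.
have xSx : x + antipode x =
    \sum_(p <- l) (p.1 *: fm p.2 + p.1 *: antipode (fm p.2)).
  rewrite big_split /= {1 2}xE /fsum; congr (_ + _).
  rewrite !linear_sum; apply: eq_bigr => p _; by rewrite !linearZZ.
apply/eqP; rewrite -addr_eq0 addrC xSx; apply/eqP.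
rewrite -[RHS]oppr0 -[X in _ = - X]e0 -sumrN [LHS]big_seq [RHS]big_seq.
by apply: eq_bigr => p pl; rewrite split0.
Qed.

(** As [rv] is an involution, S x = -x shows that the squared coefficient of S fixes x. Squaring
    removes the sign, and q is not a root of unity. *)
Lemma winv_singular w x : size w = n -> w != [::] -> homog w x -> singular x ->
  x != 0 -> winv D w = 0.
Proof.
move=> wn w0 hx sx x0; have := antipode_singular wn w0 hx sx.
rewrite /= (homog_tw _ hx) linearZZ /= => e.
have : antipode_coef D w ^+ 2 *: x = x.
  have := congr1 rv e; rewrite linearZZ linearN /= rvK; last exact: homog_Um hx.
  move=> /(congr1 (fun y => antipode_coef D w *: y)).
  by rewrite scalerN e opprK scalerA.
move=> /eqP; rewrite -subr_eq0 -{2}[x]scale1r -scalerBl scaler_eq0 (negbTE x0) orbF.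
rewrite subr_eq0 /antipode_coef exprMn sqrr_sign mul1r expr2 -q_expzD q_expz_eq1.
by move=> /eqP; lia.
Qed.
End Antipode.
End Singular.

(** * Mirror derivations and the vanishing of singular vectors *)

Section SingularVectors.
Context {I : countType} {P : zmodType} (D : bc_datum I P).
Notation a := (bcA D).
Notation s := (bcs D).
Notation Uq := (Uq D).
Notation F := (gen_f D).
Notation fm := (fmonomial D).
Notation Um := (@Uminus I P D).
Notation ed := (ed D).
Notation pr := (pr D).
Notation wpr := (wpr D).
Notation rv := (rv D).
Notation homog := (@homog I P D).
Notation singular := (@singular I P D).

Definition rd (i : I) : {linear Uq -> Uq} := rv \o ed i \o rv.

Lemma rdE i x : rd i x = rv (ed i (rv x)). Proof. by []. Qed.

Lemma rd_lin i c x y : rd i (c *: x + y) = c *: rd i x + rd i y.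
Proof. exact: linearP. Qed.
Lemma rdD i x y : rd i (x + y) = rd i x + rd i y. Proof. exact: linearD. Qed.
Lemma rdZ i c x : rd i (c *: x) = c *: rd i x. Proof. exact: linearZZ. Qed.
Lemma rd0 i : rd i 0 = 0. Proof. exact: linear0. Qed.

Lemma homog_rd i w x : homog w x -> homog (rem i w) (rd i x).
Proof. by move=> hx; exact: (homog_rv (homog_ed i (homog_rv hx))). Qed.

Lemma Uminus_rd i x : Um x -> Um (rd i x).
Proof. by move=> xU; exact: (Uminus_rv (Uminus_ed i (Uminus_rv xU))). Qed.

Lemma homog_rd_notin i w x : homog w x -> i \notin w -> rd i x = 0.
Proof. by move=> hx iw; rewrite rdE (homog_ed_notin (homog_rv hx)) ?linear0. Qed.

Lemma rv_F i : rv (F i) = F i.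
Proof. by rewrite -fm1 rv_fm. Qed.

Lemma rd_mulF i j x : Um x ->
  rd i (x * F j) = (i == j)%:R *: x + q ^ (- pr i j) *: (rd i x * F j).
Proof.
move=> xU; have FU : Um (F j) := Uminus_gen j; have rU := Uminus_rv xU.
rewrite !rdE rvM // rv_F ed_F // linearP linearZZ /= rvK // rvM ?rv_F //.
exact: Uminus_ed.
Qed.

Lemma edF i j : ed i (F j) = (i == j)%:R *: 1.
Proof. by rewrite -[F j]mulr1 ed_F ?ed1 ?mulr0 ?scaler0 ?addr0 //; exact: Uminus1. Qed.

Lemma rd_F i j v x : homog v x ->
  rd i (F j * x) = F j * rd i x + ((i == j)%:R * q ^ (- wpr i v)) *: x.
Proof.
move: x; apply: homog_ind => [u uv|c x y ex ey|].
- rewrite !rdE rv_fm -fm_cons rv_fm rev_cons -cats1 fm_cat fm1.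
  rewrite ed_fm_cat; last exact: Uminus_gen.
  rewrite linearD linearZZ /= rvM ?rv_F; last exact: Uminus_gen.
    rewrite edF -scalerAr mulr1 linearZZ rv_fm revK scalerA mulrC.
    by rewrite (@wpr_perm _ _ D i (rev u) v) // perm_rev.
  by apply: Uminus_ed; exact: Uminus_fm.
- rewrite mulrDr -scalerAr !rd_lin ex ey !scalerDr mulrDr -scalerAr addrACA.
  by congr (_ + _ + _); rewrite !scalerA mulrC.
- by rewrite mulr0 rd0 mulr0 scaler0 addr0.
Qed.

(** The two derivations strip letters from opposite ends; their powers of q agree by symmetry of the
    form. *)
Let ed_rd_fm i j w : ed i (rd j (fm w)) = rd j (ed i (fm w)).
Proof.
elim: w => [|k w IH]; first by rewrite fm_nil ed1 rd0 rdE rv1 ed1 !linear0.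
have wU : Um (fm w) := Uminus_fm w; rewrite fm_cons.
rewrite (rd_F j k (homog_fm D (perm_refl w))) linearD linearZZ ed_F; last exact: Uminus_rd.
rewrite ed_F // rdD !rdZ (rd_F j k (homog_ed_fm D i w)) IH.
rewrite scalerDr -!addrA; congr (_ + (_ + _)).
have [jk|jk] := eqVneq j k; last by rewrite !mul0r !scale0r scaler0.
subst k; have [iw|iw] := boolP (i \in w); last by rewrite ed_fm_notin // !scaler0.
rewrite !mul1r scalerA -q_expzD.
rewrite (wpr_perm D j (perm_to_rem iw)) wpr_cons.
by rewrite (prC D j i) opprD.
Qed.

Lemma ed_rd i j x : Um x -> ed i (rd j x) = rd j (ed i x).
Proof.
move: x; apply: (@linear_Uminus _ _ _ (ed i \o rd j) (rd j \o ed i)) => w.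
exact: ed_rd_fm.
Qed.

Lemma iter_linear (G : {linear Uq -> Uq}) n c x y :
  iter n G (c *: x + y) = c *: iter n G x + iter n G y.
Proof. by elim: n => //= n ->; rewrite linearP. Qed.

Lemma iter_linear0 (G : {linear Uq -> Uq}) n : iter n G 0 = 0.
Proof. by elim: n => //= n ->; rewrite linear0. Qed.

Lemma iter_eq0_leq (G : {linear Uq -> Uq}) m n x : (m <= n)%N ->
  iter m G x = 0 -> iter n G x = 0.
Proof. by move=> mn e; rewrite -(subnK mn) iterD e iter_linear0. Qed.

Lemma iterZ (G : {linear Uq -> Uq}) n c x : iter n G (c *: x) = c *: iter n G x.
Proof. by rewrite -[c *: x]addr0 iter_linear iter_linear0 addr0. Qed.

Lemma homog_iter_ed i n w x : homog w x -> (size w < n)%N -> iter n (ed i) x = 0.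
Proof.
elim: n w x => // n IH w x hx wn; rewrite iterSr.
have [iw|iw] := boolP (i \in w); last first.
  by rewrite (homog_ed_notin hx iw) iter_linear0.
apply: IH (homog_ed i hx) _; rewrite size_rem //.
by case: (w) iw wn.
Qed.

Lemma ed_nilpotent i x : Um x -> exists n, iter n (ed i) x = 0.
Proof.
move: x; apply: Uminus_ind => [w|c x y _ _ [m xm] [n yn]|]; last by exists 0%N.
- exists (size w).+1; apply: homog_iter_ed (leqnn _).
  exact: homog_fm.
- exists (m + n)%N; rewrite iter_linear.
  rewrite (iter_eq0_leq (leq_addr n m) xm) (iter_eq0_leq (leq_addl m n) yn).
  by rewrite scaler0 addr0.
Qed.

Lemma rd_nilpotent i x : Um x -> exists n, iter n (rd i) x = 0.
Proof.
move=> xU; have [n en] := ed_nilpotent i (Uminus_rv xU).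
exists n; rewrite -(linear0 rv) -en.
elim: n {en} => [|n IH]; first by rewrite rvK.
rewrite iterS IH rdE rvK //; elim: n {IH} => [|n IH]; first exact: Uminus_rv.
by rewrite iterS; exact: Uminus_ed.
Qed.

Section Real.
Variable (i : I).
Hypothesis ri : is_real D i.

Let aii : a i i = 2. Proof. exact/eqP. Qed.
Let prii : pr i i = (s i)%:Z * 2. Proof. by rewrite /pr aii. Qed.
(** This is q_i^(-2), and [geo n] is the q-integer [n]_i up to a power of q_i. *)
Let z : Qq := q ^ (- pr i i).
Let geo n : Qq := \sum_(l < n) z ^+ l.

Let geoS n : geo n.+1 = 1 + z * geo n.
Proof.
rewrite /geo big_ord_recl expr0 mulr_sumr; congr (_ + _).
by apply: eq_bigr => l _; rewrite exprS.
Qed.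

Let geo_neq0 n : geo n.+1 != 0.
Proof.
have: (z - 1) * geo n.+1 != 0.
  rewrite /geo -subrX1 subr_eq0 /z.
  rewrite -[_ ^+ _]/(exprz _ n.+1%:Z) exprz_exp q_expz_eq1 prii.
  by have := bcs_gt0 D i; lia.
by rewrite mulf_eq0 negb_or => /andP[].
Qed.

Definition UF (N : nat) (x : Uq) : Prop := exists2 y, Um y & x = y * F i ^+ N.

Lemma UF_lin N c x y : UF N x -> UF N y -> UF N (c *: x + y).
Proof.
move=> [x' xU ->] [y' yU ->]; exists (c *: x' + y'); first exact: Uminus_lin.
by rewrite mulrDl -scalerAl.
Qed.

Lemma UF0 N : UF N 0.
Proof. by exists 0; [exact: Uminus0|rewrite mul0r]. Qed.

Lemma UF_mul N y x : Um y -> UF N x -> UF N (y * x).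
Proof. by move=> yU [x' xU ->]; exists (y * x'); [exact: UminusM|rewrite mulrA]. Qed.

(** With n = -a_ij, the Serre relation rewrites f_i^(n+1) f_j so that every term has some f_i on the
    right; induction on N handles the terms that still have too few. *)
Lemma UF_serre j N : i != j ->
  UF N (F i ^+ (`|1 - a i j|.-1 + N)%N * F j).
Proof.
move=> ij; have [n [nE aij]] := a_offdiag_nat D ij; rewrite nE /=.
have FXU k : Um (F i ^+ k) by apply: UminusX; exact: Uminus_gen.
have [m] := ubnP N; elim: m N => // m IH [|N] Nm.
  by exists (F i ^+ (n + 0) * F j); [apply: UminusM => //; exact: Uminus_gen|rewrite mulr1].
have := serre_f (Uq_rel D) ri ij; rewrite /= nE big_ord_recl /=.
rewrite subn0 !mulr1 expr0 mul1r => /eqP; rewrite addr_eq0 => /eqP e0.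
have q0 : qbinom D i n.+1 0 = 1.
  have f0 : qfact D i n.+1 != 0.
    by apply/prodf_neq0 => k _; exact: (qint_neq0 D i k).
  by rewrite /qbinom /qfact big_ord0 mul1r subn0 divff.
rewrite q0 scale1r in e0.
rewrite addnS -addSn addnC exprD -mulrA e0 mulrN mulr_sumr.
rewrite -scaleN1r -[_ *: _]addr0; apply: UF_lin; last exact: UF0.
elim/big_ind: _ => [|x y hx hy|r _]; first exact: UF0.
  by rewrite -[x]scale1r; exact: UF_lin.
rewrite -scalerAr -[_ *: _]addr0; apply: UF_lin; last exact: UF0.
rewrite !mulrA -exprD /bump /= add1n subSS.
have rn : (r <= n)%N by rewrite -ltnS.
have [rN|rN] := leqP r N.
  have [y yU yE] := IH (N - r)%N (leq_ltn_trans (leq_subr r N) (Nm : (N < m)%N)).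
  have -> : (N + (n - r) = n + (N - r))%N by lia.
  exists y => //; rewrite yE -mulrA -exprD; congr (_ * _ ^+ _).
  by rewrite addnS subnK.
exists (F i ^+ (N + (n - r)) * F j * F i ^+ (r - N)).
  by apply: UminusM => //; apply: UminusM => //; exact: Uminus_gen.
rewrite -!mulrA -!exprD; congr (_ * (_ * _ ^+ _)); lia.
Qed.

(** Left multiplication by f_i is locally nilpotent modulo U_q^- f_i^N: a power of f_i is pushed
    through w, and each letter must let through as many factors as the rest of the word requires. *)
Lemma UF_fm w N : exists K, UF N (F i ^+ K * fm w).
Proof.
have FXU k : Um (F i ^+ k) by apply: UminusX; exact: Uminus_gen.
elim: w N => [|j w IH] N.
  by exists N, 1; [exact: Uminus1|rewrite mul1r fm_nil mulr1].
have [M MN] := IH N; rewrite fm_cons.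
have [ij|ij] := eqVneq i j.
  by exists M; rewrite -ij mulrA -exprSr exprS -mulrA; apply: UF_mul MN; exact: Uminus_gen.
have [y yU yE] := UF_serre M ij.
exists (`|(1 - a i j)%R|.-1 + M)%N; rewrite mulrA yE -mulrA.
exact: UF_mul.
Qed.

Lemma UF_ex x : Um x -> exists K, UF 1 (F i ^+ K * x).
Proof.
have FXU k : Um (F i ^+ k) by apply: UminusX; exact: Uminus_gen.
move: x; apply: Uminus_ind => [w|c x y xU yU [K hK] [L hL]|]; first exact: UF_fm.
- exists (K + L)%N; rewrite mulrDr -scalerAr; apply: UF_lin.
    by rewrite addnC exprD -mulrA; exact: UF_mul.
  by rewrite exprD -mulrA; exact: UF_mul.
- by exists 0%N; rewrite mulr0; exact: UF0.
Qed.

Fact wpr_inv : perm_inv (fun u => q ^ wpr i u).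
Proof. by move=> u v uv; rewrite (wpr_perm D i uv). Qed.
Fact wprN_inv : perm_inv (fun u => q ^ (- wpr i u)).
Proof. by move=> u v uv; rewrite (wpr_perm D i uv). Qed.
Let tau : {linear Uq -> Uq} := tw D wpr_inv.
Let tauN : {linear Uq -> Uq} := tw D wprN_inv.

Let tauNK x : Um x -> tau (tauN x) = x.
Proof.
move: x; apply: Uminus_ind => [w|c x y _ _ ex ey|]; last by rewrite !linear0.
  by rewrite tw_fm linearZZ /= tw_fm scalerA -q_expzD addNr expr0z scale1r.
by rewrite !linearP /= ex ey.
Qed.

Let tau_mulF x : Um x -> tau (x * F i) = q ^ pr i i *: (tau x * F i).
Proof.
move: x; apply: Uminus_ind => [w|c x y _ _ ex ey|].
- rewrite -fm1 -fm_cat !tw_fm wpr_cat wpr_cons wpr_nil addr0 fm_cat.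
  by rewrite -scalerAl scalerA -q_expzD addrC.
- rewrite mulrDl -scalerAl !linearP /= ex ey mulrDl -scalerAl scalerDr !scalerA.
  by rewrite mulrC.
- by rewrite mul0r linear0 mul0r scaler0.
Qed.

Let ed_mulF x : Um x -> ed i (x * F i) = ed i x * F i + tauN x.
Proof.
move: x; apply: Uminus_ind => [w|c x y _ _ ex ey|].
- rewrite ed_fm_cat; last exact: Uminus_gen.
  by rewrite edF eqxx scale1r mulr1 tw_fm.
- rewrite mulrDl -scalerAl !linearP /= ex ey mulrDl -scalerAl scalerDr.
  by rewrite addrACA.
- by rewrite mul0r !linear0 mul0r addr0.
Qed.

(* the action of e_i on U_q^- / U_q^- f_i, up to scalars *)
Let dd x := rd i x - tau (ed i x).

(** The twist [tau] is inverse to the one in the Leibniz rule for y f_i, so the two derivations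
    produce the same term y and it cancels in [dd]. *)
Let dd_UF x : UF 1 x -> UF 1 (dd x).
Proof.
move=> [y yU ->]; rewrite /dd expr1 rd_mulF // eqxx scale1r ed_mulF // linearD.
rewrite /= tauNK // tau_mulF; last exact: Uminus_ed.
rewrite [y + _]addrC opprD addrACA subrr addr0 addrC -scaleN1r scalerA.
apply: UF_lin.
  exists (tau (ed i y)); last by rewrite expr1.
  by apply: Uminus_tw; exact: Uminus_ed.
rewrite -[_ *: _]addr0; apply: UF_lin; last exact: UF0.
by exists (rd i y); rewrite ?expr1 //; exact: Uminus_rd.
Qed.

Section KilledVector.
Variables (w : seq I) (x : Uq).
Hypotheses (hx : homog w x) (edx : ed i x = 0) (rdx : rd i x = 0).

Let homog_FX k : homog (nseq k i ++ w) (F i ^+ k * x).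
Proof. by apply: homogM hx; rewrite -fm_nseq; exact: homog_fm. Qed.

Let edFX k : ed i (F i ^+ k.+1 * x) = geo k.+1 *: (F i ^+ k * x).
Proof.
elim: k => [|k IH].
  rewrite expr1 ed_F; last exact: homog_Um hx.
  by rewrite edx mulr0 scaler0 addr0 eqxx /geo big_ord1 !expr0 mul1r.
rewrite exprS -mulrA ed_F; last exact: homog_Um (homog_FX _).
rewrite IH eqxx [in RHS]geoS scalerDl scale1r; congr (_ + _).
by rewrite -scalerAr scalerA mulrA -exprS.
Qed.

Let rdFX k : rd i (F i ^+ k.+1 * x) = (q ^ (- wpr i w) * geo k.+1) *: (F i ^+ k * x).
Proof.
have wE k' : q ^ (- wpr i (nseq k' i ++ w)) = q ^ (- wpr i w) * z ^+ k'.
  elim: k' => [|k' IH]; first by rewrite mulr1.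
  rewrite exprS /= wpr_cons opprD q_expzD IH; rewrite /z; ring.
elim: k => [|k IH].
  rewrite expr1 (rd_F _ _ hx) rdx mulr0 add0r eqxx mul1r.
  by rewrite /geo big_ord1 !expr0 mul1r mulr1.
rewrite exprS -mulrA (rd_F _ _ (homog_FX _)) IH eqxx mul1r wE.
rewrite -scalerAr mulrA -exprS -scalerDl -mulrDr.
by rewrite [in RHS]/geo big_ord_recr.
Qed.

(* sl_2-theory: e_i acts on U_q^- / U_q^- f_i through dd and sends f_i^(k+1) x
   to a multiple of f_i^k x, which is nonzero when wpr i w > 0. *)
Lemma UF_killed k : wpr i w > 0 -> UF 1 (F i ^+ k * x) -> UF 1 x.
Proof.
move=> wpos; elim: k => [|k IH]; first by rewrite mul1r.
move=> /dd_UF; rewrite /dd edFX rdFX linearZZ /= (homog_tw _ (homog_FX k)).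
rewrite scalerA -scalerBl; set c := (X in X *: _) => uf; apply: IH.
have c0 : c != 0.
  rewrite /c mulrC -mulrBr; apply: mulf_neq0; first exact: geo_neq0.
  rewrite subr_eq0; apply/eqP => /(congr1 (fun y => y * q ^ wpr i w)).
  rewrite -!q_expzD addNr expr0z => /esym/eqP; rewrite q_expz_eq1 wpr_cat.
  have : 0 <= wpr i (nseq k i).
    elim: (k) => [|k' IHk]; first by rewrite wpr_nil.
    rewrite /= wpr_cons prii; by move: (wpr i _) IHk => x1; lia.
  by move: wpos (wpr i (nseq k i)); move: (wpr i w) => x1 ? y1; lia.
rewrite -[_ * x](scalerK c0) -[_ *: _]addr0.
by apply: UF_lin uf _; exact: UF0.
Qed.
End KilledVector.

(** In the (n+1)-st derivative of y f_i, the n-th derivative of y has the nonzero coefficient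
    [geo n.+1]. Starting from nilpotence, this lowers the order of vanishing of y down to 0. *)
Lemma rd_UF_eq0 y : Um y -> rd i (y * F i) = 0 -> y = 0.
Proof.
move=> yU ry0.
have iterU n : Um (iter n (rd i) y) by elim: n => //= n IH; exact: Uminus_rd.
have rdn n : iter n.+1 (rd i) (y * F i) =
    geo n.+1 *: iter n (rd i) y + z ^+ n.+1 *: (iter n.+1 (rd i) y * F i).
  elim: n => [|n IH].
    change (rd i (y * F i) = geo 1 *: y + z ^+ 1 *: (rd i y * F i)).
    by rewrite rd_mulF // eqxx /geo big_ord1 expr0 expr1.
  rewrite iterS IH rd_lin rdZ rd_mulF // eqxx scale1r scalerDr addrA -scalerDl.
  by rewrite scalerA -exprSr [in RHS]/geo [in RHS]big_ord_recr.
have [n] := rd_nilpotent i yU; elim: n => // n IH yn; apply: IH.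
have := rdn n; rewrite iterSr ry0 iter_linear0 yn mul0r scaler0 addr0 => /esym/eqP.
by rewrite scaler_eq0 (negbTE (geo_neq0 n)) /= => /eqP.
Qed.

Lemma real_killed w x : homog w x -> ed i x = 0 -> rd i x = 0 -> wpr i w > 0 -> x = 0.
Proof.
move=> hx edx rdx wpos; have [k xk] := UF_ex (homog_Um hx).
have [y yU yE] := UF_killed hx edx rdx wpos xk; rewrite expr1 in yE.
by rewrite yE (rd_UF_eq0 yU) ?mul0r // -yE.
Qed.
End Real.

Lemma fm_commuting k w : (forall l, l \in w -> F k * F l = F l * F k) ->
  F k * fm w = fm w * F k.
Proof.
elim: w => [|l w IH] hw; first by rewrite fm_nil mulr1 mul1r.
rewrite fm_cons mulrA hw ?mem_head // -!mulrA IH // => l' lw.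
by apply: hw; rewrite in_cons lw orbT.
Qed.

Lemma fm_perm u w : {in w &, forall k l, F k * F l = F l * F k} ->
  perm_eq u w -> fm u = fm w.
Proof.
elim: w u => [|k w IH] u hw; first by move=> /perm_nilP ->.
move=> uw; have ku : k \in u by rewrite (perm_mem uw) mem_head.
have [u1 [u2 uE]] : exists u1 u2, u = u1 ++ k :: u2.
  by case/splitPr: ku => u1 u2; exists u1, u2.
have u12 : perm_eq (u1 ++ u2) w.
  by rewrite -(perm_cons k) -(permPr uw) uE -cat_rcons perm_sym -cats1 -catA
             -cat1s perm_catCA.
rewrite uE fm_cat fm_cons mulrA -fm_commuting; last first.
  move=> l lu; apply: hw; rewrite ?mem_head // in_cons -(perm_mem u12) mem_cat lu.
  exact: orbT.
rewrite -mulrA -fm_cat (IH _ _ u12) ?fm_cons // => l m lw mw.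
by apply: hw; rewrite in_cons ?lw ?mw orbT.
Qed.

(** When f_k is orthogonal to all letters of w no power of q appears, and f_k e_k' is the Euler
    operator counting the letter k. *)
Lemma ed_isotropic k w : (forall l, l \in w -> a k l = 0) ->
  F k * ed k (fm w) = (count_mem k w)%:R *: fm w.
Proof.
elim: w => [|j w IH] aw; first by rewrite fm_nil ed1 mulr0 scale0r.
have akj : a k j = 0 by apply: aw; rewrite mem_head.
have aw' l : l \in w -> a k l = 0 by move=> lw; apply: aw; rewrite in_cons lw orbT.
rewrite fm_cons ed_F; last exact: Uminus_fm.
rewrite {1}/pr akj mulr0 oppr0 expr0z scale1r mulrDr mulrA.
rewrite (rel_ff (Uq_rel D) akj) -mulrA IH // -!scalerAr /= natrD scalerDl [j == k]eq_sym.
by congr (_ + _); case: eqP => [->|_] //; rewrite !scale0r.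
Qed.

Lemma natrS_neq0 n : n.+1%:R != 0 :> Qq.
Proof.
rewrite -[_%:R](rmorph_nat (@tofrac _)) tofrac_eq0.
by rewrite -polyC_natr polyC_eq0 pnatr_eq0.
Qed.

Lemma singular_eq0 w x : w != [::] -> homog w x -> singular x -> x = 0.
Proof.
have [n] := ubnP (size w); elim: n w x => // n IH w x wn w0 hx sx.
apply/eqP/negP => /negP x0.
have rdx i : rd i x = 0.
  have [iw|iw] := boolP (i \in w); last exact: homog_rd_notin hx iw.
  (* A derivative of weight 0 escapes the induction; then w is the single letter i and x a multiple
     of f_i, which e_i' does not kill unless it is 0. *)
  have [r0|r0] := eqVneq (rem i w) [::].
    have := homog_rd i hx; rewrite r0 => /homog_nil[c rE].
    have wE : perm_eq w [:: i] by rewrite (permPl (perm_to_rem iw)) r0.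
    have [c' xE] : exists c', x = c' *: F i.
      move: {sx x0 rE} x hx; apply: homog_ind => [u uw|d x1 x2 [d1 ->] [d2 ->]|].
      - move: (perm_trans uw wE) => /perm_small_eq -> //.
        by exists 1; rewrite scale1r fm1.
      - by exists (d * d1 + d2); rewrite scalerDl scalerA.
      - by exists 0; rewrite scale0r.
    have := sx i; rewrite xE linearZZ edF eqxx scale1r => /eqP.
    rewrite scaler_eq0 oner_eq0 orbF => /eqP c'0.
    by move: x0; rewrite xE c'0 scale0r eqxx.
  apply: (IH (rem i w)) => //; last first.
  - by move=> j; rewrite ed_rd ?sx ?rd0 //; exact: homog_Um hx.
  - exact: homog_rd.
  - by rewrite size_rem //; case: (w) iw wn.
have wre i : is_real D i -> wpr i w <= 0.
  move=> ri; rewrite leNgt; apply/negP => wpos.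
  by move/eqP: x0; apply; exact: real_killed hx (sx i) (rdx i) wpos.
have nondeg v y : (size v < size w)%N -> v != [::] -> homog v y -> singular y -> y = 0.
  by move=> vw; apply: IH; exact: leq_trans vw wn.
have := winv2 D w; rewrite (winv_singular nondeg erefl w0 hx sx x0) addr0.
move=> /esym sum0.
(* For real i the term is at most -2 s_i < 0, so equality cannot occur. For imaginary i it pairs i
   with the other letters only, and each such pairing is nonpositive. *)
have term_le i : i \in w -> wpr i w - pr i i <= 0 /\
   (wpr i w - pr i i = 0 -> forall l, l \in rem i w -> a i l = 0).
  move=> iw; have [aii|[aii _]] := bcA_diag D i.
    have ri : is_real D i by rewrite /is_real aii.
    have := wre i ri; rewrite /pr aii; have := bcs_gt0 D i.
    by move: (wpr i w) (s i) => x1 y1 ? ?; split; lia.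
  rewrite (wpr_perm D i (perm_to_rem iw)) wpr_cons addrAC subrr add0r.
  have ale l : a i l <= 0.
    by have [<- //|il] := eqVneq i l; exact: bcA_offdiag.
  have prle l : pr i l <= 0.
    by rewrite /pr; have := ale l; nia.
  split; first by rewrite /wpr; apply: sumr_le0 => l _.
  move=> /eqP; rewrite /wpr -oppr_eq0 -sumrN psumr_eq0 => [|l _]; last first.
    by rewrite oppr_ge0.
  move=> /allP h l lw; have /= := h l lw; rewrite oppr_eq0 /pr mulf_eq0.
  by have := bcs_gt0 D i; case: (s i) => // s' _ /= /eqP.
have iso i : i \in w -> forall l, l \in rem i w -> a i l = 0.
  move=> iw; have [_ h] := term_le i iw; apply: h.
  move: sum0 => /eqP; rewrite -oppr_eq0 -sumrN big_seq_cond psumr_eq0 => [|l]; last first.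
    by rewrite andbT oppr_ge0 => lw; case: (term_le l lw).
  by move=> /allP /(_ i iw); rewrite iw /= oppr_eq0 => /eqP.
case: w w0 hx iso {wn wre nondeg sum0 term_le IH} => // k w _ hx iso.
have com : {in k :: w &, forall i j, F i * F j = F j * F i}.
  move=> i j iw jw; have [->|ij] := eqVneq i j; first by [].
  apply: (rel_ff (Uq_rel D)); apply: iso => //.
  by move: jw; rewrite (perm_mem (perm_to_rem iw)) in_cons eq_sym (negbTE ij).
have [c xE] : exists c, x = c *: fm (k :: w).
  move: {sx x0 rdx} x hx; apply: homog_ind => [u uw|d x1 x2 [d1 ->] [d2 ->]|].
  - by exists 1; rewrite scale1r; exact: fm_perm.
  - by exists (d * d1 + d2); rewrite scalerDl scalerA.
  - by exists 0; rewrite scale0r.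
have akw l : l \in w -> a k l = 0.
  by move=> lw; apply: (iso k); rewrite ?mem_head //= eqxx.
have := sx k; rewrite xE linearZZ fm_cons ed_F ?eqxx; last exact: Uminus_fm.
rewrite scale1r ed_isotropic // scalerA.
(* If k occurs again in w it is orthogonal to itself; otherwise the count is 0. *)
have -> : q ^ (- pr k k) * (count_mem k w)%:R = (count_mem k w)%:R.
  have [kw|kw] := boolP (k \in w).
    by rewrite /pr (akw k kw) mulr0 oppr0 expr0z mul1r.
  by rewrite (count_memPn kw) mulr0.
rewrite -{1}[fm w]scale1r -scalerDl -[1 + _]/(1%:R + _) -natrD add1n scalerA.
(* Multiplying by f_k recovers x, with the factor 1 + count, nonzero in characteristic 0. *)
move=> /(congr1 (fun y => F k * y)); rewrite mulr0 -scalerAr -fm_cons.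
rewrite mulrC -scalerA -xE => /eqP.
by rewrite scaler_eq0 (negbTE (natrS_neq0 _)) (negbTE x0).
Qed.
End SingularVectors.

(** * Strings and the lexicographic relation *)

Section Strings.
Context {I : countType} {P : zmodType} (D : bc_datum I P).
Notation Uq := (Uq D).
Notation Um := (@Uminus I P D).
Notation ed := (ed D).
Notation homog := (@homog I P D).
Notation ell := (@ell I P D).

Lemma Uminus_iter i n x : Um x -> Um (iter n (ed i) x).
Proof. by move=> xU; elim: n => //= n IH; exact: Uminus_ed. Qed.

Lemma iter_eprime i n x : Um x -> iter n (eprime i) x = iter n (ed i) x.
Proof.
by move=> xU; elim: n => //= n ->; rewrite eprimeE //; exact: Uminus_iter.
Qed.

(** Local nilpotence of e_i' makes the set defining [ell] nonempty, so the default value of [xget]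
    does not intervene. *)
Lemma ellP i v : Um v -> iter (ell i v).+1 (ed i) v = 0 /\
  forall m, iter m.+1 (ed i) v = 0 -> (ell i v <= m)%N.
Proof.
move=> vU; rewrite -iter_eprime //.
suff [A B] : [set n | iter n.+1 (eprime i) v = 0 /\
                    forall m, iter m.+1 (eprime i) v = 0 -> (n <= m)%N] (ell i v).
  by split=> // m; rewrite -iter_eprime //; exact: B.
rewrite /Defs.ell; apply: xgetPex.
have ex : exists n, `[< iter n.+1 (eprime i) v = 0 >].
  have [n en] := ed_nilpotent i vU; exists n; apply/asboolP.
  by rewrite iter_eprime // (iter_eq0_leq _ en).
exists (ex_minn ex); case: ex_minnP => n /asboolP n0 nmin; split=> // m m0.
by apply: nmin; apply/asboolP.
Qed.

Lemma ell_le i v m : Um v -> (ell i v <= m)%N <-> iter m.+1 (ed i) v = 0.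
Proof.
move=> vU; have [e0 emin] := ellP i vU; split=> [|/emin //].
by move=> em; apply: iter_eq0_leq e0.
Qed.

Lemma ell_neq0 i v : Um v -> v <> 0 -> iter (ell i v) (ed i) v <> 0.
Proof.
move=> vU v0; case e: (ell i v) => [|n] //= en.
by have := proj2 (ell_le i n vU) en; rewrite e ltnn.
Qed.

Lemma ell_eq i v n : Um v -> iter n (ed i) v <> 0 -> iter n.+1 (ed i) v = 0 ->
  ell i v = n.
Proof.
move=> vU n0 n1; apply/eqP; rewrite eqn_leq; apply/andP; split.
  exact/ell_le.
case: n n0 {n1} => // n n0; rewrite ltnNge; apply/negP => /(ell_le _ _ vU).
exact: n0.
Qed.

Lemma ell_lt i v m : Um v -> v <> 0 -> (ell i v < m)%N <-> iter m (ed i) v = 0.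
Proof. by move=> vU v0; case: m => [|m]; [split|rewrite ltnS; exact: ell_le]. Qed.

Lemma ellZ i c v : Um v -> v <> 0 -> c != 0 -> ell i (c *: v) = ell i v.
Proof.
move=> vU v0 c0; apply: ell_eq; rewrite ?iterZ; first exact: UminusZ.
  by move=> /eqP; rewrite scaler_eq0 (negbTE c0) => /eqP; exact: ell_neq0.
by rewrite (proj1 (ellP i vU)) scaler0.
Qed.

Lemma ell1 i : ell i 1 = 0%N.
Proof.
apply: ell_eq; [exact: Uminus1| |exact: ed1].
by apply/eqP; exact: oner_neq0.
Qed.

(* The string of v in direction w is the sequence of the exponents ell met
   along w; opw w v applies the corresponding powers of the e_i', and
   weak w v x says that the string of x is lexicographically at most that of v. *)
Fixpoint opw (w : seq I) (v x : Uq) : Uq :=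
  if w is i :: w' then
    opw w' (iter (ell i v) (ed i) v) (iter (ell i v) (ed i) x)
  else x.

Fixpoint weak (w : seq I) (v x : Uq) : Prop :=
  if w is i :: w' then
    iter (ell i v).+1 (ed i) x = 0 /\
    weak w' (iter (ell i v) (ed i) v) (iter (ell i v) (ed i) x)
  else True.

Definition below w v x := weak w v x /\ opw w v x = 0.

Lemma opw_lin w v c x y : opw w v (c *: x + y) = c *: opw w v x + opw w v y.
Proof. by elim: w v x y => //= i w IH v x y; rewrite iter_linear IH. Qed.

Lemma opw0 w v : opw w v 0 = 0.
Proof. by elim: w v => //= i w IH v; rewrite iter_linear0. Qed.

Lemma opwZ w v c x : opw w v (c *: x) = c *: opw w v x.
Proof. by rewrite -[c *: x]addr0 opw_lin opw0 addr0. Qed.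

Lemma weak_lin w v c x y : weak w v x -> weak w v y -> weak w v (c *: x + y).
Proof.
elim: w v x y => //= i w IH v x y [x0 wx] [y0 wy].
rewrite iter_linear linearP /= x0 y0 scaler0 addr0; split=> //.
exact: IH.
Qed.

Lemma weak0 w v : weak w v 0.
Proof. by elim: w v => //= i w IH v; rewrite !iter_linear0 linear0. Qed.

Lemma weakZ w v c x : weak w v x -> weak w v (c *: x).
Proof. by move=> h; rewrite -[c *: x]addr0; apply: weak_lin => //; exact: weak0. Qed.

Lemma weak_refl w v : Um v -> weak w v v.
Proof.
elim: w v => //= i w IH v vU; split; first exact: (proj1 (ellP i vU)).
by apply: IH; exact: Uminus_iter.
Qed.

(** A nonzero result means that no power overshoots, so x has the exponents of v; [weak] and [opw]
    depend on their reference vector only through its exponents. *)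
Lemma same_string w v x : Um x -> weak w v x -> opw w v x <> 0 ->
  (forall y, weak w x y <-> weak w v y) /\ (forall y, opw w x y = opw w v y).
Proof.
elim: w v x => //= i w IH v x xU [x0 wx] ox.
have -> : ell i x = ell i v.
  by apply: ell_eq => // e; apply: ox; rewrite e opw0.
have [h1 h2] := IH _ _ (Uminus_iter i (ell i v) xU) wx ox.
by split=> y; rewrite ?h2 // h1.
Qed.

Lemma opw_cat u w v x : opw (u ++ w) v x = opw w (opw u v v) (opw u v x).
Proof. by elim: u v x => //= i u IH v x; rewrite IH. Qed.

Lemma weak_cat u w v x :
  weak (u ++ w) v x <-> weak u v x /\ weak w (opw u v v) (opw u v x).
Proof.
elim: u v x => [|i u IH] v x /=; first by split=> [|[]].
by rewrite IH; split=> [[? []]|[[]]].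
Qed.

Lemma scalar_neq0 (c : Qq) : c != 0 -> c *: (1 : Uq) <> 0.
Proof. by move=> c0 /eqP; rewrite scaler_eq0 (negbTE c0) oner_eq0. Qed.

Lemma opw_scalar w (c : Qq) x : c != 0 -> opw w (c *: 1) x = x.
Proof.
move=> c0; elim: w x => //= i w IH x.
by rewrite ellZ // ?ell1 //=; [exact: Uminus1|apply/eqP; exact: oner_neq0].
Qed.

(** Replaces the negation in [prec] by conditions linear in x, which also absorb the convention for
    0. *)
Lemma prec_below i w v x : Um v -> v <> 0 -> Um x ->
  prec i w x v <-> below (i :: w) v x.
Proof.
move=> vU v0 xU.
suff main : x <> 0 -> (prece i w x v /\ ~ prece i w v x) <-> below (i :: w) v x.
  split=> [[_ [->|[x0 h]]]|bx]; first by split; [exact: weak0|exact: opw0].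
    by apply/main.
  split=> //; have [->|x0] := pselect (x = 0); [by left|right].
  by split=> //; apply/main.
elim: w i v x vU v0 xU => [|j w IH] i v x vU v0 xU x0.
  change ((ell i x <= ell i v)%N /\ ~ (ell i v <= ell i x)%N <->
    (iter (ell i v).+1 (ed i) x = 0 /\ True) /\ iter (ell i v) (ed i) x = 0).
  have lt := ell_lt i (ell i v) xU x0; have le := ell_le i (ell i v) xU.
  split=> [[h /negP]|[[h _] /lt]].
    by rewrite -ltnNge => /lt ?; split=> //; split=> //; apply/le.
  by rewrite ltnNge => /negP; split=> //; apply/le.
change ((((ell i x < ell i v)%N \/ (ell i x = ell i v /\ prece j w
     (iter (ell i x) (eprime i) x) (iter (ell i v) (eprime i) v))) /\
   ~ ((ell i v < ell i x)%N \/ (ell i v = ell i x /\ prece j w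
     (iter (ell i v) (eprime i) v) (iter (ell i x) (eprime i) x)))) <->
  (iter (ell i v).+1 (ed i) x = 0 /\ weak (j :: w) (iter (ell i v) (ed i) v) (iter (ell i v) (ed i) x))
   /\ opw (j :: w) (iter (ell i v) (ed i) v) (iter (ell i v) (ed i) x) = 0).
rewrite !iter_eprime //.
have lt := ell_lt i (ell i v) xU x0; have le := ell_le i (ell i v) xU.
case: (ltngtP (ell i x) (ell i v)) => [xv|vx|e].
- split=> [_|_]; last by split; [left|case=> // -[e]; rewrite e ltnn in xv].
  have -> : iter (ell i v) (ed i) x = 0 by apply/lt.
  by split; [split; [apply/le/ltnW|exact: weak0]|exact: opw0].
- split=> [[[//|[e _]]]|[[/le h _] _]]; first by rewrite e ltnn in vx.
  by rewrite leqNgt vx in h.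
- have ix0 : iter (ell i v) (ed i) x <> 0 by rewrite -e; exact: ell_neq0.
  rewrite e; have main := IH j (iter (ell i v) (ed i) v) (iter (ell i v) (ed i) x)
    (Uminus_iter _ _ vU) (@ell_neq0 i _ vU v0) (Uminus_iter _ _ xU) ix0.
  have xe : iter (ell i v).+1 (ed i) x = 0 by apply/le; rewrite e.
  split=> [[[//|[_ h]] nh]|[[_ h1] h2]].
    have [|h1 h2] := proj1 main _; last by split.
    by split=> // h'; apply: nh; right.
  have [h h'] := proj2 main (conj h1 h2).
  by split=> [|[//|[_ ]]]; [right|exact: h'].
Qed.

(** The lexicographic order on exponent sequences of fixed length is well founded: induction on w,
    and inside it on the first exponent. *)
Lemma below_ind w (Pr : Uq -> Prop) :
  (forall v, Um v -> (forall x, Um x -> x <> 0 -> below w v x -> Pr x) -> Pr v) ->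
  forall v, Um v -> Pr v.
Proof.
elim: w Pr => [|i w IH] Pr progress v vU.
  by apply: progress => // x _ x0 [_ e]; case: x0.
have [n] := ubnP (ell i v); elim: n v vU => // n IHn v vU vn.
(* The predicate carried to the rest of w quantifies over all vectors with the given first exponent
   and top u. *)
pose Q u := forall v', Um v' -> ell i v' = ell i v -> iter (ell i v) (ed i) v' = u -> Pr v'.
suff: Q (iter (ell i v) (ed i) v) by apply.
apply: (IH Q); last exact: Uminus_iter.
move=> u uU hu v' v'U ev' u_eq; apply: (progress v' v'U) => x xU x0 [[/= xv wx] ox].
rewrite ev' in xv wx ox.
have [|xlt] := leqP (ell i v) (ell i x); last first.
  by apply: IHn => //; exact: leq_trans xlt vn.
move=> vx; have ex : ell i x = ell i v.
  by apply/eqP; rewrite eqn_leq vx andbT; apply/(ell_le _ _ xU).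
apply: (hu (iter (ell i v) (ed i) x)) => //; first exact: Uminus_iter.
  by rewrite -ex; exact: ell_neq0.
by split; rewrite -u_eq.
Qed.

(** The letters removed by [opw w v]. They do not depend on its argument, so vectors of equal weight
    that survive end in equal weights. *)
Fixpoint string_word (w : seq I) (v : Uq) : seq I :=
  if w is i :: w' then
    nseq (ell i v) i ++ string_word w' (iter (ell i v) (ed i) v)
  else [::].

Lemma homog_iter i n u x : homog u x -> iter n (ed i) x <> 0 ->
  exists2 u', perm_eq u (nseq n i ++ u') & homog u' (iter n (ed i) x).
Proof.
elim: n u x => [|n IH] u x hx; first by exists u.
rewrite iterSr => x0; have [iu|iu] := boolP (i \in u); last first.
  by case: x0; rewrite (homog_ed_notin hx iu) iter_linear0.
have [u' uu' hu'] := IH _ _ (homog_ed i hx) x0.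
by exists u' => //; rewrite (permPl (perm_to_rem iu)) /= perm_cons.
Qed.

Lemma homog_opw w v u x : homog u x -> opw w v x <> 0 ->
  exists2 u', perm_eq u (string_word w v ++ u') & homog u' (opw w v x).
Proof.
elim: w v u x => [|i w IH] v u x hx x0; first by exists u.
have i0 : iter (ell i v) (ed i) x <> 0 by move=> e; apply: x0; rewrite /= e opw0.
have [u1 uu1 hu1] := homog_iter hx i0; have [u2 uu2 hu2] := IH _ _ _ hu1 x0.
exists u2 => //=; rewrite -catA (perm_trans uu1) // perm_cat2l.
exact: uu2.
Qed.
End Strings.

(** * Perfect bases *)

Lemma sum_fibers (A T : eqType) (V : nmodType) (l : seq A) (r : seq T) (m : A -> T)
    (F : A -> V) : uniq r -> {in l, forall p, m p \in r} ->
  \sum_(v <- r) \sum_(p <- l | m p == v) F p = \sum_(p <- l) F p.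
Proof.
move=> ur lr; rewrite (exchange_big_dep xpredT) //= [LHS]big_seq [RHS]big_seq.
apply: eq_bigr => p /lr pr; rewrite -big_filter.
rewrite (eq_filter (a2 := pred1 (m p))) => [|v]; last exact: eq_sym.
by rewrite filter_pred1_uniq // big_seq1.
Qed.

Lemma sum_fiber1 (A T : eqType) (V : nmodType) (r : seq A) (g : A -> T)
    (c : A -> V) t : uniq (map g r) -> t \in r ->
  \sum_(t' <- r | g t' == g t) c t' = c t.
Proof.
elim: r => // k r IH /= /andP[kr ur]; rewrite in_cons big_cons => /orP[/eqP ->|tr].
  rewrite eqxx big_seq_cond big1 ?addr0 // => t' /andP[t'r /eqP e].
  by rewrite -e map_f in kr.
by case: eqP kr => [->|_ _]; [rewrite map_f|exact: IH].
Qed.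

Section Weights.
Context {I : countType} {P : zmodType} (D : bc_datum I P).
Notation fm := (fmonomial D).
Notation homog := (@homog I P D).

Lemma wtw_perm (u w : seq I) : wtw D u = wtw D w -> perm_eq u w.
Proof.
have wtE v (r : seq I) : uniq r -> {subset v <= r} ->
    wtw D v = \sum_(i <- r) (count_mem i v)%:Z *: (bcalpha D i : zmodule P).
  move=> ur vr; rewrite /wtw -(sum_fibers (m := id) _ ur vr); apply: eq_bigr => i _.
  rewrite (eq_bigr (fun=> bcalpha D i)) => [|k /eqP -> //].
  by rewrite big_const_seq iter_addr_0.
move=> uw; apply/allP => i; rewrite mem_cat => iuw /=; pose r := undup (u ++ w).
have ur : uniq r := undup_uniq _.
have [su sw] : {subset u <= r} /\ {subset w <= r}.
  by split=> k kv; rewrite mem_undup mem_cat kv ?orbT.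
have := @bcalpha_indep _ _ D r (fun i => (count_mem i u)%:Z - (count_mem i w)%:Z) ur.
rewrite (eq_bigr (fun i => (count_mem i u)%:Z *: (bcalpha D i : zmodule P)
   - (count_mem i w)%:Z *: (bcalpha D i : zmodule P))); last first.
  by move=> k _; rewrite scalerBl.
rewrite sumrB -(wtE u r ur su) -(wtE w r ur sw) uw subrr => /(_ erefl i).
rewrite mem_undup mem_cat => /(_ iuw) /eqP; rewrite subr_eq0 => /eqP.
by case=> ->.
Qed.

Lemma Uminus_deg_homog (w : seq I) x :
  Uminus_deg (- wtw D w) x -> homog w x.
Proof.
move=> [r [c [hr ->]]]; rewrite big_seq; elim/big_ind: _ => [|y z hy hz|v vr].
- exact: homog0.
- exact: homogD.
- apply: homogZ; have [u /= uw <-] := hr v vr; apply: homog_fm; apply: wtw_perm.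
  exact: oppr_inj.
Qed.

Lemma homog_Uminus_deg (w : seq I) x : homog w x -> Uminus_deg (- wtw D w) x.
Proof.
case=> l lw ->; pose m (p : Qq * seq I) := fm p.2.
exists (undup (map m l)), (fun v => \sum_(p <- l | m p == v) p.1); split.
  move=> v; rewrite mem_undup => /mapP[p pl ->]; exists p.2 => //=.
  by rewrite /wtw (perm_big _ (lw p pl)).
have ml : {in l, forall p, m p \in undup (map m l)}.
  by move=> p pl; rewrite mem_undup; exact: map_f.
rewrite /fsum -(sum_fibers _ (undup_uniq _) ml); apply: eq_bigr => v _.
by rewrite scaler_suml; apply: eq_bigr => p /eqP <-.
Qed.
End Weights.

Section PerfectBasis.
Context {I : countType} {P : zmodType} (D : bc_datum I P).
Notation Uq := (Uq D).
Notation Um := (@Uminus I P D).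
Notation ed := (ed D).
Notation homog := (@homog I P D).
Notation ell := (@ell I P D).
Variable (B : set Uq).
Hypothesis pB : perfect_basis B.

(** Independence for families with an arbitrary index type, freeing later arguments from the subtype
    of B. *)
Lemma basis_indep (T : eqType) (r : seq T) (g : T -> Uq) (c : T -> Qq) :
  uniq (map g r) -> {in r, forall t, B (g t)} -> \sum_(t <- r) c t *: g t = 0 ->
  {in r, forall t, c t = 0}.
Proof.
move=> ugr gB s0 t tr; have [ind _] := pb_basis pB.
pose c' (v : Uq) := \sum_(t <- r | g t == v) c t.
pose rB : seq B := pmap insub (map g r).
have valB : map val rB = map g r.
  rewrite /rB (pmap_filter (@insubK _ _ _)); apply/all_filterP/allP => v /mapP[t' t'r ->].
  by rewrite /= isSome_insub; apply/mem_set; exact: gB.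
have urB : uniq rB by rewrite -(map_inj_uniq val_inj) valB.
have : \sum_(b <- rB) c' (val b) *: val b = 0.
  rewrite -(big_map val xpredT (fun v => c' v *: v)) valB -[RHS]s0.
  have ml : {in r, forall t', g t' \in map g r} by move=> t' t'r; exact: map_f.
  rewrite -[RHS](sum_fibers _ ugr ml); apply: eq_bigr => v _.
  by rewrite scaler_suml; apply: eq_bigr => t' /eqP ->.
have tB : B (g t) by exact: gB.
move=> /(ind rB (fun b => c' (val b)) urB) /(_ (SigSub (mem_set tB) : B)).
rewrite /c' /= (sum_fiber1 c ugr tr) => h; apply: h.
by rewrite -(mem_map val_inj) valB /=; exact: map_f.
Qed.

Lemma basis_Um b : B b -> Um b.
Proof.
move=> bB; have [_ <-] := pb_basis pB.
exists [:: b], (fun=> 1); split; last by rewrite big_seq1 scale1r.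
by move=> v; rewrite inE => /eqP ->.
Qed.

Lemma basis_expand x : Um x ->
  exists r c, [/\ uniq r, {in r, forall b, B b} & x = \sum_(b <- r) c b *: b].
Proof.
have [_ sp] := pb_basis pB; rewrite -{1}sp => -[r [c [rB ->]]].
exists (undup r), (fun v => \sum_(p <- r | p == v) c p); split.
- exact: undup_uniq.
- by move=> b; rewrite mem_undup; exact: rB.
- have ml : {in r, forall p, id p \in undup r} by move=> p; rewrite mem_undup.
  rewrite -(sum_fibers _ (undup_uniq _) ml); apply: eq_bigr => v _.
  by rewrite scaler_suml; apply: eq_bigr => p /eqP ->.
Qed.

Lemma basis_neq0 b : B b -> b <> 0.
Proof.
move=> bB b0; have hB : {in [:: b], forall t, B (id t)}.
  by move=> t; rewrite inE => /eqP ->.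
have s0 : \sum_(t <- [:: b]) (1 : Qq) *: id t = 0 by rewrite big_seq1 scale1r.
have /eqP := basis_indep (c := fun=> 1) (erefl : uniq (map id [:: b])) hB s0 (mem_head b [::]).
by rewrite oner_eq0.
Qed.

Lemma basis_prop b b' (c : Qq) : B b -> B b' -> b = c *: b' -> b = b'.
Proof.
move=> bB bB' e; apply/eqP/negP => /negP bb.
have u2 : uniq (map id [:: b; b']) by rewrite /= inE bb.
have hB : {in [:: b; b'], forall t, B (id t)}.
  by move=> t; rewrite !inE => /orP[] /eqP ->.
pose d (v : Uq) : Qq := if v == b then 1 else - c.
have s0 : \sum_(t <- [:: b; b']) d t *: id t = 0.
  rewrite big_cons big_seq1 /d eqxx eq_sym (negbTE bb) scale1r scaleNr {1}e.
  exact: subrr.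
have /eqP := basis_indep u2 hB s0 (mem_head b [:: b']).
by rewrite /d eqxx oner_eq0.
Qed.

Lemma basis_one : B 1.
Proof. by have [] : (B `&` [set c%:A | c in [set: Qq]]) 1 by rewrite (pb_one pB). Qed.

Lemma basis_scalar b (c : Qq) : B b -> b = c *: 1 -> b = 1.
Proof. by move=> bB bc; have := basis_prop bB basis_one bc. Qed.

Lemma basis_homog b : B b -> exists w, homog w b.
Proof.
move=> /(pb_graded pB)[mu [[[w _ <-] dw] _]]; exists w.
exact: Uminus_deg_homog.
Qed.

(** From the exponent of b' on, the powers of e_i' annihilate the error term of the arrow, and b and
    b' become proportional. *)
Lemma arrowP i b b' : B b -> B b' -> perfect_arrow i b b' -> ed i b <> 0 ->
  ell i b = (ell i b').+1 /\
  exists2 c : Qq, c != 0 & forall k, (ell i b' <= k)%N ->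
    iter k.+1 (ed i) b = c *: iter k (ed i) b'.
Proof.
move=> bB bB' [c c0 [lU l0]] eb; have bU := basis_Um bB; have bU' := basis_Um bB'.
rewrite iter_eprime // in l0; rewrite eprimeE // in l0 lU.
case e: (ell i b) l0 => [|n] /= l0.
  by case: eb; have /(ell_le i 0 bU) : (ell i b <= 0)%N by rewrite e.
have iE k : (n <= k)%N -> iter k.+1 (ed i) b = c *: iter k (ed i) b'.
  move=> nk; have := iter_eq0_leq nk l0; rewrite -scaleNr addrC iter_linear -iterSr.
  by rewrite scaleNr addrC => /eqP; rewrite subr_eq0 => /eqP.
have en : ell i b' = n.
  apply: ell_eq => // [e0|].
    have := @ell_neq0 _ _ _ i b bU (basis_neq0 bB).
    by rewrite e iE // e0 scaler0.
  have := proj1 (ellP i bU); rewrite e iE ?leqnSn // => /eqP.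
  by rewrite scaler_eq0 (negbTE c0) => /eqP.
by rewrite en; split=> //; exists c.
Qed.

Lemma etilP i (b b' : B) : etil i b = Some b' <->
  eprime i (val b) <> 0 /\ perfect_arrow i (val b) (val b').
Proof.
rewrite /etil; case: eqP => [->|/eqP /eqP e0]; first by split=> [|[]].
have [b1 [[bB1 ab1] b1u]] := pb_arrow pB (set_valP b) e0.
split=> [|[_ ab']].
  by case: xgetP => [_ -> [b2 ab2 <-] [<-]|//].
have sub_b1 (x y : B) : val x = val y -> x = y by exact: val_inj.
case: xgetP => [_ _ [b2 ab2 <-]|/(_ (Some b'))]; last by case; exists b'.
congr Some; apply: sub_b1.
exact: etrans (esym (b1u _ (conj (set_valP b2) ab2)))
              (b1u _ (conj (set_valP b') ab')).
Qed.

Lemma etop_iter i n (b : B) : ell i (val b) = n ->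
  exists b0 : B, iter n (obind (etil i)) (Some b) = Some b0 /\
    exists2 c : Qq, c != 0 & iter n (ed i) (val b) = c *: val b0.
Proof.
elim: n b => [|n IH] b en.
  by exists b; split=> //; exists 1; rewrite ?oner_neq0 // scale1r.
have bB := set_valP b; have bU := basis_Um bB.
have eb : ed i (val b) <> 0.
  by move=> e0; have /(ell_le i 0 bU) := e0; rewrite en.
have eb' : eprime i (val b) <> 0 by rewrite eprimeE.
have [b1 [[bB1 ab1] _]] := pb_arrow pB bB eb'.
have [e1 [c c0 iE]] := arrowP bB bB1 ab1 eb.
have eb1 : etil i b = Some (SigSub (mem_set bB1) : B) by apply/etilP.
have en1 : ell i b1 = n by move: e1; rewrite en => -[].
have [b0 [b0E [c1 c10 i1]]] := IH (SigSub (mem_set bB1) : B) en1.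
exists b0; split; first by rewrite iterSr /= eb1.
exists (c * c1); first exact: (mulf_neq0 c0 c10).
rewrite iE; last by rewrite en1.
by rewrite -[b1]/(val (SigSub (mem_set bB1) : B)) i1 scalerA.
Qed.

Lemma top_ex i b : B b -> exists2 b0, B b0 &
  exists2 c : Qq, c != 0 & iter (ell i b) (ed i) b = c *: b0.
Proof.
move=> bB; have [b0 [_ h]] := @etop_iter i _ (SigSub (mem_set bB) : B) erefl.
by exists (val b0) => //; exact: set_valP.
Qed.

(** Arrows lead down to exponent 0, where proportional basis elements coincide; injectivity of the
    arrows leads back up. *)
Lemma top_inj i n b1 b2 (c : Qq) : B b1 -> B b2 -> ell i b1 = n -> ell i b2 = n ->
  iter n (ed i) b1 = c *: iter n (ed i) b2 -> b1 = b2.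
Proof.
elim: n b1 b2 c => [|n IH] b1 b2 c bB1 bB2 e1 e2 be.
  exact: basis_prop be.
have arr b : B b -> ell i b = n.+1 -> eprime i b <> 0 /\ exists2 b', B b' &
    perfect_arrow i b b' /\ (ell i b' = n /\
      exists2 d : Qq, d != 0 & iter n.+1 (ed i) b = d *: iter n (ed i) b').
  move=> bB e; have bU := basis_Um bB.
  have eb : ed i b <> 0 by move=> e0; have /(ell_le i 0 bU) := e0; rewrite e.
  have eb' : eprime i b <> 0 by rewrite eprimeE.
  have [b' [[bB' ab'] _]] := pb_arrow pB bB eb'; split=> //; exists b' => //.
  have [e' [d d0 h]] := arrowP bB bB' ab' eb; have en : ell i b' = n.
    by move: e'; rewrite e => -[].
  by split=> //; split=> //; exists d => //; rewrite h // en.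
have [eb1 [b1' bB1' [a1 [n1 [d1 d10 h1]]]]] := arr b1 bB1 e1.
have [eb2 [b2' bB2' [a2 [n2 [d2 d20 h2]]]]] := arr b2 bB2 e2.
have e12 : b1' = b2'.
  apply: (IH b1' b2' (d1^-1 * (c * d2))) => //.
  by rewrite -!scalerA -h2 -be h1 scalerA (mulVf d10) scale1r.
by apply: (pb_inj pB) eb1 eb2 a1 _ => //; rewrite e12.
Qed.
End PerfectBasis.

Lemma uniq_map_inj (A T : eqType) (r : seq A) (g : A -> T) : uniq (map g r) ->
  {in r &, injective g}.
Proof.
move=> ugr t t' tr tr' gtt; apply/eqP/negP => /negP tt.
have := sum_fiber1 (V := nat) (fun x => (x == t : nat)) ugr tr'.
by rewrite -gtt (sum_fiber1 (V := nat) _ ugr tr) eqxx eq_sym (negbTE tt).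
Qed.

(** * Strings of the elements of a perfect basis *)

Section BasisStrings.
Context {I : countType} {P : zmodType} (D : bc_datum I P).
Notation Uq := (Uq D).
Notation Um := (@Uminus I P D).
Notation ed := (ed D).
Notation homog := (@homog I P D).
Notation ell := (@ell I P D).
Notation opw := (@opw I P D).
Notation weak := (@weak I P D).

Lemma iter_sum i n (T : Type) (r : seq T) (F : T -> Uq) :
  iter n (ed i) (\sum_(t <- r) F t) = \sum_(t <- r) iter n (ed i) (F t).
Proof.
elim: r => [|t r IH]; first by rewrite !big_nil iter_linear0.
by rewrite !big_cons -{1}[F t]scale1r iter_linear scale1r IH.
Qed.

Lemma opw_sum w v (T : Type) (r : seq T) (F : T -> Uq) :
  opw w v (\sum_(t <- r) F t) = \sum_(t <- r) opw w v (F t).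
Proof.
elim: r => [|t r IH]; first by rewrite !big_nil opw0.
by rewrite !big_cons -{1}[F t]scale1r opw_lin scale1r IH.
Qed.

Lemma weak_sum w v (T : eqType) (r : seq T) (F : T -> Uq) :
  {in r, forall t, weak w v (F t)} -> weak w v (\sum_(t <- r) F t).
Proof.
elim: r => [|t r IH] h; first by rewrite big_nil; exact: weak0.
rewrite big_cons -[F t]scale1r; apply: weak_lin; first by apply: h; rewrite mem_head.
by apply: IH => t' tr; apply: h; rewrite in_cons tr orbT.
Qed.

Section OneBasis.
Variable (B : set Uq).
Hypothesis pB : perfect_basis B.

(* The tops of the elements of B with maximal ell are distinct elements of B. *)
Lemma support_iter_eq0 i k (T : eqType) (r : seq T) (g : T -> Uq) (c : T -> Qq) :
  uniq (map g r) -> {in r, forall t, B (g t)} ->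
  iter k (ed i) (\sum_(t <- r) c t *: g t) = 0 ->
  {in r, forall t, c t != 0 -> iter k (ed i) (g t) = 0}.
Proof.
move=> ugr gB s0.
have step m : (k <= m)%N -> {in r, forall t, c t != 0 -> (ell i (g t) < m.+1)%N} ->
    {in r, forall t, c t != 0 -> (ell i (g t) < m)%N}.
  move=> km hm.
  (* [p t] is the basis element at the top of [g t], with its coefficient; (0, 0) is the default
     where the exponent differs from m. *)
  have /choice[p hp] : forall t, exists p : Uq * Qq, t \in r -> ell i (g t) = m ->
      [/\ B p.1, p.2 != 0 & iter m (ed i) (g t) = p.2 *: p.1].
    move=> t; have [[tr tm]|nt] := pselect (t \in r /\ ell i (g t) = m); last first.
      by exists (0, 0) => tr tm; case: nt.
    have [b0 bB0 [d d0 e]] := top_ex pB i (gB t tr).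
    by exists (b0, d) => _ _; split; [exact: bB0|exact: d0|rewrite -tm].
  pose r' := [seq t <- r | ell i (g t) == m].
  have r'P t : t \in r' -> t \in r /\ ell i (g t) = m.
    by rewrite mem_filter => /andP[/eqP].
  have inj : {in r' &, injective (fun t => (p t).1)}.
    move=> t t' tr tr' /= ett'; have [tr1 tm] := r'P t tr; have [tr2 tm'] := r'P t' tr'.
    have [_ d0 e] := hp t tr1 tm; have [_ d0' e'] := hp t' tr2 tm'.
    have gtt : g t = g t'.
      apply: (@top_inj _ _ _ _ pB i m (g t) (g t') ((p t).2 / (p t').2)) => //.
      - exact: gB.
      - exact: gB.
      - by rewrite e e' ett' scalerA (divfK d0').
    exact: (uniq_map_inj ugr).
  have ur' : uniq (map (fun t => (p t).1) r').
    by rewrite map_inj_in_uniq // filter_uniq //; exact: map_uniq ugr.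
  have B' : {in r', forall t, B (p t).1}.
    by move=> t /r'P[tr tm]; have [] := hp t tr tm.
  have sum0 : \sum_(t <- r') (c t * (p t).2) *: (p t).1 = 0.
    rewrite big_filter -[RHS](iter_eq0_leq km s0) iter_sum big_mkcond big_seq [RHS]big_seq.
    apply: eq_bigr => t tr; rewrite iterZ.
    have gU := basis_Um pB (gB t tr).
    case: eqP => [tm|tm]; first by have [_ _ ->] := hp t tr tm; rewrite scalerA.
    have [->|ct] := eqVneq (c t) 0; first by rewrite scale0r.
    have tlt : (ell i (g t) < m)%N by rewrite ltn_neqAle -ltnS hm // andbT; apply/eqP.
    have /(ell_lt i m gU (basis_neq0 pB (gB t tr))) -> := tlt.
    by rewrite scaler0.
  move=> t tr ct; rewrite ltn_neqAle -ltnS hm // andbT; apply/eqP => tm.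
  have tr' : t \in r' by rewrite mem_filter tm eqxx.
  have [_ d0 _] := hp t tr tm.
  have /eqP := basis_indep pB ur' B' sum0 tr'.
  by rewrite mulf_eq0 (negbTE ct) (negbTE d0).
have bound n : {in r, forall t, c t != 0 -> (ell i (g t) < k + n)%N} ->
    {in r, forall t, c t != 0 -> (ell i (g t) < k)%N}.
  elim: n => [|n IH]; first by rewrite addn0.
  by rewrite addnS => h; apply: IH; apply: step h; exact: leq_addr.
have h : {in r, forall t, c t != 0 -> (ell i (g t) < k)%N}.
  apply: (bound (\max_(t <- r) ell i (g t)).+1) => t tr _.
  rewrite addnS ltnS; apply: leq_trans (leq_addl _ _).
  exact: (@leq_bigmax_seq _ r xpredT (fun t => ell i (g t)) t tr isT).
move=> t tr ct; have gU := basis_Um pB (gB t tr).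
by apply/(ell_lt i k gU (basis_neq0 pB (gB t tr))); exact: h.
Qed.

(** The terms of exponent exactly [ell i v] have tops proportional to distinct elements of B, so the
    claim for the rest of w applies to them; the remaining terms of the support are already
    killed. *)
Lemma weak_support w v (T : eqType) (r : seq T) (g : T -> Uq) (c : T -> Qq) :
  uniq (map g r) -> {in r, forall t, B (g t)} ->
  weak w v (\sum_(t <- r) c t *: g t) ->
  {in r, forall t, c t != 0 -> weak w v (g t)}.
Proof.
elim: w v T r g c => //= i w IH v T r g c ugr gB [s0 sw] t tr ct.
set m := ell i v in s0 sw *.
have km := support_iter_eq0 (k := m.+1) ugr gB s0; split; first exact: (km t tr ct).
have /choice[p hp] : forall t, exists p : Uq * Qq, t \in r -> ell i (g t) = m ->
    [/\ B p.1, p.2 != 0 & iter m (ed i) (g t) = p.2 *: p.1].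
  move=> t'; have [[tr' tm]|nt] := pselect (t' \in r /\ ell i (g t') = m); last first.
    by exists (0, 0) => tr' tm; case: nt.
  have [b0 bB0 [d d0 e]] := top_ex pB i (gB t' tr').
  by exists (b0, d) => _ _; split; [exact: bB0|exact: d0|rewrite -tm].
have gU := basis_Um pB (gB t tr); have g0 := basis_neq0 pB (gB t tr).
have [tm|tm] := eqVneq (ell i (g t)) m; last first.
  have /(ell_le i m gU) tle := km t tr ct.
  have /(ell_lt i m gU g0) -> : (ell i (g t) < m)%N by rewrite ltn_neqAle tm.
  exact: weak0.
pose r' := [seq t <- r | ell i (g t) == m].
have r'P t' : t' \in r' -> t' \in r /\ ell i (g t') = m.
  by rewrite mem_filter => /andP[/eqP].
have [_ d0 ->] := hp t tr tm; apply: weakZ.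
have inj : {in r' &, injective (fun t => (p t).1)}.
  move=> t1 t2 tr1 tr2 /= ett; have [t1r t1m] := r'P t1 tr1; have [t2r t2m] := r'P t2 tr2.
  have [_ d10 e1] := hp t1 t1r t1m; have [_ d20 e2] := hp t2 t2r t2m.
  apply: (uniq_map_inj ugr) => //.
  apply: (@top_inj _ _ _ _ pB i m (g t1) (g t2) ((p t1).2 / (p t2).2)) => //.
  - exact: gB.
  - exact: gB.
  - by rewrite e1 e2 ett scalerA (divfK d20).
apply: (IH _ T r' (fun t => (p t).1) (fun t => c t * (p t).2)).
- by rewrite map_inj_in_uniq // filter_uniq //; exact: map_uniq ugr.
- by move=> t' /r'P[tr' tm']; have [] := hp t' tr' tm'.
- have <- : iter m (ed i) (\sum_(t <- r) c t *: g t) =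
      \sum_(t <- r') (c t * (p t).2) *: (p t).1; last exact: sw.
  rewrite big_filter iter_sum [RHS]big_mkcond; apply: eq_big_seq => t' tr'.
  rewrite iterZ.
  have gU' := basis_Um pB (gB t' tr').
  case: eqP => [tm'|tm']; first by have [_ _ ->] := hp t' tr' tm'; rewrite scalerA.
  have [->|ct'] := eqVneq (c t') 0; first by rewrite scale0r.
  have /(ell_le i m gU') tle := km t' tr' ct'.
  have tlt : (ell i (g t') < m)%N by rewrite ltn_neqAle tle andbT; apply/eqP.
  have /(ell_lt i m gU' (basis_neq0 pB (gB t' tr'))) -> := tlt.
  by rewrite scaler0.
- by rewrite mem_filter tm eqxx.
- exact: (mulf_neq0 ct d0).
Qed.

(** [top_inj] undoes the tops one letter at a time, from the end of w to its beginning. *)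
Lemma weak_inj w v b1 b2 (c : Qq) : B b1 -> B b2 -> weak w v b1 -> weak w v b2 ->
  opw w v b1 = c *: opw w v b2 -> opw w v b1 <> 0 -> b1 = b2.
Proof.
elim: w v b1 b2 c => [|i w IH] v b1 b2 c bB1 bB2.
  by move=> _ _ /= e _; exact: (basis_prop pB bB1 bB2 e).
set m := ell i v => -[/= e1 w1] [/= e2 w2] be o1.
have o2 : opw w (iter m (ed i) v) (iter m (ed i) b2) <> 0.
  by move=> o2; apply: o1; rewrite be o2 scaler0.
have len b : B b -> iter m.+1 (ed i) b = 0 ->
    opw w (iter m (ed i) v) (iter m (ed i) b) <> 0 -> ell i b = m.
  move=> bB e o; apply: ell_eq => //; first exact: (basis_Um pB bB).
  by move=> e0; apply: o; rewrite e0 opw0.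
have m1 := len b1 bB1 e1 o1; have m2 := len b2 bB2 e2 o2.
have [t1 tB1 [d1 d10 t1E]] := top_ex pB i bB1.
have [t2 tB2 [d2 d20 t2E]] := top_ex pB i bB2.
rewrite m1 in t1E; rewrite m2 in t2E.
rewrite -/m t1E t2E !opwZ in w1 w2 be o1.
have wt d t : d != 0 -> weak w (iter m (ed i) v) (d *: t) -> weak w (iter m (ed i) v) t.
  by move=> d0 /(weakZ d^-1); rewrite scalerA (mulVf d0) scale1r.
have t12 : t1 = t2.
  apply: (IH (iter m (ed i) v) t1 t2 (d1^-1 * (c * d2)) tB1 tB2).
  - exact: wt d10 w1.
  - exact: wt d20 w2.
  - by rewrite -!scalerA -be scalerA (mulVf d10) scale1r.
  - by move=> e; apply: o1; rewrite e scaler0.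
apply: (@top_inj _ _ _ _ pB i m b1 b2 (d1 / d2) bB1 bB2 m1 m2).
by rewrite t1E t2E t12 scalerA (divfK d20).
Qed.

Lemma support_homog u (r : seq Uq) (c : Uq -> Qq) : uniq r ->
  {in r, forall b, B b} -> homog u (\sum_(b <- r) c b *: b) ->
  {in r, forall b, c b != 0 -> homog u b}.
Proof.
move=> ur rB hu b br cb; have [//|nh] := pselect (homog u b).
(* Subtracting the projection to weight u leaves only the terms of other weights, whose coefficients
   then vanish by independence. *)
pose chi (b : Uq) : Qq := if `[< homog u b >] then 0 else 1.
have chiE b' : b' \in r -> b' - pj D u b' = chi b' *: b'.
  move=> br'; rewrite /chi; case: asboolP => [h|h]; first by rewrite (pj_id h) subrr scale0r.
  have [u' hu'] := basis_homog pB (rB _ br').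
  rewrite (pj_out hu') ?subr0 ?scale1r //; apply/negP => uu'.
  by apply: h; exact: homog_perm uu' hu'.
have s0 : \sum_(b <- r) (c b * chi b) *: id b = 0.
  transitivity (\sum_(b <- r) c b *: (b - pj D u b)).
    by apply: eq_big_seq => b' br'; rewrite chiE // scalerA.
  under eq_bigr => b' _ do rewrite scalerBr -linearZZ.
  rewrite sumrB -linear_sum.
  by rewrite (pj_id hu) subrr.
have ur' : uniq (map id r) by rewrite map_id.
have := basis_indep pB ur' rB s0 br; rewrite /chi; case: asboolP => // _.
by rewrite mulr1 => e; rewrite e eqxx in cb.
Qed.

(** The vanishing of singular vectors enters here; in weight 0 the normalisation of B leaves only
    1. *)
Lemma basis_nonsingular u b : B b -> homog u b -> b <> 1 ->
  exists2 i, i \in u & ed i b <> 0.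
Proof.
move=> bB hb b1; apply: contrapT => nex.
have sb : singular b.
  move=> i; have [iu|iu] := boolP (i \in u); last exact: homog_ed_notin hb iu.
  by apply: contrapT => e; apply: nex; exists i.
have [u0|u0] := eqVneq u [::]; last first.
  exact: (basis_neq0 pB bB (singular_eq0 u0 hb sb)).
by rewrite u0 in hb; have [c /(basis_scalar pB bB)] := homog_nil hb.
Qed.

Lemma opw_same_scale w (c : Qq) b : Um b -> b <> 0 -> c != 0 ->
  opw w (c *: b) (c *: b) = c *: opw w b b.
Proof.
elim: w b => //= i w IH b bU b0 c0; rewrite (ellZ i bU b0 c0) iterZ IH //.
  exact: Uminus_iter.
exact: ell_neq0.
Qed.

(** One passage along l. The second alternative contradicts [basis_nonsingular] when l contains all
    letters of u and b is not 1, so the weight must shrink. *)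
Lemma string_pass l u b : B b -> homog u b -> exists b1 u1,
  [/\ B b1, homog u1 b1, {subset u1 <= u},
     (exists2 c : Qq, c != 0 & opw l b b = c *: b1) &
     (size u1 < size u)%N \/ [/\ b1 = b, u1 = u & forall i, i \in l -> ed i b = 0]].
Proof.
elim: l u b => [|i l IH] u b bB hb.
  exists b, u; split=> //; last by right.
  by exists 1; [exact: oner_neq0|rewrite scale1r].
have bU := basis_Um pB bB; have b0 := basis_neq0 pB bB.
case e: (ell i b) => [|m].
  have [b1 [u1 [B1 h1 s1 o1 d1]]] := IH u b bB hb.
  exists b1, u1; split=> //; first by rewrite /= e.
  case: d1 => [lt|[b1E u1E all0]]; [by left|right; split=> // j].
  rewrite in_cons => /orP[/eqP ->|]; last exact: all0.
  by apply/(ell_le i 0 bU); rewrite e.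
have [bt tB [d d0 tE]] := top_ex pB i bB.
have i0 : iter (ell i b) (ed i) b <> 0 by exact: ell_neq0.
have [ut uut ht] := homog_iter hb i0.
have {}ht : homog ut bt.
  by rewrite -[bt](scalerK d0) -tE; exact: homogZ.
have [b1 [u1 [B1 h1 s1 [c c0 o1] d1]]] := IH ut bt tB ht.
have sz : (size ut < size u)%N.
  by rewrite (perm_size uut) size_cat size_nseq e addSn ltnS leq_addl.
have su : {subset ut <= u}.
  by move=> j jt; rewrite (perm_mem uut) mem_cat jt orbT.
exists b1, u1; split=> //; first by move=> j /s1 /su.
- exists (d * c); first exact: (mulf_neq0 d0 c0).
  rewrite /= tE (opw_same_scale _ (basis_Um pB tB) (basis_neq0 pB tB) d0).
  by rewrite o1 scalerA.
- left; by case: d1 => [lt|[_ -> _]]; first exact: ltn_trans lt sz.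
Qed.

End OneBasis.
End BasisStrings.

(** * Matching two perfect bases *)

Section Matching.
Context {I : countType} {P : zmodType} (D : bc_datum I P).
Notation Uq := (Uq D).
Notation Um := (@Uminus I P D).
Notation ed := (ed D).
Notation homog := (@homog I P D).
Notation ell := (@ell I P D).
Notation opw := (@opw I P D).
Notation weak := (@weak I P D).
Notation below := (@below I P D).

Definition is_const (x : Uq) : Prop := exists2 c : Qq, c != 0 & x = c *: 1.
Definition reach (w : seq I) (b : Uq) : Prop := is_const (opw w b b).
Definition same (w : seq I) (b b' : Uq) : Prop := weak w b b' /\ is_const (opw w b b').

Lemma is_const_nz x : is_const x -> x <> 0.
Proof. by move=> [c c0 ->]; exact: scalar_neq0. Qed.

Lemma is_const1 : is_const 1.
Proof. by exists 1; [exact: oner_neq0|rewrite scale1r]. Qed.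

Lemma is_constZ c x : c != 0 -> is_const x -> is_const (c *: x).
Proof. by move=> c0 [d d0 ->]; exists (c * d); [exact: (mulf_neq0 c0 d0)|rewrite scalerA]. Qed.

(** As many passages through u as u has letters, enough to reduce every basis element of weight u to
    a constant, in any perfect basis. *)
Definition full_word (u : seq I) : seq I := flatten (nseq (size u) u).

Section OneBasis.
Variable (B : set Uq).
Hypothesis pB : perfect_basis B.

Lemma reach_rounds k u0 u b : B b -> homog u b -> {subset u <= u0} ->
  (size u <= k)%N -> reach (flatten (nseq k u0)) b.
Proof.
elim: k u b => [|k IH] u b bB hb su.
  rewrite leqn0 => /nilP u0E; rewrite u0E in hb; have [c bE] := homog_nil hb.
  by rewrite (basis_scalar pB bB bE); exact: is_const1.
move=> sk; have [b1E|b1] := pselect (b = 1).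
  have := @opw_scalar _ _ D (flatten (nseq k.+1 u0)) 1 1 (oner_neq0 _).
  by rewrite scale1r b1E /reach => ->; exact: is_const1.
have [b' [u' [B' h' s' [c c0 o'] d']]] := string_pass pB u0 bB hb.
rewrite /reach /= opw_cat o'.
rewrite (opw_same_scale _ (basis_Um pB B') (basis_neq0 pB B') c0).
apply: (is_constZ c0); case: d' => [lt|[bE _ all0]].
  apply: (IH u') => //; first by move=> j /s' /su.
  exact: leq_trans lt sk.
by have [i iu] := basis_nonsingular pB bB hb b1; case; apply: all0; exact: su.
Qed.

(** A prefix w only shortens the weight and brings in no new letters, so the passages that follow
    still suffice. *)
Lemma reach_full w u b : B b -> homog u b -> reach (w ++ full_word u) b.
Proof.
move=> bB hb; have [b' [u' [B' h' s' [c c0 o'] d']]] := string_pass pB w bB hb.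
rewrite /reach opw_cat o'.
rewrite (opw_same_scale _ (basis_Um pB B') (basis_neq0 pB B') c0).
apply: (is_constZ c0); apply: (reach_rounds B' h' s').
by case: d' => [/ltnW|[_ -> _]].
Qed.

Lemma same_unique w v b1 b2 : B b1 -> B b2 -> same w v b1 -> same w v b2 -> b1 = b2.
Proof.
move=> bB1 bB2 [w1 o1] [w2 o2]; have o1' := is_const_nz o1.
case: o1 o2 => [c c0 e1] [d d0 e2].
apply: (weak_inj pB (c := c / d) bB1 bB2 w1 w2) => //.
by rewrite e1 e2 scalerA (divfK d0).
Qed.

(** Both vectors lose the letters of [string_word w v]; if one ends in weight 0, so does the
    other. *)
Lemma opw_homog_scalar w v u x y : homog u x -> homog u y -> is_const (opw w v x) ->
  opw w v y <> 0 -> is_const (opw w v y).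
Proof.
move=> hx hy sx y0; have x0 := is_const_nz sx; case: sx => c c0 xE.
have [u1 uu1 h1] := homog_opw hx x0; have [u2 uu2 h2] := homog_opw hy y0.
have u1n : perm_eq [::] u1.
  apply/negP => /negP nu; apply: x0.
  apply: homog_disjoint h1 nu.
  by rewrite xE; apply: homogZ; rewrite -(fm_nil D); exact: homog_fm.
have u12 : perm_eq u1 u2.
  by rewrite -(perm_cat2l (string_word w v)) -(permPl uu1).
have h0 : homog [::] (opw w v y).
  by apply: homog_perm h2; rewrite perm_sym (perm_trans u1n).
have [d dE] := homog_nil h0; exists d; last exact: dE.
by apply/eqP => d0; apply: y0; rewrite dE d0 scale0r.
Qed.

(** Since [opw w b] does not kill b it spares some term of the expansion; a spared term matches b
    along w, and [same_unique] leaves room for only one. *)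
Lemma partner u w b (r : seq Uq) (X : Uq -> Qq) : Um b -> homog u b -> reach w b ->
  uniq r -> {in r, forall b', B b'} -> b = \sum_(b' <- r) X b' *: b' ->
  exists2 b', b' \in r & [/\ X b' != 0, homog u b', same w b b' &
    below w b (b - X b' *: b')].
Proof.
move=> bU hb rb ur rB bE.
have ur' : uniq (map id r) by rewrite map_id.
have supp b' : b' \in r -> X b' != 0 -> homog u b' /\ weak w b b'.
  move=> br' X0; split.
    by apply: (support_homog pB ur rB _ br' X0); rewrite -bE.
  by apply: (weak_support pB ur' rB _ br' X0); rewrite -bE; exact: weak_refl.
have [b' br' [X0 o0]] : exists2 b', b' \in r & X b' != 0 /\ opw w b b' <> 0.
  apply: contrapT => nex; apply: (is_const_nz rb); rewrite {2}bE opw_sum big_seq.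
  apply: big1 => b' br'; rewrite opwZ.
  have [->|X0] := eqVneq (X b') 0; first by rewrite scale0r.
  have [->|o0] := pselect (opw w b b' = 0); first by rewrite scaler0.
  by case: nex; exists b'; [exact: br'|split; [exact: X0|exact: o0]].
have [hb' wb'] := supp b' br' X0.
have sb' : same w b b' by split=> //; exact: opw_homog_scalar hb hb' rb o0.
exists b' => //; split=> //.
have -> : b - X b' *: b' = \sum_(b'' <- rem b' r) X b'' *: b''.
  by rewrite {1}bE (perm_big _ (perm_to_rem br')) /= big_cons addrAC subrr add0r.
have remP b'' : b'' \in rem b' r -> b'' \in r /\ b'' != b'.
  by rewrite (mem_rem_uniq _ ur) inE => /andP[].
split.
  apply: weak_sum => b'' /remP[br'' _].
  have [->|X0'] := eqVneq (X b'') 0; first by rewrite scale0r; exact: weak0.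
  by apply: weakZ; have [] := supp b'' br'' X0'.
rewrite opw_sum big_seq; apply: big1 => b'' /remP[br'' nb].
rewrite opwZ; have [->|X0'] := eqVneq (X b'') 0; first by rewrite scale0r.
have [->|o0'] := pselect (opw w b b'' = 0); first by rewrite scaler0.
have [hb'' wb''] := supp b'' br'' X0'.
have sb'' : same w b b'' by split=> //; exact: opw_homog_scalar hb hb'' rb o0'.
by move/eqP: nb; case; exact: same_unique (rB _ br'') (rB _ br') sb'' sb'.
Qed.

Lemma partner_ex u w b : Um b -> homog u b -> reach w b ->
  exists b', [/\ B b', homog u b' & same w b b'].
Proof.
move=> bU hb rb; have [r [X [ur rB bE]]] := basis_expand pB bU.
have [b' br' [_ h' s' _]] := partner bU hb rb ur rB bE.
by exists b'; split=> //; exact: rB.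
Qed.
End OneBasis.

Lemma same_sym w b b' : Um b -> Um b' -> reach w b -> same w b b' ->
  same w b' b /\ reach w b'.
Proof.
move=> bU bU' rb [wb' ob']; have [h1 h2] := same_string bU' wb' (is_const_nz ob').
by rewrite /same /reach !h2; split=> //; split=> //; apply/h1; exact: weak_refl.
Qed.

Lemma below_weak_trans w v x y : Um x -> Um y -> x <> 0 -> y <> 0 ->
  below w v x -> weak w x y -> below w v y.
Proof.
elim: w v x y => [|i w IH] v x y xU yU x0 y0; first by move=> [_ e].
move=> [[xv wx] ox] [yx wy]; rewrite -/(weak w _ _) in wx wy.
have xv' := proj2 (ell_le i _ xU) xv; have yx' := proj2 (ell_le i _ yU) yx.
have yv : (ell i y <= ell i v)%N := leq_trans yx' xv'.
have yv0 := proj1 (ell_le i _ yU) yv.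
have [e|ne] := eqVneq (ell i y) (ell i v); last first.
  have e0 := proj1 (ell_lt i (ell i v) yU y0) (ltac:(by rewrite ltn_neqAle ne)).
  by split=> /=; rewrite e0 ?opw0 //; split; [rewrite linear0|exact: weak0].
have xe : ell i x = ell i v.
  by apply/eqP; rewrite eqn_leq xv' -e yx'.
rewrite xe in wy.
have iy0 : iter (ell i v) (ed i) y <> 0 by rewrite -e; exact: ell_neq0.
have ix0 : iter (ell i v) (ed i) x <> 0 by rewrite -xe; exact: ell_neq0.
have [h1 h2] := IH _ _ _ (Uminus_iter _ _ xU) (Uminus_iter _ _ yU) ix0 iy0 (conj wx ox) wy.
by split.
Qed.

Section TwoBases.
Variables (B1 B2 : set Uq).
Hypotheses (pB1 : perfect_basis B1) (pB2 : perfect_basis B2).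

(* If b and b' match along w1 but not along w2 then b' lies strictly below b
   along w2, and by induction the element of B1 matching b' along w2 also
   matches b' along w1, hence is b. *)
Lemma same_independent u w1 w2 :
  (forall b, B1 b \/ B2 b -> homog u b -> reach w1 b /\ reach w2 b) ->
  forall b, Um b -> B1 b -> homog u b -> forall b', B2 b' -> homog u b' ->
  same w1 b b' -> same w2 b b'.
Proof.
move=> full; apply: (below_ind (w := w2)) => b bU IH bB hb b' bB' hb' s1.
have [r1 r2] := full b (or_introl bB) hb.
have [r1' r2'] := full b' (or_intror bB') hb'.
have bU' := basis_Um pB2 bB'.
have [r [X [ur rB bE]]] := basis_expand pB2 bU.
have [b1 b1r [X0 _ sb1 _]] := partner pB2 bU hb r1 ur rB bE.
have b1E : b1 = b' := same_unique pB2 (rB _ b1r) bB' sb1 s1.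
rewrite b1E in b1r X0.
have ur' : uniq (map id r) by rewrite map_id.
have wb' : weak w2 b b'.
  by apply: (weak_support pB2 ur' rB _ b1r X0); rewrite -bE; exact: weak_refl.
have [o0|o0] := pselect (opw w2 b b' = 0); last first.
  by split=> //; exact: opw_homog_scalar hb hb' r2 o0.
have [b2 [bB2 hb2 s2]] := partner_ex pB1 bU' hb' r2'.
have bU2 := basis_Um pB1 bB2; have b20 := basis_neq0 pB1 bB2.
have bel : below w2 b b2.
  apply: below_weak_trans (basis_neq0 pB2 bB') b20 (conj wb' o0) _ => //.
  by case: s2.
have [r1b2 r2b2] := full b2 (or_introl bB2) hb2.
have [b3 [bB3 hb3 s3]] := partner_ex pB2 bU2 hb2 r1b2.
have s3' := IH b2 bU2 b20 bel bB2 hb2 b3 bB3 hb3 s3.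
have [s2' _] := same_sym bU' bU2 r2' s2.
have b3E : b3 = b' := same_unique pB2 bB3 bB' s3' s2'.
rewrite b3E in s3.
have [t1 _] := same_sym bU bU' r1 s1; have [t2 _] := same_sym bU2 bU' r1b2 s3.
have bb2 : b = b2 := same_unique pB1 bB bB2 t1 t2.
by rewrite bb2.
Qed.

Lemma match_ex u b : B1 b -> homog u b -> exists b', [/\ B2 b', homog u b',
  forall w, reach w b -> same w b b' &
  exists2 c : Qq, c != 0 & forall w, reach w b -> below w b (b - c *: b')].
Proof.
move=> bB hb; have bU := basis_Um pB1 bB.
(* The given w may reach b without reaching the other elements of its weight; appending
   [full_word u] meets the hypothesis of [same_independent]. *)
have full w v : B1 v \/ B2 v -> homog u v -> reach (full_word u) v /\ reach (w ++ full_word u) v.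
  by move=> [vB|vB] hv; split; [exact: (reach_full pB1 [::] vB hv)|
    exact: (reach_full pB1 w vB hv)|exact: (reach_full pB2 [::] vB hv)|
    exact: (reach_full pB2 w vB hv)].
have [r [X [ur rB bE]]] := basis_expand pB2 bU.
have [r0 _] := full [::] b (or_introl bB) hb.
have [b' br' [X0 hb' sb' _]] := partner pB2 bU hb r0 ur rB bE.
have sames w : reach w b -> same w b b'.
  move=> rw; have [] := same_independent (full w) bU bB hb (rB _ br') hb' sb'.
  move=> /weak_cat[wb' _]; case: rw => c c0 cE.
  (* Once w has turned b into a scalar, all further exponents are 0 and the appended letters act
     trivially. *)
  by rewrite opw_cat cE (opw_scalar _ _ c0).
exists b'; split=> //; first exact: rB.
exists (X b'); first exact: X0.
move=> w rw; have [b2 b2r [_ _ s2 bel]] := partner pB2 bU hb rw ur rB bE.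
by rewrite -(same_unique pB2 (rB _ b2r) (rB _ br') s2 (sames w rw)).
Qed.
End TwoBases.
End Matching.

(** * The crystal isomorphism between two perfect bases *)

Section CrystalOfBasis.
Context {I : countType} {P : zmodType} (D : bc_datum I P).
Notation Uq := (Uq D).
Notation ed := (ed D).
Notation homog := (@homog I P D).
Notation ell := (@ell I P D).
Notation opw := (@opw I P D).

Section OneBasis.
Variable (B : set Uq).
Hypothesis pB : perfect_basis B.

Lemma basis_val (b : B) : B (val b). Proof. exact: set_valP. Qed.

Lemma wtE u (b : B) : homog u (val b) -> wt b = - wtw D u.
Proof.
move=> hu; have [mu [_ muu]] := pb_graded pB (basis_val b).
have h : Qminus D (- wtw D u) /\ Uminus_deg (- wtw D u) (val b).
  by split; [exists u|exact: homog_Uminus_deg].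
rewrite /wt; case: xgetP => [m _ hm|/(_ _ h)//].
by rewrite -(muu _ hm) -(muu _ h).
Qed.

Lemma etop_seqE w (b : B) : exists b0 : B, etop_seq w b = Some b0 /\
  exists2 c : Qq, c != 0 & opw w (val b) (val b) = c *: val b0.
Proof.
elim: w b => [|i w IH] b.
  by exists b; split=> //; exists 1; [exact: oner_neq0|rewrite scale1r].
have [b1 [e1 [c c0 o1]]] := etop_iter pB (i := i) (erefl (ell i (val b))).
have [b0 [e0 [d d0 o0]]] := IH b1; exists b0; split.
  by rewrite -e0 /etop_seq /= /etop e1.
exists (c * d); first exact: (mulf_neq0 c0 d0).
rewrite /= o1 (opw_same_scale _ (basis_Um pB (basis_val b1)) _ c0) ?o0 ?scalerA //.
exact: (basis_neq0 pB (basis_val b1)).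
Qed.

Lemma etop_seq_reach w (b : B) : omap val (etop_seq w b) = Some 1 <-> reach w (val b).
Proof.
have [b0 [-> [c c0 oE]]] := etop_seqE w b; rewrite /reach oE /=.
split=> [[->]|[d d0 e]]; first by exists c.
congr Some; apply: (basis_scalar pB (c := c^-1 * d) (basis_val b0)).
by rewrite -scalerA -e (scalerK c0).
Qed.

Lemma ftilP i (b b' : B) : ftil i b = Some b' <-> etil i b' = Some b.
Proof.
rewrite /ftil; split=> [|eb']; first by case: xgetP => [_ -> [b1 e1 <-] [<-]|//].
case: xgetP => [_ _ [b1 e1 <-]|/(_ (Some b'))]; last by case; exists b'.
congr Some; apply: val_inj; move: e1 eb' => /(etilP pB)[n1 a1] /(etilP pB)[n2 a2].
exact: (pb_inj pB (basis_val b1) (basis_val b') (basis_val b) n1 n2 a1 a2).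
Qed.
End OneBasis.

Lemma same_ell i w (x y : Uq) : Uminus y -> same (i :: w) x y -> ell i y = ell i x.
Proof.
move=> yU [[y0 _] /is_const_nz o0]; apply: ell_eq => // e.
by apply: o0; rewrite /= e opw0.
Qed.

Section Iso.
Variables (B1 B2 : set Uq).
Hypotheses (pB1 : perfect_basis B1) (pB2 : perfect_basis B2).

Definition matched (b b' : Uq) : Prop :=
  (exists2 u, homog u b & homog u b') /\ forall w, reach w b -> same w b b'.

Lemma matched_ex (b : B1) : exists p : B2 * {x : Qq | x != 0},
  matched (val b) (val p.1) /\
  forall w, reach w (val b) -> below w (val b) (val b - val p.2 *: val p.1).
Proof.
have bB := basis_val b; have [u hu] := basis_homog pB1 bB.
have [b' [B' hu' sb' [c c0 bel]]] := match_ex pB1 pB2 bB hu.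
exists ((SigSub (mem_set B') : B2), exist _ c c0); split; last exact: bel.
by split; [exists u|exact: sb'].
Qed.

Lemma matched_unique (b : B1) (b' b'' : B2) w : reach w (val b) ->
  matched (val b) (val b') -> same w (val b) (val b'') -> b' = b''.
Proof.
move=> rw [_ s'] s''; apply: val_inj.
exact: (same_unique pB2 (basis_val b') (basis_val b'') (s' w rw) s'').
Qed.

Lemma matched_wt (b : B1) (b' : B2) : matched (val b) (val b') -> wt b' = wt b.
Proof. by move=> [[u hu hu'] _]; rewrite (wtE pB1 hu) (wtE pB2 hu'). Qed.

(** Along a word beginning with i, the first entry of the common string is the exponent of i. *)
Lemma matched_ell i (b : B1) (b' : B2) : matched (val b) (val b') ->
  ell i (val b') = ell i (val b).
Proof.
move=> [[u hu _] sb]; apply: (@same_ell i (full_word u)).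
  exact: (basis_Um pB2 (basis_val b')).
by apply: sb; exact: (reach_full pB1 [:: i] (basis_val b) hu).
Qed.

(** Compatibility with f_i is checked on e_i. If e_i sends b1 to b, their tops in direction i are
    proportional, so one word i :: v reaches both; comparing strings along it shows that e_i (psi
    b1) matches b. *)
Lemma matched_crystal (psi : B1 -> B2) : (forall b, matched (val b) (val (psi b))) ->
  crystal_morphism (Some \o psi).
Proof.
move=> mpsi; split=> [b b' [<-]|i b b1].
  have wtE' := matched_wt (mpsi b); split=> // i.
  have epsE : eps i (psi b) = eps i b by rewrite /eps (matched_ell i (mpsi b)).
  by rewrite /phi epsE wtE'.
move=> /(ftilP pB1) eb1 /=; apply/(ftilP pB2).
have [nb1 ab1] := proj1 (etilP pB1 i b1 b) eb1.
have U1 := basis_Um pB1 (basis_val b1); have Ub := basis_Um pB1 (basis_val b).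
have U1' := basis_Um pB2 (basis_val (psi b1)).
have e1 : ed i (val b1) <> 0 by rewrite -eprimeE.
have [lb1 [c c0 iE]] := arrowP pB1 (basis_val b1) (basis_val b) ab1 e1.
have l1' := matched_ell i (mpsi b1).
have e1' : ed i (val (psi b1)) <> 0.
  by move=> /(ell_le i 0 U1'); rewrite l1' lb1.
have n1' : eprime i (val (psi b1)) <> 0 by rewrite eprimeE.
have [b2 [[bB2 ab2] _]] := pb_arrow pB2 (basis_val (psi b1)) n1'.
pose b2' : B2 := SigSub (mem_set bB2).
have [lb2 [d d0 iE']] := arrowP pB2 (basis_val (psi b1)) bB2 ab2 e1'.
suff -> : psi b = b2' by apply/(etilP pB2).
have l2 : ell i b2 = ell i (val b) by move: lb2; rewrite l1' lb1 => -[].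
have [[u hu _] _] := mpsi b.
pose w := i :: full_word u.
have rw : reach w (val b) := reach_full pB1 [:: i] (basis_val b) hu.
apply: (matched_unique rw (mpsi b)).
have ib1 : iter (ell i (val b1)) (ed i) (val b1) = c *: iter (ell i (val b)) (ed i) (val b).
  by rewrite lb1 iE.
have ib2 : iter (ell i (val b1)) (ed i) (val (psi b1)) = d *: iter (ell i (val b)) (ed i) b2.
  by rewrite -l2 -iE' // -lb2 l1'.
have ib0 : iter (ell i (val b)) (ed i) (val b) <> 0.
  by apply: ell_neq0 => //; exact: (basis_neq0 pB1 (basis_val b)).
have iU := Uminus_iter i (ell i (val b)) Ub.
have wc : weak (full_word u) (iter (ell i (val b)) (ed i) (val b))
    (c *: iter (ell i (val b)) (ed i) (val b)) by apply: weakZ; exact: weak_refl.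
have oc : opw (full_word u) (iter (ell i (val b)) (ed i) (val b))
   (c *: iter (ell i (val b)) (ed i) (val b)) <> 0.
  rewrite opwZ => /eqP; rewrite scaler_eq0 (negbTE c0) => /eqP.
  exact: is_const_nz rw.
(* Rescaling the reference vector by c leaves its string unchanged; this removes c from the
   reference vector in what follows. *)
have [h1 h2] := same_string (UminusZ c iU) wc oc.
have rw1 : reach w (val b1).
  rewrite /reach /= ib1 h2 opwZ; apply: (is_constZ c0); exact: rw.
have [_ /(_ w rw1)] := mpsi b1.
move=> [[_ w2] o2]; rewrite -/(weak (full_word u) _ _) in w2.
have {}o2 : is_const (opw (full_word u)
  (iter (ell i (val b1)) (ed i) (val b1))
  (iter (ell i (val b1)) (ed i) (val (psi b1)))) := o2.
rewrite ib1 ib2 h2 opwZ in o2; rewrite ib1 ib2 in w2; move/h1: w2 => w2.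
split=> /=.
  split; first by rewrite -l2; exact: (proj1 (ellP i (basis_Um pB2 bB2))).
  have /(weakZ d^-1) := w2; by rewrite scalerA (mulVf d0) scale1r.
have d0' : d^-1 != 0 by rewrite invr_eq0.
by have := is_constZ d0' o2; rewrite scalerA (mulVf d0) scale1r.
Qed.
End Iso.
End CrystalOfBasis.

Theorem theorem4p19 (I : countType) (P : zmodType) (D : bc_datum I P)
    (B B' : set (Uq D)) (hB : perfect_basis B) (hB' : perfect_basis B') :
  exists! p : (B -> B') * (nontrivial_part B -> {x : Qq | (x != 0)%R}),
    id_perfect_isomorphism p.1 p.2.
Proof.
have /choice[p hp] := matched_ex hB hB'; have /choice[p' hp'] := matched_ex hB' hB.
pose psi b := (p b).1; pose psi' b := (p' b).1.
pose c (n : nontrivial_part B) := (p (val n)).2.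
have mpsi b : matched (val b) (val (psi b)) by case: (hp b).
have mpsi' b : matched (val b) (val (psi' b)) by case: (hp' b).
have psiK (B1 B2 : set (Uq D)) (h1 : perfect_basis B1) (h2 : perfect_basis B2)
    (f : B1 -> B2) (g : B2 -> B1) : (forall b, matched (val b) (val (f b))) ->
    (forall b, matched (val b) (val (g b))) -> cancel f g.
  move=> mf mg b; have bB := basis_val b; have [u hu] := basis_homog h1 bB.
  have rw := reach_full h1 [::] bB hu.
  have [sb rb] := same_sym (basis_Um h1 bB) (basis_Um h2 (basis_val (f b))) rw
                           (proj2 (mf b) _ rw).
  exact: matched_unique h1 _ _ _ _ rb (mg (f b)) sb.
have psi1 b : val b = 1 -> val (psi b) = 1.
  (* The empty word already reaches 1, so its match is a scalar lying in B'. *)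
  move=> b1; have r1 : reach [::] (val b) by rewrite b1; exact: is_const1.
  have [_ /(_ _ r1)[_ [d d0 e]]] := mpsi b.
  exact: (basis_scalar hB' (basis_val (psi b)) e).
exists (psi, c); split=> [|[f d] [/= _ f1 fprec]].
  split=> //=.
  - split; first exact: (matched_crystal hB hB' mpsi).
    exact: Bijective (psiK B B' hB hB' _ _ mpsi mpsi') (psiK B' B hB' hB _ _ mpsi' mpsi).
  - move=> n i w /(etop_seq_reach hB) rw.
    have bB := basis_val (val n); have bU := basis_Um hB bB.
    apply/prec_below => //; first exact: (basis_neq0 hB bB).
      apply: UminusB => //; apply: UminusZ.
      exact: (basis_Um hB' (basis_val (psi (val n)))).
    exact: (proj2 (hp (val n)) _ rw).
have main (n : nontrivial_part B) : psi (val n) = f (val n) /\ c n = d n.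
  have bB := basis_val (val n); have bU := basis_Um hB bB.
  have b0 := basis_neq0 hB bB.
  have [u hu] := basis_homog hB bB.
  (* [prec] needs a nonempty sequence; an element other than 1 supplies a first letter. *)
  have [i iu _] := basis_nonsingular hB bB hu (elimN eqP (valP n)).
  have rw : reach (i :: full_word u) (val (val n)) := reach_full hB [:: i] bB hu.
  have := fprec n i (full_word u) (proj2 (etop_seq_reach hB _ _) rw).
  have fU := basis_Um hB' (basis_val (f (val n))).
  move=> /(prec_below i _ bU b0 (UminusB bU (UminusZ _ fU))).
  move: (full_word u) rw => v rw [wx ox].
  have d0 : val (d n) != 0 := valP (d n).
  (* Solving the hypothesis on (f, d) for the image of b exhibits it as a multiple of b plus a
     vector strictly below b; it therefore has the string of b and must be the match. *)
  have fE : val (f (val n)) = (val (d n))^-1 *: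
      (-1 *: (val (val n) - val (d n) *: val (f (val n))) + val (val n)).
    by rewrite scaleN1r opprB subrK (scalerK d0).
  have sf : same (i :: v) (val (val n)) (val (f (val n))).
    rewrite fE; split.
      by apply: weakZ; apply: weak_lin => //; exact: weak_refl.
    rewrite opwZ opw_lin ox scaler0 add0r; apply: is_constZ; last exact: rw.
    by rewrite invr_eq0.
  have pf := matched_unique hB' rw (mpsi (val n)) sf.
  split=> //; apply: val_inj; have [_ oc] := proj2 (hp (val n)) _ rw.
  rewrite -/(psi (val n)) -/(c n) in oc; rewrite -pf in ox.
  have lin e : opw (i :: v) (val (val n)) (val (val n) - e *: val (psi (val n))) =
      opw (i :: v) (val (val n)) (val (val n)) -
      e *: opw (i :: v) (val (val n)) (val (psi (val n))).
    by rewrite addrC -scaleNr opw_lin scaleNr addrC.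
  rewrite lin in oc; rewrite lin in ox.
  (* Both differences vanish at the end of the word, while the common image does not; hence the
     scalars agree. *)
  have : (val (c n) - val (d n)) *: opw (i :: v) (val (val n)) (val (psi (val n))) = 0.
    rewrite scalerBl; move/eqP: oc; rewrite subr_eq0 => /eqP <-.
    by move/eqP: ox; rewrite subr_eq0 => /eqP <-; rewrite subrr.
  move=> /eqP; rewrite scaler_eq0 subr_eq0 => /orP[/eqP //|/eqP o0].
  by case: (is_const_nz (proj2 sf)); rewrite -pf.
congr (_, _); apply/funext; last by move=> n; case: (main n).
move=> b; have [b1|b1] := eqVneq (val b) 1; first by apply: val_inj; rewrite /= psi1 // f1.
by case: (main (exist _ b b1)).
Qed.
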